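(* Let $G_\omega$ be a weighted tree (a weighted graph whose underlying graph $G$ is a tree), let $r\ge 1$ be an integer, and let $A$ be a field. Then the following conditions are equivalent: (i) $I_r(G_\omega)$ is Cohen-Macaulay; (ii) $I_r(G_\omega)$ is m-unmixed; and (iii) there is a weighted tree $\Gamma_\mu$ and a (weighted) $r$-path suspension $H_\lambda$ of $\Gamma_\mu$ such that $H_\lambda$ is obtained by pruning a sequence of $r$-pathless leaves from $G_\omega$ and for all $v_iv_j\in E(\Gamma_\mu)$ we have $\omega(v_iv_j)\leq\min\{\omega(v_iy_{i,1}),\omega(v_jy_{j,1})\}$.
   Context: $\mathbb{N}=\{1,2,\dots\}$. Graphs are finite, simple, with non-empty vertex set. A weighted graph $G_\omega$ is a graph $G$ with vertex set $V=\{v_1,\dots,v_n\}$ ($n\geq 1$) and edge set $E$, together with a function $\omega\colon E\to\mathbb{N}$; an induced weighted subgraph carries the restricted weights. An $r$-path in $G$ is a sequence $v_{i_1}\dots v_{i_{r+1}}$ of distinct vertices such that $v_{i_j}v_{i_{j+1}}\in E$ for $j=1,\dots,r$. $S=A[X_1,\dots,X_n]$. The weighted $r$-path ideal $I_r(G_\omega)$ is the ideal of $S$ generated by the monomials $X_{i_1}^{e_{i_1}}\cdots X_{i_{r+1}}^{e_{i_{r+1}}}$, one for each $r$-path $v_{i_1}\dots v_{i_{r+1}}$ in $G$, where $e_{i_1}=\omega(v_{i_1}v_{i_2})$, $e_{i_j}=\max\{\omega(v_{i_{j-1}}v_{i_j}),\omega(v_{i_j}v_{i_{j+1}})\}$ for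 $1<j\leq r$, and $e_{i_{r+1}}=\omega(v_{i_r}v_{i_{r+1}})$. An ideal $I\subseteq S$ is called Cohen-Macaulay when the ring $S/I$ is Cohen-Macaulay. For $W\subseteq V$ and $\sigma\colon W\to\mathbb{N}$ set $P_{(W,\sigma)}=(X_i^{\sigma(v_i)}\mid v_i\in W)S$. Every monomial ideal $I$ of $S$ has a unique (up to order) irredundant decomposition $I=\bigcap_{k=1}^t P_{(W_k,\sigma_k)}$, irredundant meaning that no ideal in the decomposition is contained in another. $I$ is m-unmixed if all the $W_k$ in this decomposition have the same cardinality (over a field this is equivalent to $I$ being unmixed). An $r$-pathless leaf of $G_\omega$ is a vertex $v_i$ of degree 1 in $G$ that is not a part of any $r$-path in $G$; pruning it means passing to the weighted subgraph induced by $V\smallsetminus\{v_i\}$. A weighted subgraph of $G_\omega$ is obtained by pruning a sequence of $r$-pathless leaves from $G_\omega$ if it is the last term of a finite sequence of weighted graphs $G_\omega=G^{(0)}_{\omega^{(0)}},G^{(1)}_{\omega^{(1)}},\dots,G^{(l)}_{\omega^{(l)}}$ in which each $G^{(i+1)}_{\omega^{(i+1)}}$ is obtained by pruning an $r$-pathless leaf from $G^{(i)}_{\omega^{(i)}}$. The $r$-path suspension of an unweighted graph $\Gamma$ is the graph obtained by adding a new path of length $r$ to each vertex of $\Gamma$. A weighted graph $H_\lambda$ is a weighted $r$-path suspension of $\Gamma_\mu$ if $H$ is an $r$-path suspension of $\Gamma$. The notation is: (after renaming vertices) $V(\Gamma)=\{v_1,\dots,v_\beta\}$, the vertex set of $H$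 consists of the distinct vertices $v_i,y_{i,1},\dots,y_{i,r}$ for $i=1,\dots,\beta$, the new path attached to $v_i$ is $v_iy_{i,1}\dots y_{i,r}$ with $\deg(y_{i,k})=2$ for $k=1,\dots,r-1$ and $\deg(y_{i,r})=1$ in $H$, and $\Gamma$ is the subgraph of $H$ induced by $\{v_1,\dots,v_\beta\}$.
   Formalization: The formal theorem assumes that G has at least one r-path (so I_r is nonzero); without r-paths (e.g. a single vertex) I_r = 0 is Cohen-Macaulay and m-unmixed, but (iii) fails because a suspension of a non-empty tree contains an r-path. *)

(* Defs.v *)
From HB Require Import structures.
From mathcomp Require Import all_boot all_order all_algebra.
From mathcomp Require Import ring_quotient.
From mathcomp Require Import boolp.
From mathcomp Require Import mpoly.

Set Implicit Arguments.
Unset Strict Implicit.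
Unset Printing Implicit Defensive.

Import GRing.Theory.
Local Open Scope ring_scope.

(* Ideals are elements of {pred R}; by excluded middle this loses none of them.
   idealr_closed requires 1 \notin J, so it describes proper ideals. *)

(* The ideal generated by the elements g i for i satisfying P. *)
Definition gen_ideal (R : comNzRingType) (I : finType) (P : pred I) (g : I -> R)
  : {pred R} :=
  fun x => `[< exists c : I -> R, x = \sum_(i | P i) c i * g i >].

Definition prime_ideal (R : comNzRingType) (P : {pred R}) : Prop :=
  idealr_closed P /\ prime_idealr_closed P.

Definition maximal_ideal (R : comNzRingType) (M : {pred R}) : Prop :=
  idealr_closed M /\
  forall J : {pred R}, idealr_closed J -> {subset M <= J} -> {subset J <= M}.

Definition regular_sequence (R : comNzRingType) (d : nat) (x : 'I_d -> R) : Prop :=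
  1 \notin gen_ideal xpredT x /\
  forall (i : 'I_d) (a : R),
    x i * a \in gen_ideal (fun j : 'I_d => (j < i)%N) x ->
    a \in gen_ideal (fun j : 'I_d => (j < i)%N) x.

Definition regular_sequence_in (R : comNzRingType) (J : {pred R}) (d : nat) : Prop :=
  exists x : 'I_d -> R, regular_sequence x /\ forall i, x i \in J.

Definition has_depth (R : comNzRingType) (J : {pred R}) (d : nat) : Prop :=
  regular_sequence_in J d /\
  forall k, regular_sequence_in J k -> (k <= d)%N.

Definition prime_chain_to (R : comNzRingType) (P : {pred R}) (d : nat) : Prop :=
  exists Q : nat -> {pred R},
    [/\ Q d =i P,
        forall k, (k <= d)%N -> prime_ideal (Q k),
        forall k, (k < d)%N -> {subset Q k <= Q k.+1}
      & forall k, (k < d)%N -> ~ {subset Q k.+1 <= Q k}].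

Definition has_height (R : comNzRingType) (P : {pred R}) (d : nat) : Prop :=
  prime_chain_to P d /\
  forall k, prime_chain_to P k -> (k <= d)%N.

(* For a Noetherian ring R (every quotient of a polynomial ring in finitely many
   variables over a field is one): depth (M, R) = codim M for every maximal
   ideal M, which is the definition in Eisenbud, Commutative Algebra, 18.2. *)
Definition cohen_macaulay (R : comNzRingType) : Prop :=
  forall M : {pred R}, maximal_ideal M ->
    exists d : nat, has_depth M d /\ has_height M d.

Definition bundled_ideal (R : comNzRingType) (J : {pred R})
  (hJ : idealr_closed J) : {pred R} := J.

HB.instance Definition _ (R : comNzRingType) (J : {pred R})
  (hJ : idealr_closed J) := isIdealr.Build R (bundled_ideal hJ) hJ.

(* MathComp forms the ring R / J only for a proper ideal J. *)
Definition cohen_macaulay_ideal (R : comNzRingType) (J : {pred R}) : Prop :=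
  exists hJ : idealr_closed J, cohen_macaulay {ideal_quot (bundled_ideal hJ)}.

(* A weighted graph with vertex set T. The values of weight outside the edges
   are irrelevant; non-emptiness of T is part of is_tree below. *)
Record wgraph (T : finType) := WGraph {
  adj : rel T;
  adj_sym : ssrbool.symmetric adj;
  adj_irr : ssrbool.irreflexive adj;
  weight : T -> T -> nat;
  weight_sym : forall x y, weight x y = weight y x;
  weight_gt0 : forall x y, adj x y -> (0 < weight x y)%N }.

Section Graphs.
Variable T : finType.
Implicit Type G : wgraph T.

Definition is_tree G : Prop :=
  [/\ (0 < #|T|)%N,
      forall x y, connect (adj G) x y
    & forall c : seq T, (2 < size c)%N -> ~ ucycle (adj G) c].

Definition degree G (x : T) : nat := #|[set y | adj G x y]|.

(* p ord0, ..., p ord_max is an r-path. *)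
Definition is_rpath (r : nat) G (p : {ffun 'I_r.+1 -> T}) : bool :=
  injectiveb p && [forall j : 'I_r, adj G (p (inord j)) (p (inord j.+1))].

Definition path_exponent (r : nat) G (p : {ffun 'I_r.+1 -> T}) (j : 'I_r.+1) : nat :=
  if j == 0%N :> nat then weight G (p (inord 0)) (p (inord 1))
  else if j == r :> nat then weight G (p (inord r.-1)) (p (inord r))
  else maxn (weight G (p (inord j.-1)) (p j)) (weight G (p j) (p (inord j.+1))).

Definition pathless_leaf (r : nat) G (v : T) : Prop :=
  degree G v = 1%N /\ forall p, is_rpath (r := r) G p -> forall j, p j <> v.

End Graphs.

Section Induced.
Variables (T : finType) (G : wgraph T) (W : {set T}).
Let VW := {x : T | x \in W}.

Definition induced : wgraph VW :=
  @WGraph VW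
    (fun x y : VW => adj G (val x) (val y))
    (fun x y => adj_sym G (val x) (val y))
    (fun x => adj_irr G (val x))
    (fun x y : VW => weight G (val x) (val y))
    (fun x y => weight_sym G (val x) (val y))
    (fun x y => @weight_gt0 T G (val x) (val y)).

End Induced.

(* induced G W is obtained by pruning a sequence of r-pathless leaves from G. *)
Inductive pruned (r : nat) (T : finType) (G : wgraph T) : {set T} -> Prop :=
| pruned_none : pruned r G [set: T]
| pruned_leaf (W : {set T}) (v : {x : T | x \in W}) :
    pruned r G W -> pathless_leaf r (induced G W) v -> pruned r G (W :\ val v).

(* H is a weighted r-path suspension of Gamma: s i ord0 is the vertex v_i of
   Gamma inside H, and s i (inord k) is y_(i,k) for 0 < k <= r. *)
Record path_suspension (r b : nat) (T : finType) (Gamma : wgraph 'I_b)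
    (H : wgraph T) (s : 'I_b -> 'I_r.+1 -> T) : Prop := PathSuspension {
  susp_vertices : bijective (fun u : 'I_b * 'I_r.+1 => s u.1 u.2);
  susp_path : forall i (k : nat), (k < r)%N ->
    adj H (s i (inord k)) (s i (inord k.+1));
  susp_inner_degree : forall i (k : nat), (0 < k < r)%N ->
    degree H (s i (inord k)) = 2%N;
  susp_end_degree : forall i, degree H (s i ord_max) = 1%N;
  susp_base_adj : forall i j, adj H (s i ord0) (s j ord0) = adj Gamma i j;
  susp_base_weight : forall i j, adj Gamma i j ->
    weight H (s i ord0) (s j ord0) = weight Gamma i j }.

Definition path_ideal (A : fieldType) (n r : nat) (G : wgraph 'I_n)
  : {pred {mpoly A[n]}} :=
  gen_ideal (fun p => is_rpath (r := r) G p)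
    (fun p => \prod_(j < r.+1) 'X_(p j) ^+ path_exponent G p j).

Definition P_ideal (A : fieldType) (n : nat) (W : {set 'I_n}) (sigma : 'I_n -> nat)
  : {pred {mpoly A[n]}} :=
  gen_ideal (fun i => i \in W) (fun i => 'X_i ^+ sigma i).

Arguments path_ideal A {n} r G.
Arguments P_ideal A {n} W sigma.

(* sigma k is only used on W k. *)
Definition irredundant_decomposition (A : fieldType) (n : nat)
    (J : {pred {mpoly A[n]}}) (t : nat) (W : 'I_t -> {set 'I_n})
    (sigma : 'I_t -> 'I_n -> nat) : Prop :=
  [/\ forall k i, i \in W k -> (0 < sigma k i)%N,
      forall f, f \in J <-> forall k, f \in P_ideal A (W k) (sigma k)
    & forall k l, k != l ->
        ~ {subset P_ideal A (W k) (sigma k) <= P_ideal A (W l) (sigma l)}].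

(* The irredundant decomposition of a monomial ideal is unique up to order. *)
Definition m_unmixed (A : fieldType) (n : nat) (J : {pred {mpoly A[n]}}) : Prop :=
  exists (t : nat) (W : 'I_t -> {set 'I_n}) (sigma : 'I_t -> 'I_n -> nat),
    irredundant_decomposition J W sigma /\
    forall k l, #|W k| = #|W l|.

(* Main.v *)
(* (i) => (ii). The irredundant components P_(W, c) of the path ideal I are the
   minimal covers c of the paths, with support W. The primes containing the
   variables in W form a chain of length n - |W| ending at the homogeneous maximal
   ideal. Regular sequences in that ideal have length at most n - |W|, since
   there is a monomial outside I whose product with any variable in W lies in I,
   while, by counting monomials, more than n - |W| polynomials satisfy a
   polynomial relation modulo the variables in W. Hence n - |W| is the depth and
   the height for every component.

   (ii) => (iii). Root the tree at a vertex on a path. A greedy choice from the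
   bottom gives disjoint paths and a transversal with as many vertices. As all
   minimal transversals are minimal covers, hence of equal size, each of them
   consists of one vertex on each chosen path. So the chosen paths cover all
   vertices that lie on paths, and only one end of each is joined to others: in
   each other case two vertices of a chosen path lie on a common minimal
   transversal. A cover that is too large gives the inequality of the weights.

   (iii) => (i). Let a(v) be the exponent of v in the monomial of its whisker. In
   the monomial of any path, v has exponent at most a(v), and if v occurs in it,
   every vertex u between v and the base of the whisker has exponent a(u). So S/I
   has a filtration whose factors are quotients of S by one variable for each whisker.
   For a maximal ideal M of S containing I, Zariski's lemma provides for each of
   the n - b linear forms y_(i,k-1) - y_(i,k) and X_v, v on no whisker, a monic
   polynomial in it that lies in M. They are a regular sequence on each factor,
   hence on S/I, and n - b bounds the length of the chains of primes. *)
Require Import Defs.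
From HB Require Import structures.
From mathcomp Require Import all_boot all_order all_algebra.
From mathcomp Require Import mpoly boolp ring_quotient.
From mathcomp Require Import ring zify.
From mathcomp Require classical_sets.
Set Implicit Arguments.
Unset Strict Implicit.
Unset Printing Implicit Defensive.
Import GRing.Theory.

(** * Regular sequences *)

Section Ideals.
Local Open Scope ring_scope.
Variable R : comNzRingType.
Implicit Types (J K : R -> Prop) (x u : R) (xs : seq R).

(** No ring is localized. Both upper bounds, on prime chains and on regular sequences, come from one
    elimination, [box_eval_strip]: a relation modulo the variables in W, multiplied by a suitable z,
    lies in the first of a sequence of ideals, and stripping its lowest terms pushes z into the last
    one. A regular sequence inside a prime yields a prime chain below it, so depth never exceeds
    height. The Cohen-Macaulay condition ranges over all maximal ideals and A is any field: a
    maximal ideal need not contain theta - a for a scalar a, only a monic polynomial in theta. Such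
    polynomials are handled by a translation that moves theta to a free variable T, because a monic
    polynomial in T is a nonzerodivisor modulo every extended ideal. From (ii) only the equal size
    of the supports of minimal covers is kept. A minimal transversal, taken with exponents 1,
    refines to a minimal cover with the same support, so the shape of the tree is found without its
    weights. Rooting at a vertex on a path makes the set of all vertices on paths closed under
    parents; hence it is connected, and removing deepest vertices outside it is a pruning. *)

Definition is_ideal J := J 0 /\ forall a u v, J u -> J v -> J (a * u + v).

Definition adjoin J x : R -> Prop := fun f => exists b, J (f - x * b).

Definition colon J u : R -> Prop := fun f => J (f * u).

(* A regular sequence on R / J, without the condition that J and xs generate a
   proper ideal. *)
Fixpoint weakly_regular J xs : Prop :=
  if xs is x :: xs' then
    (forall a, J (x * a) -> J a) /\ weakly_regular (adjoin J x) xs'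
  else True.

Lemma predP_eq (T : Type) (P Q : T -> Prop) : (forall t, P t <-> Q t) -> P = Q.
Proof. by move=> PQ; apply/funext => t; apply/propext. Qed.

Section OneIdeal.
Variables (J : R -> Prop) (hJ : is_ideal J).

Lemma ideal0 : J 0. Proof. by case: hJ. Qed.

Lemma idealM a u : J u -> J (a * u).
Proof. by case: hJ => J0 JD Ju; rewrite -[a * u]addr0; apply: JD. Qed.

Lemma idealMr a u : J u -> J (u * a).
Proof. by rewrite mulrC; apply: idealM. Qed.

Lemma idealD u v : J u -> J v -> J (u + v).
Proof. by case: hJ => J0 JD Ju Jv; rewrite -[u]mul1r; apply: JD. Qed.

Lemma idealN u : J u -> J (- u).
Proof. by rewrite -mulN1r; apply: idealM. Qed.

Lemma idealB u v : J u -> J v -> J (u - v).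
Proof. by move=> Ju /idealN; apply: idealD. Qed.

Lemma idealDr u v : J v -> J (u + v) <-> J u.
Proof.
move=> Jv; split=> [Juv|Ju]; last exact: idealD.
by rewrite -[u](addrK v); apply: idealB.
Qed.

Lemma ideal_sum (I : Type) (s : seq I) (P : pred I) (F : I -> R) :
  (forall i, P i -> J (F i)) -> J (\sum_(i <- s | P i) F i).
Proof. by move=> JF; apply: big_ind => //; [apply: ideal0 | apply: idealD]. Qed.

Lemma adjoin_ideal x : is_ideal (adjoin J x).
Proof.
split=> [|a u v [b Jb] [c Jc]]; first by exists 0; rewrite mulr0 subr0; apply: ideal0.
exists (a * b + c); have -> : a * u + v - x * (a * b + c) = a * (u - x * b) + (v - x * c) by ring.
by apply: idealD => //; apply: idealM.
Qed.

Lemma sub_adjoin x f : J f -> adjoin J x f.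
Proof. by exists 0; rewrite mulr0 subr0. Qed.

Lemma mem_adjoin x : adjoin J x x.
Proof. by exists 1; rewrite mulr1 subrr; apply: ideal0. Qed.

End OneIdeal.

Lemma adjoinC J x y : is_ideal J -> adjoin (adjoin J x) y = adjoin (adjoin J y) x.
Proof.
by move=> hJ; apply: predP_eq => f; split=> -[b [c Jbc]]; exists c; exists b; rewrite addrAC.
Qed.

Lemma weakly_regular_total J xs : is_ideal J -> (forall f, J f) -> weakly_regular J xs.
Proof.
elim: xs J => //= x xs IH J hJ JT; split=> //.
by apply: IH; [apply: adjoin_ideal | move=> f; apply: sub_adjoin].
Qed.

(* Long exact sequence argument for 0 -> R/(J:u) -> R/J -> R/(J,u) -> 0. *)
Lemma weakly_regular_colon J u xs : is_ideal J ->
  weakly_regular (colon J u) xs -> weakly_regular (adjoin J u) xs -> weakly_regular J xs.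
Proof.
elim: xs J => //= x xs IH J hJ [rc hc] [ra ha]; split.
  move=> a Jxa; have [b Jb] : adjoin J u a by apply/ra/sub_adjoin.
  have Jub : J (u * b).
    rewrite mulrC; apply: rc; rewrite /colon.
    have -> : x * b * u = x * a - x * (a - u * b) by ring.
    by apply: idealB => //; apply: idealM.
  by rewrite -[a](subrK (u * b)); apply: idealD.
apply: IH; [exact: adjoin_ideal | | by rewrite adjoinC].
(* Regularity of x modulo J + (u) makes the colon by u commute with adjoining x: if f u - x b is in
   J, then x b, hence b, is in J + (u). *)
suff -> : colon (adjoin J x) u = adjoin (colon J u) x by [].
apply: predP_eq => f; split=> [[b Jb]|[b Jb]]; last first.
  by exists (b * u); have -> : f * u - x * (b * u) = (f - x * b) * u by ring.
have [d Jd] : adjoin J u b.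
  apply: ra; exists f.
  by rewrite -opprB [u * f]mulrC; apply: idealN.
exists d; rewrite /colon.
have -> : (f - x * d) * u = (f * u - x * b) + x * (b - u * d) by ring.
by apply: idealD => //; apply: idealM.
Qed.

(** By induction on k: R/(J, x^(k+1)) is an extension of R/(J, x) by R/(J, x^k), the colon by x
    being (J, x^k). Powers serve later to push an ideal above a given degree. *)
Lemma weakly_regular_exp J xs k : is_ideal J -> weakly_regular J xs ->
  weakly_regular J [seq x ^+ k | x <- xs].
Proof.
elim: xs J => //= x xs IH J hJ [rx hx]; split.
  by elim: k {IH} => [|k IHk] a; [rewrite mul1r | rewrite exprS -mulrA => /rx /IHk].
apply: IH; first exact: adjoin_ideal.
elim: k => [|k IHk].
  (* The power x^0 gives the unit ideal, which [is_ideal] admits. *)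
  apply: weakly_regular_total; first exact: adjoin_ideal.
  by move=> f; exists f; rewrite mul1r subrr; apply: ideal0.
apply: (@weakly_regular_colon _ x); first exact: adjoin_ideal.
  suff -> : colon (adjoin J (x ^+ k.+1)) x = adjoin J (x ^+ k) by [].
  apply: predP_eq => f; split=> [[b Jb]|[b Jb]]; exists b.
    apply: rx; have -> : x * (f - x ^+ k * b) = f * x - x ^+ k.+1 * b by rewrite exprS; ring.
    exact: Jb.
  have -> : f * x - x ^+ k.+1 * b = x * (f - x ^+ k * b) by rewrite exprS; ring.
  exact: (idealM hJ).
suff -> : adjoin (adjoin J (x ^+ k.+1)) x = adjoin J x by [].
apply: predP_eq => f; split=> [[b [c Jc]]|[b Jb]].
  exists (b + x ^+ k * c).
  by have -> : f - x * (b + x ^+ k * c) = f - x * b - x ^+ k.+1 * c by rewrite exprS; ring.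
by exists b; apply: sub_adjoin.
Qed.

Lemma foldl_adjoin_ideal J xs : is_ideal J -> is_ideal (foldl adjoin J xs).
Proof. by elim: xs J => //= x xs IH J hJ; apply/IH/adjoin_ideal. Qed.

(** Links the recursive form, suited to induction, with the indexed form of [regular_sequence]. *)
Lemma weakly_regular_take J xs : is_ideal J -> weakly_regular J xs <->
  forall i, (i < size xs)%N -> forall a,
    foldl adjoin J (take i xs) (nth 0 xs i * a) -> foldl adjoin J (take i xs) a.
Proof.
elim: xs J => //= x xs IH J hJ; split=> [[rx /(IH _ (adjoin_ideal hJ x)) hx] [|i]|h] //=.
  by rewrite ltnS => /hx.
split; first exact: (h 0%N).
by apply/(IH _ (adjoin_ideal hJ x)) => i isz; apply: (h i.+1).
Qed.

End Ideals.

(** * Prime ideals and chains of primes *)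

Section Primes.
Local Open Scope ring_scope.
Variable R : comNzRingType.
Implicit Types (J K : R -> Prop) (x u : R) (xs : seq R).

Definition is_prime J :=
  [/\ is_ideal J, ~ J 1 & forall u v, J (u * v) -> J u \/ J v].

Lemma prime_exp_avoid J x k : is_prime J -> J (x ^+ k) -> J x.
Proof.
by case=> hJ J1 JM; elim: k => [//|k IHk]; rewrite exprS => /JM[].
Qed.

(** Krull's argument: an ideal maximal among those that contain J and avoid the multiplicative set T
    is prime. *)
Lemma exists_prime_avoiding J (T : R -> Prop) : is_ideal J ->
  T 1 -> (forall u v, T u -> T v -> T (u * v)) -> (forall f, J f -> ~ T f) ->
  exists Q, [/\ is_prime Q, forall f, J f -> Q f & forall f, Q f -> ~ T f].
Proof.
move=> hJ T1 TM JT.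
pose good K := [/\ is_ideal K, forall f, J f -> K f & forall f, K f -> ~ T f].
pose le (s t : {K : R -> Prop | good K}) := `[< forall f, sval s f -> sval t f >].
have [||||[Q [hQ JQ QT]] Qmax] := @classical_sets.Zorn _ le.
- by move=> s; apply/asboolP.
- by move=> r s t /asboolP rs /asboolP st; apply/asboolP => f /rs /st.
- move=> [K gK] [L gL] /asboolP /= KL /asboolP /= LK.
  have E : K = L by apply: predP_eq => f; split; [apply: KL | apply: LK].
  by subst L; congr exist; apply: Prop_irrelevance.
- move=> A totA.
  (* J is put in by hand so that the empty chain has an upper bound too. *)
  pose U f := J f \/ exists2 s, A s & sval s f.
  have dir f g : U f -> U g -> exists K, [/\ good K, K f, K g & forall h, K h -> U h].
    move=> [Jf|[s As sf]] [Jg|[t At tg]].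
    + by exists J; split=> // h Jh; left.
    + exists (sval t); split=> //; first exact: (svalP t); last by right; exists t.
      by have [_ h _] := svalP t; apply: h.
    + exists (sval s); split=> //; first exact: (svalP s); last by right; exists s.
      by have [_ h _] := svalP s; apply: h.
    + have [/asboolP st|/asboolP ts] := totA s t As At.
        exists (sval t); split=> //; [exact: (svalP t)|exact: st|by right; exists t].
      exists (sval s); split=> //; [exact: (svalP s)|exact: ts|by right; exists s].
  have gU : good U.
    split=> [|f Jf|f Uf]; [split | by left | ].
    + by left; case: hJ.
    + move=> a u v Uu Uv; have [K [[hK _ _] Ku Kv KU]] := dir _ _ Uu Uv.
      by apply: KU; apply: (idealD hK) => //; apply: (idealM hK).
    + by have [K [[_ _ KT] Kf _ _]] := dir _ _ Uf Uf; apply: KT.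
  by exists (exist _ U gU) => s As; apply/asboolP => f sf; right; exists s.
exists Q; split=> //; split=> //; first by move=> /QT; apply.
move=> u v Quv; apply: contrapT => /not_orP[Qu Qv].
have meet w : ~ Q w -> exists2 t, T t & adjoin Q w t.
  move=> Qw; apply: contrapT => nex.
  have gw : good (adjoin Q w).
    split=> [|f /JQ|f Qf Tf]; [exact: adjoin_ideal | exact: sub_adjoin | ].
    by apply: nex; exists f.
  have /(Qmax (exist _ _ gw)) [] : le (exist _ Q (And3 hQ JQ QT)) (exist _ _ gw).
    by apply/asboolP => f; apply: sub_adjoin.
  by move=> E; apply: Qw; rewrite -E; apply: mem_adjoin.
(* With u and v outside Q, both Q + (u) and Q + (v) meet T; the product of the two elements found
   lies in Q, as u v does. *)
have [t1 Tt1 [b Qb]] := meet _ Qu; have [t2 Tt2 [c Qc]] := meet _ Qv.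
apply: (QT (t1 * t2)); last exact: TM.
have -> : t1 * t2 = t2 * (t1 - u * b) + u * b * (t2 - v * c) + b * c * (u * v) by ring.
by apply: (idealD hQ); first apply: (idealD hQ); apply: idealM.
Qed.

(* Q avoids the multiplicative set of all s * x ^+ k with s outside P. *)
Lemma exists_prime_below J P x : is_ideal J -> is_prime P ->
  (forall f, J f -> P f) -> (forall a, J (x * a) -> J a) ->
  exists Q, [/\ is_prime Q, forall f, J f -> Q f, forall f, Q f -> P f & ~ Q x].
Proof.
move=> hJ [hP P1 PM] JP rx.
pose T f := exists s k, ~ P s /\ f = s * x ^+ k.
have [||f Jf [s [k [Ps def_f]]]|Q [pQ JQ QT]] := @exists_prime_avoiding J T hJ.
- by exists 1, 0%N; rewrite mulr1.
- move=> _ _ [s [k [Ps ->]]] [t [l [Pt ->]]].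
  exists (s * t), (k + l)%N; split; first by case/PM.
  by rewrite exprD mulrACA.
- apply: Ps; apply: JP; move: Jf; rewrite {}def_f mulrC.
  by elim: k => [|k IHk]; rewrite ?mul1r // exprS -mulrA => /rx.
exists Q; split=> // [f Qf|Qx].
  by apply: contrapT => Pf; apply: (QT f Qf); exists f, 0%N; rewrite mulr1.
by apply: (QT x Qx); exists 1, 1%N; rewrite mul1r.
Qed.

Definition chain_below J P d :=
  exists Q : nat -> R -> Prop,
    [/\ Q d = P, forall f, J f -> Q 0%N f,
        forall k, (k <= d)%N -> is_prime (Q k),
        forall k, (k < d)%N -> forall f, Q k f -> Q k.+1 f
      & forall k, (k < d)%N -> exists2 f, Q k.+1 f & ~ Q k f].

(** Each element x lengthens the chain by one: the chain for the tail starts at a prime that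
    contains x, and since x is regular modulo J, a prime over J that avoids x lies below it. *)
Lemma weakly_regular_chain J P xs : is_ideal J -> is_prime P ->
  (forall f, J f -> P f) -> (forall x, x \in xs -> P x) -> weakly_regular J xs ->
  chain_below J P (size xs).
Proof.
move=> + pP; elim: xs J => [|x xs IH] J hJ JP xsP /=.
  by move=> _; exists (fun=> P); split.
have [hP P1 PM] := pP.
case=> rx; case/(IH _ (adjoin_ideal hJ x)) => [f [b /JP Pf]|y yxs|Q [Qd JQ pQ Qinc Qprop]].
- rewrite -[f](subrK (x * b)); apply: idealD => //; apply: idealMr => //.
  by apply: xsP; rewrite mem_head.
- by apply: xsP; rewrite inE yxs orbT.
have [|Q0 [pQ0 JQ0 Q0Q Q0x]] := @exists_prime_below J (Q 0%N) x hJ (pQ _ (leq0n _)) _ rx.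
  by move=> f Jf; apply/JQ/sub_adjoin.
exists (fun k => if k is k'.+1 then Q k' else Q0); split=> //.
- by case=> // k; rewrite ltnS; apply: pQ.
- by case=> [_|k]; [exact: Q0Q | apply: Qinc].
- case=> [_|k]; last by apply: Qprop.
  by exists x => //; apply/JQ/mem_adjoin.
Qed.

Section PredIdeals.
Implicit Types (M P : {pred R}).

Lemma idealr_closedP M : idealr_closed M <-> is_ideal (fun f => f \in M) /\ 1 \notin M.
Proof.
by split=> [[M0 M1 Mlin]|[[M0 Mlin] M1]]; split.
Qed.

Lemma prime_idealP P : prime_ideal P <-> is_prime (fun f => f \in P).
Proof.
split=> [[/idealr_closedP[hP P1] pP]|[hP /negP P1 PM]].
  by split=> // [|u v /pP /orP]; first exact/negP.
by split; [apply/idealr_closedP | move=> u v /PM /orP].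
Qed.

Lemma maximal_prime M : maximal_ideal M -> prime_ideal M.
Proof.
case=> /idealr_closedP[hM M1] maxM; apply/prime_idealP; split=> //; first exact/negP.
move=> u v Muv; apply: contrapT => /not_orP[Mu Mv].
have one : adjoin (fun f => f \in M) u 1.
  apply: contrapT => n1; apply: Mu.
  apply: (maxM [pred f | `[< adjoin (fun f => f \in M) u f >]]).
  - apply/idealr_closedP; split; last by apply/negP => /asboolP.
    have [h0 hD] := adjoin_ideal hM u.
    by split=> [|a f g /asboolP Jf /asboolP Jg]; apply/asboolP => //; apply: hD.
  - by move=> f Mf; apply/asboolP/sub_adjoin.
  - by apply/asboolP/mem_adjoin.
have [b Mb] := one; apply: Mv.
have -> : v = v * (1 - u * b) + b * (u * v) by ring.
by apply: (idealD hM); apply: (idealM hM).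
Qed.

Lemma prime_chain_toP P d : prime_chain_to P d <-> chain_below (fun f => f = 0) (fun f => f \in P) d.
Proof.
split=> [[Q [Qd pQ Qinc Qprop]]|[Q [Qd Q0 pQ Qinc Qprop]]].
  exists (fun k f => f \in Q k); split=> [|f ->|k /pQ /prime_idealP|k /Qinc h f|k /Qprop nsub] //.
  - by apply: predP_eq => f; rewrite Qd.
  - by have /prime_idealP[[]] := pQ 0%N isT.
  - exact: h.
  - by apply: contrapT => nex; apply: nsub => f Qf; apply: contrapT => nQf; apply: nex; exists f.
exists (fun k f => `[< Q k f >]); split.
- by move=> f; rewrite unfold_in /= Qd; apply/asboolP/idP.
- move=> k /pQ; rewrite prime_idealP; congr is_prime.
  by apply: predP_eq => f; split=> [Qf|/asboolP]; first exact/asboolP.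
- by move=> k /Qinc h f /asboolP Qf; apply/asboolP/h.
- move=> k /Qprop[f Qf nQf] sub; apply: nQf; apply/asboolP/sub.
  exact/asboolP.
Qed.

End PredIdeals.
End Primes.

(** * Algebraic dependence and the lengths of prime chains *)

Section BoxPolynomials.
Local Open Scope ring_scope.
Variables (A : fieldType) (R : comNzRingType) (phi : {rmorphism A -> R}) (N : nat).
Implicit Types (x z : R) (xs : seq R) (c : seq nat -> A) (l : seq nat).

(* The value at xs of the polynomial in size xs variables whose coefficient at
   the exponent vector l is c l, for the l with all entries below N. *)
Fixpoint box_eval xs c : R :=
  if xs is x :: xs' then \sum_(k < N) x ^+ k * box_eval xs' (fun l => c (nat_of_ord k :: l))
  else phi (c [::]).

Definition box_nonzero d c := exists l, [/\ size l = d, all (fun k => k < N)%N l & c l != 0].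

Lemma box_eval0 xs c : ~ box_nonzero (size xs) c -> box_eval xs c = 0.
Proof.
elim: xs c => [|x xs IH] c nz /=.
  have -> : c [::] = 0; last exact: rmorph0.
  by apply: contrapT => /eqP c0; apply: nz; exists [::].
apply: big1 => k _; rewrite IH ?mulr0 // => -[l [sz lN cl]].
by apply: nz; exists (nat_of_ord k :: l); split=> //=; rewrite ?sz // ltn_ord.
Qed.

Lemma lowest_term x k (F : nat -> R) : (k < N)%N -> (forall j, (j < k)%N -> F j = 0) ->
  exists y, \sum_(i < N) x ^+ i * F i = x ^+ k * (F k + x * y).
Proof.
move=> kN F0; exists (\sum_(k.+1 <= i < N) x ^+ (i - k.+1) * F i).
rewrite -(big_mkord xpredT (fun i => x ^+ i * F i)) (@big_cat_nat _ _ _ k) //=; last exact: ltnW.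
rewrite big_nat big1 ?add0r => [|i /F0 ->]; last by rewrite mulr0.
rewrite big_ltn // mulrDr; congr +%R; rewrite !big_distrr /=.
apply: eq_big_nat => i /andP[ki _].
by rewrite [x * _]mulrA mulrA -exprS -exprD addnS -addSn subnKC.
Qed.

(* Strip the relation of its terms of lowest degree in the first element, which is
   regular modulo J 0 and lies in J 1, and recurse. *)
Lemma box_eval_strip xs (J : nat -> R -> Prop) c z :
  (forall k, (k <= size xs)%N -> is_ideal (J k)) ->
  (forall k, (k < size xs)%N ->
     [/\ forall a, J k (xs`_k * a) -> J k a, forall f, J k f -> J k.+1 f & J k.+1 xs`_k]) ->
  box_nonzero (size xs) c -> J 0%N (box_eval xs c * z) -> J (size xs) z.
Proof.
elim: xs J c => [|x xs IH] J c hJ step /=.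
  (* No element is left: the relation is a nonzero scalar, which is inverted. *)
  case=> l [/size0nil -> _ c0] /(idealM (hJ 0%N isT) (phi (c [::])^-1)).
  by rewrite mulrA -rmorphM mulVf // rmorph1 mul1r.
move=> nz.
pose P k := (k < N)%N && `[< box_nonzero (size xs) (fun l => c (k :: l)) >].
have exP : exists k, P k.
  have [[|k l] [//= [sz] /andP[kN lN] cl]] := nz.
  by exists k; rewrite /P kN; apply/asboolP; exists l.
case: (ex_minnP exP) => k /andP[kN /asboolP nzk] kmin.
have [|y ->] := @lowest_term x k (fun i => box_eval xs (fun l => c (i :: l))) kN.
  move=> j jk; apply: box_eval0 => nzj.
  have := kmin j; rewrite /P (ltn_trans jk kN) /= leqNgt jk.
  by move/(_ (asboolT nzj)).
have [rx J01 J1x] := step 0%N isT; rewrite -mulrA => Jk.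
have {Jk} : J 0%N ((box_eval xs (fun l => c (k :: l)) + x * y) * z).
  move: (_ * z) Jk => w; elim: k {kN nzk kmin} => [|k IHk]; rewrite ?mul1r // exprS -mulrA.
  by move=> /rx.
move/J01; rewrite mulrDl -mulrA idealDr; [|exact: hJ|by apply: idealMr; first exact: hJ].
by apply: (IH (fun k => J k.+1)) => // j; [apply: (hJ j.+1) | apply: (step j.+1)].
Qed.

Fixpoint box d : seq (seq nat) :=
  if d is d'.+1 then [seq k :: l | k <- iota 0 N, l <- box d'] else [:: [::]].

Lemma size_box d : size (box d) = (N ^ d)%N.
Proof. by elim: d => //= d IH; rewrite size_allpairs size_iota IH expnS. Qed.

Lemma box_uniq d : uniq (box d).
Proof.
elim: d => //= d IH; apply: allpairs_uniq => //; first exact: iota_uniq.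
by move=> [k l] [k' l'] _ _ /= [-> ->].
Qed.

Lemma mem_box d l : (l \in box d) = (size l == d) && all (fun k => k < N)%N l.
Proof.
elim: d l => [|d IH] [|k l] //=; first by apply/negP => /allpairsP[[k l] []].
apply/allpairsP/idP => [[[k' l']] /= [] | /and3P[sz kN lN]].
  by rewrite mem_iota IH /= => kN /andP[sz lN] [-> ->]; rewrite eqSS sz kN.
by exists (k, l); rewrite mem_iota IH kN lN /= andbT.
Qed.

Fixpoint box_term xs l : R :=
  match xs, l with x :: xs', k :: l' => x ^+ k * box_term xs' l' | _, _ => 1 end.

(** The expanded form makes the coefficients unknowns of a linear system; the recursive form serves
    the elimination. *)
Lemma box_evalE xs c : box_eval xs c = \sum_(l <- box (size xs)) phi (c l) * box_term xs l.
Proof.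
elim: xs c => [|x xs IH] c /=; first by rewrite big_seq1 mulr1.
have iotaE : iota 0 N = index_iota 0 N by rewrite /index_iota subn0.
rewrite big_allpairs_dep /= iotaE big_mkord.
apply: eq_bigr => k _; rewrite IH mulr_sumr; apply: eq_bigr => l _.
by rewrite mulrCA.
Qed.

End BoxPolynomials.

Section Dependence.
Local Open Scope ring_scope.
Variables (A : fieldType) (n : nat).
Local Notation S := {mpoly A[n]}.
Implicit Types (f g : S) (xs : seq S) (W : {set 'I_n}).

Definition deg_le D f := forall m, m \in msupp f -> (mdeg m <= D)%N.

Lemma deg_leM D E f g : deg_le D f -> deg_le E g -> deg_le (D + E) (f * g).
Proof.
move=> fD gE m /msuppM_le /allpairsP[[m1 m2] /= [/fD m1D /gE m2E ->]].
by rewrite mdegD leq_add.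
Qed.

Lemma deg_leX D k f : deg_le D f -> deg_le (k * D) (f ^+ k).
Proof.
move=> fD; elim: k => [|k IHk]; last by rewrite exprS mulSn; apply: deg_leM.
by rewrite mul0n expr0 => m; rewrite msupp1 inE => /eqP ->; rewrite mdeg0.
Qed.

Lemma deg_le_box_term N D xs l : (forall f, f \in xs -> deg_le D f) ->
  all (fun k => k < N)%N l -> deg_le (size xs * (N * D)) (box_term xs l).
Proof.
elim: xs l => [|f xs IH] [|k l] fD /=; last case/andP=> kN lN.
1-3: by move=> _ m; rewrite msupp1 inE => /eqP ->; rewrite mdeg0.
rewrite mulSn; apply: deg_leM; last by apply: IH => // g gxs; apply: fD; rewrite inE gxs orbT.
move=> m /(deg_leX (fD f (mem_head _ _))) /leq_trans; apply.
by rewrite leq_mul2r (ltnW kN) orbT.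
Qed.

(* Counting: the N ^ size xs monomials in xs lie, modulo the variables in W, in
   a space of dimension (size xs * N * D).+1 ^ #|~: W|, which is smaller when N
   is large. *)
Lemma algebraic_dependence W xs : (#|~: W| < size xs)%N ->
  exists N (c : seq nat -> A), box_nonzero N (size xs) c /\
    forall m : 'X_{1..n}, (forall i, i \in W -> m i = 0%N) -> (box_eval (@mpolyC n A) N xs c)@_m = 0.
Proof.
set e := #|~: W|; set d := size xs => ed.
pose D := (\max_(f <- xs) msize f)%N.
have xsD f : f \in xs -> deg_le D f.
  move=> fxs m /msize_mdeg_lt /ltnW /leq_trans; apply.
  by apply: (@leq_bigmax_seq _ xs xpredT).
(* The monomials in xs have degree at most B, and B + 1 <= N K. As N > K^e, this gives (B + 1)^e <=
   N^e K^e < N^(e+1) <= N^d. *)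
pose K := (d * D).+1; pose N := (K ^ e).+1; pose B := (d * (N * D))%N.
have countN : (B.+1 ^ e < N ^ d)%N.
  have BK : (B.+1 <= N * K)%N by rewrite /B /K; nia.
  apply: (@leq_ltn_trans ((N * K) ^ e)); first by case: (e) => // e'; rewrite leq_exp2r.
  rewrite expnMn; apply: (@leq_trans (N ^ e * N)); first by rewrite ltn_pmul2l // expn_gt0.
  by rewrite -expnSr leq_exp2l //; rewrite /N ltnS expn_gt0.
pose F := {ffun {i | i \in ~: W} -> 'I_B.+1}.
have cardF : #|F| = (B.+1 ^ e)%N by rewrite card_ffun card_ord card_sig.
pose mon (h : F) : 'X_{1..n} :=
  [multinom (if insub i is Some x then h x : nat else 0%N) | i < n].
(* Rows are the monomials in xs, columns the monomials without variables in W and with exponents at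
   most B. There are more rows than columns, and a nonzero vector of the left kernel is the
   relation. *)
pose M := \matrix_(i < size (box N d), j < #|F|)
  (box_term xs (nth [::] (box N d) i))@_(mon (enum_val j)).
have kerM : kermx M != 0.
  rewrite kermx_eq0 /row_free; apply: contraTneq countN => rkM.
  by rewrite -leqNgt -(size_box N d) -cardF -rkM rank_leq_col.
pose v := nz_row (kermx M).
have v0 : v != 0 by rewrite nz_row_eq0.
have vM : v *m M = 0 by apply/sub_kermxP/nz_row_sub.
exists N, (fun l => if insub (index l (box N d)) is Some i then v 0 i else 0); split.
  have [i vi] : exists i, v 0 i != 0.
    apply: contrapT => nex; case/eqP: v0; apply/rowP => i; rewrite mxE.
    by apply: contrapT => vi; apply: nex; exists i; apply/eqP.
  exists (nth [::] (box N d) i).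
  have : nth [::] (box N d) i \in box N d by apply: mem_nth.
  rewrite mem_box => /andP[/eqP sz ltN]; split=> //.
  by rewrite index_uniq ?box_uniq // valK.
move=> m mW; rewrite box_evalE raddf_sum /= (big_nth [::]) big_mkord.
under eq_bigr => i _ do rewrite mcoeffCM index_uniq ?box_uniq // valK.
have [mB|mB] := leqP (mdeg m) B; last first.
  apply: big1 => i _; rewrite [X in _ * X](_ : _ = 0) ?mulr0 //.
  apply/eqP; rewrite mcoeff_eq0; apply: contraL mB => mi; rewrite -leqNgt.
  apply: deg_le_box_term xsD _ _ mi.
  have : nth [::] (box N d) i \in box N d by apply: mem_nth.
  by rewrite mem_box => /andP[].
have mi_le i : (m i < B.+1)%N.
  by rewrite ltnS; apply: leq_trans mB; rewrite mdegE (bigD1 i) //= leq_addr.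
pose h : F := [ffun x => Ordinal (mi_le (val x))].
have mE : mon (enum_val (enum_rank h)) = m.
  apply/mnmP => i; rewrite mnmE enum_rankK; case: insubP => [x _ <-|]; first by rewrite ffunE.
  by rewrite inE negbK => /mW ->.
transitivity ((v *m M) 0 (enum_rank h)); last by rewrite vM mxE.
by rewrite mxE; apply: eq_bigr => i _; rewrite mxE mE.
Qed.

End Dependence.

(** * Generated and monomial ideals, bounds on chains and on regular sequences *)

Section GenIdeal.
Local Open Scope ring_scope.
Variable R : comNzRingType.

Lemma gen_ideal_is_ideal (I : finType) (P : pred I) (g : I -> R) :
  is_ideal (fun f => f \in gen_ideal P g).
Proof.
split=> [|a u v /asboolP[c ->] /asboolP[d ->]]; apply/asboolP.
  by exists (fun=> 0); rewrite big1 // => i _; rewrite mul0r.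
exists (fun i => a * c i + d i); rewrite mulr_sumr -big_split /=.
by apply: eq_bigr => i _; rewrite mulrDl mulrA.
Qed.

Lemma mem_gen_ideal (I : finType) (P : pred I) (g : I -> R) i : P i -> g i \in gen_ideal P g.
Proof.
move=> Pi; apply/asboolP; exists (fun j => (j == i)%:R).
rewrite (bigD1 i) //= eqxx mul1r big1 ?addr0 // => j /andP[_ /negbTE ->].
by rewrite mul0r.
Qed.

Lemma gen_ideal_sub (I : finType) (P : pred I) (g : I -> R) (J : R -> Prop) f :
  is_ideal J -> (forall i, P i -> J (g i)) -> f \in gen_ideal P g -> J f.
Proof.
by move=> hJ Jg /asboolP[c ->]; apply: (ideal_sum hJ) => i Pi; apply/(idealM hJ)/Jg.
Qed.

Lemma foldl_adjoin_sub (J K : R -> Prop) (xs : seq R) : is_ideal K ->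
  (forall f, J f -> K f) -> (forall x, x \in xs -> K x) ->
  forall f, foldl (@adjoin R) J xs f -> K f.
Proof.
move=> hK; elim: xs J => //= x xs IH J JK xsK; apply: IH => [f [b /JK Kf]|y yxs].
  rewrite -[f](subrK (x * b)); apply: idealD => //; apply: idealMr => //.
  by apply: xsK; rewrite mem_head.
by apply: xsK; rewrite inE yxs orbT.
Qed.

End GenIdeal.

Section MonomialIdeals.
Local Open Scope ring_scope.
Variables (A : fieldType) (n : nat).
Local Notation S := {mpoly A[n]}.
Implicit Types (f g : S) (xs : seq S) (W : {set 'I_n}) (m : 'X_{1..n}) (G : 'X_{1..n} -> Prop).

Definition upclosed G := forall m m', G m -> G (m + m')%MM.

Definition mono_ideal G : S -> Prop := fun f => forall m, m \in msupp f -> G m.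

Lemma mono_ideal_is_ideal G : upclosed G -> is_ideal (mono_ideal G).
Proof.
move=> upG; split=> [m|a u v Gu Gv m]; first by rewrite msupp0.
move/msuppD_le; rewrite mem_cat => /orP[|/Gv //].
by move/msuppM_le/allpairsP => [[m1 m2] /= [_ /Gu Gm ->]]; rewrite addmC; apply: upG.
Qed.

Lemma mono_idealX G m : mono_ideal G 'X_[m] <-> G m.
Proof.
by split=> [|Gm m']; [apply; rewrite msuppX inE | rewrite msuppX inE => /eqP ->].
Qed.

Lemma mono_ideal_min G (J : S -> Prop) f : is_ideal J ->
  (forall m, G m -> J 'X_[m]) -> mono_ideal G f -> J f.
Proof.
move=> hJ GJ Gf; rewrite [f]mpolyE big_seq; apply: (ideal_sum hJ) => m /Gf Gm.
by rewrite -mul_mpolyC; apply/(idealM hJ)/GJ.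
Qed.

Lemma upclosed_lem G m m' : upclosed G -> (m <= m')%MM -> G m -> G m'.
Proof. by move=> upG le_mm' /(upG _ (m' - m)%MM); rewrite addmC submK. Qed.

Lemma gen_ideal_monomials (I : finType) (P : pred I) (e : I -> 'X_{1..n}) f :
  f \in gen_ideal P (fun i => 'X_[e i] : S) <->
  mono_ideal (fun m => exists2 i, P i & (e i <= m)%MM) f.
Proof.
have upG : upclosed (fun m => exists2 i, P i & (e i <= m)%MM).
  by move=> m m' [i Pi le_im]; exists i => //; apply: (lepm_trans le_im); apply: lem_addr.
split.
  apply: gen_ideal_sub; first exact: mono_ideal_is_ideal.
  by move=> i Pi; apply/mono_idealX; exists i => //; apply: lepm_refl.
apply: (mono_ideal_min (gen_ideal_is_ideal P _)) => m [i Pi le_im].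
rewrite -(submK le_im) mpolyXD; apply: (idealM (gen_ideal_is_ideal P _)).
exact: (mem_gen_ideal (fun i => 'X_[e i] : S)).
Qed.

Definition var_ideal W : S -> Prop := mono_ideal (fun m => exists2 i, i \in W & (0 < m i)%N).

Lemma var_upclosed W : upclosed (fun m => exists2 i, i \in W & (0 < m i)%N).
Proof. by move=> m m' [i iW mi]; exists i; rewrite // mnmDE addn_gt0 mi. Qed.

Lemma var_ideal_is_ideal W : is_ideal (var_ideal W).
Proof. exact/mono_ideal_is_ideal/var_upclosed. Qed.

Lemma var_ideal_coeffP W f :
  var_ideal W f <-> forall m, (forall i, i \in W -> m i = 0%N) -> f@_m = 0.
Proof.
split=> [Wf m mW|f0 m mf]; last first.
  apply: contrapT => nW; move: mf; rewrite mcoeff_msupp f0 ?eqxx // => i iW.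
  by apply: contrapT => /eqP mi; apply: nW; exists i; rewrite // lt0n.
apply/eqP; rewrite mcoeff_eq0; apply/negP => /Wf[i /mW ->].
by rewrite ltnn.
Qed.

(** The projection modulo the variables in W, realized as an endomorphism of S: its kernel is
    [var_ideal W] and its target a domain, so that ideal is prime. *)
Definition kill_vars W : S -> S := mmap (@mpolyC n A) (fun i => if i \in W then 0 else 'X_i).

Lemma kill_varsX W m :
  kill_vars W 'X_[m] = if [exists i in W, (0 < m i)%N] then 0 else 'X_[m].
Proof.
rewrite /kill_vars mmapX /mmap1; case: existsP => [[i /andP[iW mi]]|nex].
  by rewrite (bigD1 i) //= iW expr0n eqn0Ngt mi /= mul0r.
rewrite mpolyXE_id; apply: eq_bigr => i _; case: ifP => // iW.
have : ~~ (0 < m i)%N by apply/negP => mi; apply: nex; exists i; rewrite iW.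
by rewrite -eqn0Ngt => /eqP ->; rewrite !expr0.
Qed.

Lemma kill_varsE W f :
  kill_vars W f = \sum_(m <- msupp f) (f@_m)%:MP * kill_vars W 'X_[m].
Proof. by apply: eq_bigr => m _; rewrite /kill_vars mmapX. Qed.

Lemma kill_vars_coeff W f m : (forall i, i \in W -> m i = 0%N) -> (kill_vars W f)@_m = f@_m.
Proof.
move=> mW; rewrite kill_varsE raddf_sum /= [in RHS](mpolyE f) raddf_sum /=.
apply: eq_bigr => m' _; rewrite mcoeffCM mcoeffZ kill_varsX.
case: existsP => // -[i /andP[iW mi]]; rewrite mcoeff0 mcoeffX.
by case: eqP mi => [->|]; rewrite ?mulr0 // mW.
Qed.

Lemma var_ideal_kill W f : var_ideal W f <-> kill_vars W f = 0.
Proof.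
split=> [Wf|kf]; last first.
  by apply/var_ideal_coeffP => m mW; rewrite -(kill_vars_coeff f mW) kf mcoeff0.
rewrite kill_varsE big_seq big1 // => m /Wf[i iW mi].
rewrite kill_varsX ifT ?mulr0 //.
by apply/existsP; exists i; rewrite iW.
Qed.

Lemma var_ideal_prime W : is_prime (var_ideal W).
Proof.
split; first exact: var_ideal_is_ideal.
  by move/var_ideal_kill/eqP; rewrite /kill_vars rmorph1 oner_eq0.
move=> u v /var_ideal_kill/eqP; rewrite /kill_vars rmorphM mulf_eq0.
by case/orP => /eqP ?; [left | right]; apply/var_ideal_kill.
Qed.

(** Choose an element of each prime outside the preceding one. If there are too many, they satisfy a
    relation modulo W, which lies in the first prime; stripping it puts 1 into the last. *)
Lemma chain_length_le W (P : S -> Prop) d : chain_below (var_ideal W) P d -> (d <= #|~: W|)%N.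
Proof.
case=> Q [_ WQ pQ Qinc Qprop]; rewrite leqNgt; apply/negP => Wd.
have [x Qx] : exists x : nat -> S, forall k, (k < d)%N -> Q k.+1 (x k) /\ ~ Q k (x k).
  suff /choice [x Qx] : forall k, exists f, (k < d)%N -> Q k.+1 f /\ ~ Q k f by exists x.
  move=> k; case: (ltnP k d) => [/Qprop[f]|_]; last by exists 0.
  by exists f.
have [N [c [nz ev0]]] := @algebraic_dependence A n W (mkseq x d) (etrans (congr1 _ (size_mkseq x d)) Wd).
have [hQd Qd1 _] := pQ d (leqnn d); apply: Qd1; rewrite -[d](size_mkseq x).
apply: (@box_eval_strip _ _ (@mpolyC n A) N _ _ c) => //; rewrite ?size_mkseq //.
- by move=> k /pQ[].
- move=> k kd; have [hQ _ QM] := pQ k (ltnW kd); have [Qx1 nQx] := Qx k kd.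
  rewrite nth_mkseq //; split=> //; last exact: Qinc.
  by move=> a /QM[].
- by rewrite mulr1; apply/WQ/var_ideal_coeffP.
Qed.

Lemma var_ideal_chain W : chain_below (var_ideal W) (var_ideal [set: 'I_n]) #|~: W|.
Proof.
pose s := enum (~: W).
have szs : size s = #|~: W| by rewrite -cardE.
pose V k := W :|: [set i in take k s].
have VT : V #|~: W| = [set: 'I_n].
  by apply/setP => i; rewrite !inE -szs take_size mem_enum inE orbN.
exists (fun k => var_ideal (V k)); split=> [|f Wf m /Wf[i iW mi]|k _|k kd f Vf m /Vf[i]|k kd].
- by rewrite VT.
- by exists i; rewrite // inE iW.
- exact: var_ideal_prime.
- rewrite !inE => /orP[iW|it] mi; exists i => //; rewrite !inE ?iW //.
  by rewrite (take_nth i) ?szs // mem_rcons inE it !orbT.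
- have i0 : 'I_n.
    have : (0 < size s)%N by rewrite szs; apply: leq_ltn_trans kd.
    by case: (s).
  exists 'X_(nth i0 s k).
    move=> m; rewrite msuppX inE => /eqP ->; exists (nth i0 s k); last by rewrite mnm1E eqxx.
    by rewrite !inE (take_nth i0) ?szs // mem_rcons inE eqxx orbT.
  move/(_ U_(nth i0 s k)%MM); rewrite msuppX inE eqxx => /(_ isT)[j jV].
  rewrite mnm1E; case: eqP jV => // <-.
  have : nth i0 s k \in s by rewrite mem_nth ?szs.
  rewrite !inE mem_enum inE => /negbTE -> /=.
  by rewrite in_take ?index_uniq ?enum_uniq ?szs // ?ltnn // mem_nth ?szs.
Qed.

(** A relation modulo W times X^u lies in the ideal, so stripping puts X^u into the ideal extended
    by the sequence. Passing to k-th powers excludes this: as the elements have no constant term,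
    the powers contribute only monomials of degree at least k, more than the degree of u. *)
Lemma weakly_regular_length_le G W u xs : upclosed G -> ~ G u ->
  (forall i, i \in W -> G (u + U_(i))%MM) -> (forall x, x \in xs -> var_ideal [set: 'I_n] x) ->
  weakly_regular (mono_ideal G) xs -> (size xs <= #|~: W|)%N.
Proof.
move=> upG Gu GuW xs0 reg; rewrite leqNgt; apply/negP => Wxs.
pose k := (mdeg u).+1; pose ys := [seq x ^+ k | x <- xs].
have hG := mono_ideal_is_ideal upG.
have szy : size ys = size xs by rewrite size_map.
have [N [c [nz ev0]]] := @algebraic_dependence A n W ys (leq_trans Wxs (eq_leq (esym szy))).
have regy : weakly_regular (mono_ideal G) ys by apply: weakly_regular_exp.
pose J i := foldl (@adjoin S) (mono_ideal G) (take i ys).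
have hJ i : is_ideal (J i) by apply: foldl_adjoin_ideal.
have : J (size ys) 'X_[u].
  apply: (@box_eval_strip _ _ (@mpolyC n A) N ys J c) => //.
    move=> i isz; split; first exact: (iffLR (weakly_regular_take ys hG) regy i isz).
      by move=> f Jf; rewrite /J (take_nth 0) // -cats1 foldl_cat /=; apply: sub_adjoin.
    by rewrite /J (take_nth 0) // -cats1 foldl_cat /=; apply: mem_adjoin; apply: hJ.
  rewrite /J take0 /= => m; rewrite (perm_mem (msuppMX _ _)) => /mapP[m' m'ev ->].
  have [i iW mi] : exists2 i, i \in W & (0 < m' i)%N by have /var_ideal_coeffP := ev0; apply.
  suff le_um : (u + U_(i) <= u + m')%MM by apply: (upclosed_lem upG le_um); apply: GuW.
  by apply/mnm_lepP => j; rewrite !mnmDE leq_add2l mnm1E; case: eqP => // <-.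
rewrite /J take_size => Ju.
pose G' m := G m \/ (k <= mdeg m)%N.
suff /mono_idealX [//|] : mono_ideal G' ('X_[u] : S) by rewrite ltnn.
apply: foldl_adjoin_sub Ju => [|f Gf m /Gf|y /mapP[x xxs ->] m].
- apply: mono_ideal_is_ideal => m m' [/upG|km]; first by left.
  by right; rewrite mdegD (leq_trans km) // leq_addr.
- by left.
suff ordx : mono_ideal (fun m => (k <= mdeg m)%N) (x ^+ k) by move=> /ordx; right.
elim: (k) => [m'|j IHj m']; first by [].
rewrite exprS => /msuppM_le/allpairsP[[m1 m2] /= [/(xs0 x xxs)[i _ m1i] /IHj m2j ->]].
by rewrite mdegD -add1n leq_add // mdegE (bigD1 i) //= addn_gt0 m1i.
Qed.

End MonomialIdeals.

(** * Zariski's lemma *)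

Section Goldman.
Local Open Scope ring_scope.
Variable K : fieldType.

(* The image of R in K is a Goldman domain: inverting one element of it yields
   a field. *)
Definition goldman (R : comNzRingType) (phi : {rmorphism R -> K}) :=
  exists2 g, phi g != 0 & forall a, phi a != 0 -> exists k s, phi (a * s) = phi g ^+ k.

Definition poly_ext (R : comNzRingType) (phi : {rmorphism R -> K}) (x : K)
  : {rmorphism {poly R} -> K} := horner_morph (fun a => mulrC x (phi a)).

Section Step.
Variables (R : comNzRingType) (phi : {rmorphism R -> K}) (x : K).
Local Notation phix := (poly_ext phi x).

Lemma poly_extE p : phix p = (map_poly phi p).[x]. Proof. by []. Qed.

Lemma poly_extC a : phix a%:P = phi a.
Proof. by rewrite poly_extE map_polyC hornerC. Qed.

(* If x is transcendental, 1 + 'X * g is coprime to g. *)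
Lemma goldman_algebraic : goldman phix ->
  exists2 p : {poly R}, map_poly phi p != 0 & (map_poly phi p).[x] = 0.
Proof.
case=> g g0 ginv; apply: contrapT => nalg.
have tr p : phix p = 0 -> map_poly phi p = 0.
  by move=> px; apply: contrapT => /eqP p0; apply: nalg; exists p.
pose P := map_poly phi g; pose h := 1 + 'X * P.
have P0 : P != 0 by apply: contraNneq g0 => P0; rewrite poly_extE -/P P0 horner0.
have hE : map_poly phi (1 + 'X * g) = h by rewrite rmorphD rmorphM /= rmorph1 map_polyX.
have h0 : h != 0.
  apply/eqP => /(congr1 (fun p : {poly K} => p`_0)) /eqP.
  by rewrite coefD coefXM coef1 coef0 addr0 oner_eq0.
have [|k [s]] := ginv (1 + 'X * g).
  by apply: contraNneq h0 => /tr; rewrite hE => ->.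
rewrite -rmorphXn => /eqP; rewrite -subr_eq0 -rmorphB => /eqP/tr.
rewrite rmorphB rmorphM rmorphXn /= hE -/P => /eqP; rewrite subr_eq0 => /eqP hsP.
have : coprimep h P.
  by apply/Bezout_eq1_coprimepP; exists (1, - 'X); rewrite mul1r mulNr addrK.
(* h divides a power of P, to which it is coprime, although its degree is positive. *)
move/(coprimep_expr k); rewrite -hsP coprimepMr => /andP[+ _].
rewrite coprimepp /h addrC mulrC size_polyDl size_mulX ?size_poly1 ?ltnS ?lt0n ?size_poly_eq0 //.
by rewrite eqSS size_poly_eq0 (negPf P0).
Qed.

Hypothesis alg : exists2 p : {poly R}, map_poly phi p != 0 & (map_poly phi p).[x] = 0.

(** b is the leading coefficient of an equation for x: then b x is integral, and a high power of b
    clears all powers of x in s. *)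
Lemma integral_multiple :
  exists2 b, phi b != 0 & forall s, exists N, integralOver phi (phi (b ^+ N) * phix s).
Proof.
case: alg => p P0 Px; pose P := map_poly phi p; pose m := (size P).-1.
have Pm : P`_m = lead_coef P by [].
have szP : size P = m.+1 by rewrite prednK // lt0n size_poly_eq0.
have m0 : (0 < m)%N.
  rewrite lt0n; apply: contraNneq P0 => m0; move: szP; rewrite m0 => /eqP/size_poly1P[c c0 PE].
  by move: Px c0; rewrite -/P PE hornerC => ->; rewrite eqxx.
exists p`_m; first by rewrite -coef_map -/P Pm lead_coef_eq0.
set b := p`_m; have bE : phi b = P`_m by rewrite coef_map.
have int_bx : integralOver phi (phi b * x).
  (* The equation of x multiplied by b^(m-1), rewritten as a monic equation for b x. *)
  pose q : {poly R} := 'X^m + \poly_(i < m) (p`_i * b ^+ (m.-1 - i)).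
  exists q.
    rewrite monicE /q lead_coefDl ?lead_coefXn // size_polyXn ltnS; exact: size_poly.
  rewrite /q rmorphD /= map_polyXn /root hornerD hornerXn.
  rewrite (_ : map_poly phi _ = \poly_(i < m) (P`_i * phi b ^+ (m.-1 - i))); last first.
    apply/polyP => i; rewrite coef_map coef_poly (coef_poly m).
    by case: ifP => _ /=; [rewrite rmorphM rmorphXn coef_map | rewrite rmorph0].
  rewrite horner_poly.
  have : phi b ^+ m.-1 * P.[x] = 0 by rewrite Px mulr0.
  rewrite horner_coef szP big_ord_recr /= mulrDr -bE => e0; apply/eqP; rewrite -[RHS]e0 addrC.
  congr (_ + _); last by rewrite exprMn -[in LHS](prednK m0) exprSr -!mulrA (prednK m0).
  rewrite mulr_sumr; apply: eq_bigr => i _.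
  rewrite exprMn mulrACA -mulrA -[in RHS](subnK (_ : (i <= m.-1)%N)) ?exprD; first by ring.
  by rewrite -ltnS prednK.
move=> s; exists (size s); rewrite poly_extE horner_coef mulr_sumr.
apply: (big_ind (integralOver phi)); [exact: integral0 | exact: integral_add | move=> i _].
have -> : phi (b ^+ size s) * ((map_poly phi s)`_i * x ^+ i)
  = phi (s`_i * b ^+ (size s - i)) * (phi b * x) ^+ i.
  rewrite coef_map exprMn -[in LHS](@subnK i (size s)); last first.
    by apply: ltnW; apply: leq_trans (ltn_ord i) _; apply: size_poly.
  by rewrite exprD !rmorphM !rmorphXn; ring.
apply: integral_mul; first exact: integral_id.
elim: (i : nat) => [|j IHj]; first by rewrite expr0; apply: integral1.
by rewrite exprS; apply: integral_mul.
Qed.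

(** Take the lowest coefficient with nonzero image in an integral equation of w: after cancelling
    powers of w, it is a multiple of w. *)
Lemma integral_divides w : phix w != 0 -> integralOver phi (phix w) ->
  exists2 c, phi c != 0 & exists t, phi c = phix (w * t).
Proof.
move=> w0 [q qmon /rootP qw].
have : map_poly phi q != 0 by rewrite monic_neq0 // monic_map.
elim/poly_ind: q {qmon} qw => [_|q c IH]; first by rewrite rmorph0 eqxx.
rewrite rmorphD rmorphM /= map_polyX map_polyC /= hornerMXaddC.
have [c0|c0] := eqVneq (phi c) 0.
  rewrite c0 !addr0 => /eqP; rewrite mulf_eq0 (negPf w0) orbF => /eqP qw.
  move=> qX0; apply: IH => //; apply: contraNneq qX0 => ->.
  by rewrite mul0r.
move=> qw _; exists c => //; exists (- q^:P.[w]).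
rewrite rmorphM rmorphN -horner_map -map_poly_comp.
rewrite (@eq_map_poly _ _ _ phi); last by move=> a; rewrite /= poly_extC.
by rewrite mulrN mulrC; apply/eqP; rewrite -addr_eq0 addrC qw.
Qed.

(** Here v = e / a in K; an integral equation of degree m for v, multiplied by a^m, exhibits e^m as
    a multiple of a. *)
Lemma integral_power_divides a e v : integralOver phi v -> phi a * v = phi e ->
  exists m s, phi (a * s) = phi e ^+ m.
Proof.
case=> q qmon /rootP; set m := (size q).-1 => qv av.
have szq : size q = m.+1 by rewrite prednK // lt0n size_poly_eq0 monic_neq0.
have szqK : size (map_poly phi q) = m.+1 by rewrite size_map_poly_id0 ?szq // (monicP qmon) rmorph1 oner_neq0.
exists m, (- \sum_(i < m) q`_i * e ^+ i * a ^+ (m - i).-1).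
have : phi a ^+ m * (map_poly phi q).[v] = 0 by rewrite qv mulr0.
rewrite horner_coef szqK big_ord_recr /= coef_map /=.
have -> : q`_m = 1 by have /monicP := qmon; rewrite lead_coefE.
rewrite rmorph1 mul1r mulrDr -exprMn av addrC => /eqP; rewrite addr_eq0 => /eqP ->.
rewrite mulrN rmorphN; congr (- _); rewrite !mulr_sumr rmorph_sum /=.
apply: eq_bigr => i _; rewrite coef_map /= !rmorphM !rmorphXn -av exprMn.
have -> : phi a ^+ m = phi a * (phi a ^+ i * phi a ^+ (m - i).-1).
  by rewrite -exprD -exprS -addnS prednK ?subn_gt0 // subnKC // ltnW.
ring.
Qed.

(** Some c in R is divisible by b^N0 g0. A nonzero a in R divides a power of g0, hence a power of c,
    by a cofactor s' in R[x]; a power of b makes s' integral, which brings the divisibility down to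
    R. *)
Lemma goldman_descent : goldman phix -> goldman phi.
Proof.
case=> g0 g0x ginv; have [b b0 intb] := integral_multiple.
have [N0 int0] := intb g0.
have bE N : phi (b ^+ N) = phix (b ^+ N)%:P by rewrite poly_extC.
have [||c c0 [t ct]] := @integral_divides ((b ^+ N0)%:P * g0).
- by rewrite rmorphM mulf_neq0 // -bE rmorphXn expf_neq0.
- by rewrite rmorphM -bE.
exists (b * c) => [|a a0]; first by rewrite rmorphM mulf_neq0.
have [|k [s ask]] := ginv a%:P; first by rewrite poly_extC.
pose s' := s * ((b ^+ N0)%:P * t) ^+ k.
have as' : phi a * phix s' = phi (c ^+ k).
  have -> : phi a = phix a%:P by rewrite poly_extC.
  rewrite rmorphXn ct -rmorphM /s' mulrA rmorphM ask -!rmorphXn -rmorphM -exprMn.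
  by congr (phix (_ ^+ _)); ring.
have [N intN] := intb s'.
have [|m [s'' as'']] := @integral_power_divides a (b ^+ N * c ^+ k) _ intN.
  by rewrite mulrCA as' rmorphM.
exists (m * (N + k))%N, (s'' * (b ^+ k * c ^+ N) ^+ m).
rewrite mulrA rmorphM as'' -rmorphXn -rmorphM -rmorphXn; congr (phi _).
rewrite [in RHS]mulnC exprM -exprMn; congr (_ ^+ _).
rewrite exprMn !exprD; ring.
Qed.

End Step.

(** K is generated as a ring by the image of R and xs, in the form of an induction principle. *)
Definition generated (R : comNzRingType) (phi : {rmorphism R -> K}) (xs : seq K) :=
  forall B : K -> Prop, (forall u v, B u -> B v -> B (u + v)) ->
    (forall u v, B u -> B v -> B (u * v)) -> (forall r, B (phi r)) ->
    (forall x, x \in xs -> B x) -> forall z, B z.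

(** Each generator is absorbed into a polynomial ring, then found algebraic, and the property
    descends. With no generator left, phi is onto K and g = 1 works. *)
Lemma generated_goldman (R : comNzRingType) (phi : {rmorphism R -> K}) (xs : seq K) :
  generated phi xs -> goldman phi.
Proof.
elim: xs R phi => [|x xs IH] R phi gen.
  exists 1 => [|a a0]; first by rewrite rmorph1 oner_neq0.
  have [s sE] : exists s, phi s = (phi a)^-1.
    apply: (gen (fun z => exists s, phi s = z)) => // [u v [s <-] [t <-]|u v [s <-] [t <-]|r].
    + by exists (s + t); rewrite rmorphD.
    + by exists (s * t); rewrite rmorphM.
    + by exists r.
  by exists 0%N, s; rewrite rmorphM sE mulfV.
have /IH gol : generated (poly_ext phi x) xs.
  move=> B BD BM Bphi Bxs; apply: gen => // [r|y]; first by rewrite -(poly_extC phi x).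
  rewrite inE => /orP[/eqP ->|]; last exact: Bxs.
  by have := Bphi 'X; rewrite poly_extE map_polyX hornerX.
exact: (goldman_descent (goldman_algebraic gol) gol).
Qed.

End Goldman.

Section Zariski.
Local Open Scope ring_scope.
Variables (A : fieldType) (n : nat).
Local Notation S := {mpoly A[n]}.

(** theta is adjoined to A before the variables: K is generated by the variables over the image of
    A[T], T going to theta, so this image is a Goldman domain and theta is algebraic. *)
Lemma zariski_algebraic (K : fieldType) (psi : {rmorphism S -> K}) (theta : S) :
  (forall z, exists f, psi f = z) ->
  exists2 p : {poly A}, p \is monic & psi (map_poly (@mpolyC n A) p).[theta] = 0.
Proof.
move=> surj; pose phi : {rmorphism A -> K} := psi \o @mpolyC n A.
have : goldman (poly_ext phi (psi theta)).
  apply: (@generated_goldman _ _ _ [seq psi 'X_i | i <- enum 'I_n]).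
  move=> B BD BM Bphi BX z; have [f <-] := surj z.
  have B1 : B 1 by rewrite -(rmorph1 phi) -(poly_extC phi (psi theta)).
  elim/mpolyind: f => [|c m f _ _ Bf].
    by rewrite rmorph0 -(rmorph0 phi) -(poly_extC phi (psi theta)).
  rewrite rmorphD; apply: BD => //; rewrite -mul_mpolyC rmorphM; apply: (BM).
    by rewrite -[psi _]/(phi c) -(poly_extC phi (psi theta)).
  rewrite mpolyXE_id rmorph_prod; apply: (big_ind B); [exact: B1 | exact: BM | move=> i _; rewrite rmorphXn].
  elim: (m i) => [|k IHk]; rewrite ?expr0 // exprS; apply: BM => //.
  by apply/BX/map_f; rewrite mem_enum.
case/goldman_algebraic => p; rewrite map_poly_eq0 => p0 px.
exists ((lead_coef p)^-1 *: p); first by rewrite monicE lead_coefZ mulVf // lead_coef_eq0.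
rewrite -horner_map -map_poly_comp map_polyZ hornerZ.
by rewrite px mulr0.
Qed.

End Zariski.

(** * Regular sequences of polynomials in linear forms *)

Section Translations.
Local Open Scope ring_scope.

(** Descending induction on k: modulo J the coefficient of g h at deg g + k is that of h at k, the
    other terms containing higher coefficients of h. *)
Lemma ideal_coef_monic (R : comNzRingType) (J : R -> Prop) (g h : {poly R}) : is_ideal J ->
  g \is monic -> (forall k, J (g * h)`_k) -> forall k, J h`_k.
Proof.
move=> hJ gmon Jgh; set m := (size g).-1.
have gm : g`_m = 1 by have /monicP := gmon; rewrite lead_coefE.
suff down d k : (size h - d <= k)%N -> J h`_k by move=> k; apply: (down (size h)); rewrite subnn.
elim: d k => [|d IHd] k hk.
  by rewrite nth_default ?(leq_trans _ hk) ?subn0 //; apply: ideal0.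
have := Jgh (m + k)%N; rewrite coefM.
have mk : (m < (m + k).+1)%N by rewrite ltnS leq_addr.
rewrite (bigD1 (Ordinal mk)) //= gm mul1r addKn idealDr //.
apply: ideal_sum => // j jm; have [mj|jm'] := ltnP m j.
  by rewrite [g`_j]nth_default ?mul0r; [apply: ideal0 | apply: leq_trans (leqSpred _) mj].
apply: (idealM hJ); apply: IHd.
have : (j < m)%N by rewrite ltn_neqAle jm' andbT; apply: contraNneq jm => jm; apply/eqP/val_inj/jm.
by lia.
Qed.

Lemma coef_preim_ideal (R R' : comNzRingType) (psi : {rmorphism R' -> {poly R}}) (J : R -> Prop) :
  is_ideal J -> is_ideal (fun f => forall k, J (psi f)`_k).
Proof.
move=> hJ; split=> [k|a u v Ju Jv k]; first by rewrite rmorph0 coef0; apply: ideal0.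
rewrite rmorphD coefD; apply: idealD => //.
by rewrite rmorphM coefM; apply: ideal_sum => // l _; apply: idealM.
Qed.

Variables (A : fieldType) (n : nat).
Local Notation S := {mpoly A[n]}.
Implicit Types (f g : S) (W : {set 'I_n}).

(* The translation X_i |-> X_i + alpha_i (T - theta), which is the identity at
   T = theta. *)
Definition translate (alpha : 'I_n -> A) (theta : S) : {rmorphism S -> {poly S}} :=
  mmap (polyC \o @mpolyC n A) (fun i => ('X_i)%:P + (alpha i)%:MP%:P * ('X - theta%:P)).

Section OneTranslation.
Variables (alpha : 'I_n -> A) (theta : S).
Local Notation psi := (translate alpha theta).

Lemma translateC c : psi c%:MP = c%:MP%:P.
Proof. exact: mmapC. Qed.

Lemma translateX i : psi 'X_i = ('X_i)%:P + (alpha i)%:MP%:P * ('X - theta%:P).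
Proof. by rewrite /= mmapX mmap1U. Qed.

Lemma translate_theta f : (psi f).[theta] = f.
Proof.
rewrite [in RHS](mpolyE f) /= /mmap horner_sum; apply: eq_bigr => m _.
rewrite hornerM hornerC -mul_mpolyC mpolyXE_id /mmap1 horner_prod; congr (_ * _).
apply: eq_bigr => i _; rewrite horner_exp; congr (_ ^+ _).
by rewrite !hornerE subrr mulr0 addr0.
Qed.

Lemma translate_poly (p : {poly A}) (t : S) :
  psi (map_poly (@mpolyC n A) p).[t] = (map_poly polyC (map_poly (@mpolyC n A) p)).[psi t].
Proof.
rewrite -horner_map -!map_poly_comp; congr (_.[_]).
by apply: eq_map_poly => c; exact: translateC.
Qed.

(** If x a lies in J, then psi x times psi a has coefficients in J; as psi x is monic, so has psi a,
    and evaluation at theta gives back a. *)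
Lemma translate_regular (J : S -> Prop) x : is_ideal J ->
  (forall f, J f -> forall k, J (psi f)`_k) -> psi x \is monic ->
  forall a, J (x * a) -> J a.
Proof.
move=> hJ Jpsi xmon a Jxa; rewrite -(translate_theta a) horner_coef.
apply: ideal_sum => // k _; apply: (idealMr hJ).
by apply: (ideal_coef_monic hJ xmon) => j; rewrite -rmorphM; apply: Jpsi.
Qed.

End OneTranslation.

(** The translation for theta j fixes the variables in W and the other forms, so it respects the
    ideal of the earlier elements, while p j at theta j becomes the monic polynomial p j in T. *)
Lemma weakly_regular_forms W (I : eqType) (theta : I -> S) (p : I -> {poly A}) (s : seq I) :
  (forall j, p j \is monic) ->
  (forall j, exists alpha, [/\ forall i, i \in W -> alpha i = 0,
     translate alpha (theta j) (theta j) = 'X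
   & forall l, l != j -> translate alpha (theta j) (theta l) = (theta l)%:P]) ->
  uniq s ->
  weakly_regular (var_ideal W) [seq (map_poly (@mpolyC n A) (p j)).[theta j] | j <- s].
Proof.
move=> pmon trans uniq_s; set xs := map _ _.
have hV : is_ideal (@var_ideal A n W) by apply: var_ideal_is_ideal.
apply/(weakly_regular_take xs hV) => i; rewrite size_map => isz.
case: s => // j0 s' in xs uniq_s isz *; pose s := j0 :: s'.
rewrite (nth_map j0) //; set j := nth j0 s i.
have [alpha [aW aj al]] := trans j.
have hJ := foldl_adjoin_ideal (take i xs) hV.
apply: (translate_regular (alpha := alpha) (theta := theta j)) => //; last first.
  rewrite translate_poly aj -[_.['X]]/((map_poly (@mpolyC n A) (p j)) \Po 'X) comp_polyXr.
  by rewrite monic_map.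
pose J' (f : S) := forall k, foldl (@adjoin _) (var_ideal W) (take i xs) (translate alpha (theta j) f)`_k.
have hJ' : is_ideal J' := coef_preim_ideal _ hJ.
have subJ f : var_ideal W f -> foldl (@adjoin _) (var_ideal W) (take i xs) f.
  by elim: (take i xs) (var_ideal W) => //= x ys IH V Vf; apply/IH/sub_adjoin.
have memJ f : f \in take i xs -> foldl (@adjoin _) (var_ideal W) (take i xs) f.
  elim: (take i xs) (var_ideal W) hV => //= x ys IH V hV'.
  rewrite inE => /orP[/eqP ->|]; last exact/IH/adjoin_ideal.
  have := mem_adjoin hV' x; elim: ys (adjoin V x) {IH} => //= y ys IH V' V'x.
  exact/IH/sub_adjoin.
apply: (@foldl_adjoin_sub _ _ J' _ hJ') => [f|x xt k].
  apply: mono_ideal_min => // m [v vW mv] k.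
  have -> : m = (m - U_(v) + U_(v))%MM.
    by rewrite submK //; apply/mnm_lepP => l; rewrite mnm1E; case: eqP => // <-.
  rewrite mpolyXD rmorphM translateX aW // mpolyC0 mul0r addr0 coefMC.
  apply: (idealM hJ); apply: subJ => m'; rewrite msuppX inE => /eqP ->.
  by exists v; rewrite // mnm1E eqxx.
have /(nthP 0) [l] := xt; rewrite size_take size_map isz => li xE.
have lsz : (l < size s)%N by apply: ltn_trans isz.
have xj : x = (map_poly (@mpolyC n A) (p (nth j0 s l))).[theta (nth j0 s l)].
  by rewrite -xE nth_take // (nth_map j0).
rewrite {1}xj translate_poly al; last first.
  by rewrite /j nth_uniq // neq_ltn li.
rewrite horner_map -xj coefC; case: eqP => _; [exact: memJ | exact: ideal0].
Qed.

End Translations.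

(** * Filtration of a monomial quotient along whiskers *)

Section Truncation.
Local Open Scope ring_scope.
Variables (A : fieldType) (n b r : nat).
Variables (s : 'I_b -> 'I_r.+1 -> 'I_n) (a : 'I_b -> 'I_r.+1 -> nat).
Hypothesis s_inj : forall i k j l, s i k = s j l -> i = j /\ k = l.
Local Notation S := {mpoly A[n]}.
Implicit Types (m u : 'X_{1..n}) (i : 'I_b) (k : 'I_r.+1) (xs : seq S).

Definition full_below m i k := [forall l : 'I_r.+1, (l < k)%N ==> (a i l <= m (s i l))%N].

(* Keep of m the part that fills the whiskers from their base outwards, each
   vertex s i k up to the threshold a i k. *)
Definition truncate m : 'X_{1..n} :=
  [multinom (if [pick u | s u.1 u.2 == v] is Some u
             then if full_below m u.1 u.2 then minn (m v) (a u.1 u.2) else 0 else 0)%N | v < n].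

Lemma truncateE m i k :
  truncate m (s i k) = if full_below m i k then minn (m (s i k)) (a i k) else 0%N.
Proof.
rewrite mnmE; case: pickP => [[j l] /= /eqP /s_inj [-> ->] //|/(_ (i, k))].
by rewrite eqxx.
Qed.

Lemma truncate_out m v : (forall i k, s i k != v) -> truncate m v = 0%N.
Proof. by move=> vs; rewrite mnmE; case: pickP => // u; rewrite (negPf (vs _ _)). Qed.

Variant vertex_spec (v : 'I_n) : Prop :=
  | VertexIn i k of v = s i k
  | VertexOut of forall i k, s i k != v.

Lemma vertexP v : vertex_spec v.
Proof.
case: (pickP (fun u : 'I_b * 'I_r.+1 => s u.1 u.2 == v)) => [[i k] /eqP <-|nv].
  exact: VertexIn.
by apply: VertexOut => i k; apply/negbT/(nv (i, k)).
Qed.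

Lemma full_belowP m i k :
  reflect (forall l : 'I_r.+1, (l < k)%N -> (a i l <= m (s i l))%N) (full_below m i k).
Proof. exact: 'forall_implyP. Qed.

Lemma full_below_mono m m' i k : (m <= m')%MM -> full_below m i k -> full_below m' i k.
Proof.
move=> /mnm_lepP le_mm /full_belowP fm; apply/full_belowP => l /fm h.
exact: leq_trans (le_mm _).
Qed.

Lemma truncate_le m : (truncate m <= m)%MM.
Proof.
apply/mnm_lepP => v; case: (vertexP v) => [i k ->|vs]; last by rewrite truncate_out.
by rewrite truncateE; case: ifP => // _; apply: geq_minl.
Qed.

Lemma truncate_mono m m' : (m <= m')%MM -> (truncate m <= truncate m')%MM.
Proof.
move=> le_mm; apply/mnm_lepP => v; case: (vertexP v) => [i k ->|vs]; last by rewrite !truncate_out.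
rewrite !truncateE; case: ifP => // /(full_below_mono le_mm) ->.
by rewrite leq_min geq_minr andbT (leq_trans (geq_minl _ _)) //; apply/mnm_lepP.
Qed.

Lemma full_below_truncate m i k : full_below (truncate m) i k = full_below m i k.
Proof.
apply/idP/idP; first exact/full_below_mono/truncate_le.
move/full_belowP => fm; apply/full_belowP => l lk; rewrite truncateE ifT.
  by rewrite leq_min fm /=.
by apply/full_belowP => j jl; apply: fm; apply: ltn_trans lk.
Qed.

Lemma truncateK m : truncate (truncate m) = truncate m.
Proof.
apply/mnmP => v; case: (vertexP v) => [i k ->|vs]; last by rewrite !truncate_out.
rewrite !truncateE full_below_truncate; case: (full_below m i k) => //.
by rewrite -minnA minnn.
Qed.

(* Remove from F a monomial u of largest degree: modulo the ideal, the annihilator of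
   u is generated by the first variable that u does not fill on each whisker. *)
Lemma weakly_regular_truncation (F : seq 'X_{1..n}) xs :
  (forall kappa : 'I_b -> 'I_r.+1, weakly_regular (var_ideal (A := A) [set s i (kappa i) | i : 'I_b]) xs) ->
  (forall m m', (m <= m')%MM -> truncate m' \in F -> truncate m \in F) ->
  (forall u, u \in F -> truncate u = u) ->
  (forall u, u \in F -> forall i, exists k, (u (s i k) < a i k)%N) ->
  weakly_regular (mono_ideal (A := A) (fun m => truncate m \notin F)) xs.
Proof.
move=> regV; have [N szF] := ubnP (size F); elim: N F szF => // N IH F szF downF truncF openF.
have idF (F' : seq 'X_{1..n}) : (forall m m', (m <= m')%MM -> truncate m' \in F' -> truncate m \in F') ->
    is_ideal (mono_ideal (A := A) (fun m => truncate m \notin F')).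
  by move=> down'; apply: mono_ideal_is_ideal => m m'; apply/contra/down'/lem_addr.
have [F0|[u0 u0F]] : F = [::] \/ exists u, u \in F.
- by case: (F) => [|u F']; [left | right; exists u; rewrite mem_head].
- by apply: weakly_regular_total; [exact: idF | move=> f m _; rewrite F0].
have [u uF umax] : exists2 u, u \in F & forall v, v \in F -> (mdeg v <= mdeg u)%N.
  have [w _ wmax] := @arg_maxnP (seq_sub F) (SeqSub u0F) xpredT (fun w => mdeg (ssval w)) isT.
  by exists (ssval w); [exact: ssvalP | move=> v vF; apply: (wmax (SeqSub vF))].
pose F' := [seq v <- F | v != u].
have memF' v : v \in F' = (v != u) && (v \in F) by rewrite mem_filter.
(* A truncation in F that u divides has degree at most that of u, so it is u. *)
have above m : (u <= m)%MM -> truncate m \in F -> truncate m = u.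
  move=> le_um mF; have := truncate_mono le_um; rewrite truncF // => le_u.
  have := umax _ mF; rewrite -{1}(submK le_u) mdegD -{2}[mdeg u]add0n leq_add2r leqn0 mdeg_eq0.
  by move/eqP => d0; rewrite -(submK le_u) d0 add0m.
have downF' m m' : (m <= m')%MM -> truncate m' \in F' -> truncate m \in F'.
  move=> le_mm; rewrite !memF' => /andP[nu m'F]; rewrite (downF _ _ le_mm) // andbT.
  apply: contra nu => /eqP mu; apply/eqP/above => //.
  by rewrite -mu (lepm_trans (truncate_le m)).
apply: (@weakly_regular_colon _ _ 'X_[u]); first exact: idF; last first.
  have -> : adjoin (mono_ideal (A := A) (fun m => truncate m \notin F)) 'X_[u] =
            mono_ideal (A := A) (fun m => truncate m \notin F').
    apply: predP_eq => f; split=> [[g Ig]|If].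
      rewrite -[f](subrK ('X_[u] * g)); apply: (idealD (idF _ downF')).
        by move=> m /Ig; apply: contra; rewrite memF' => /andP[].
      rewrite mulrC; apply: (idealM (idF _ downF')); apply/mono_idealX.
      by rewrite memF' truncF // eqxx.
    apply: (mono_ideal_min (adjoin_ideal (idF _ downF) _)) If => m; rewrite memF' negb_and negbK.
    case/orP=> [/eqP mu|mF]; last by apply: sub_adjoin; apply/mono_idealX.
    have le_um : (u <= m)%MM by rewrite -mu truncate_le.
    rewrite -(submK le_um) mpolyXD; apply: (idealM (adjoin_ideal (idF _ downF) _)).
    exact/mem_adjoin/idF.
  apply: IH => // [|v|v]; last 2 first.
  - by rewrite memF' => /andP[_ /truncF].
  - by rewrite memF' => /andP[_ /openF].
  have cu : (0 < count_mem u F)%N by rewrite -has_count has_pred1.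
  have cE : size F' = count (predC (pred1 u)) F by rewrite size_filter; apply: eq_count.
  move: szF; rewrite ltnS -(count_predC (pred1 u) F) => szF; rewrite cE.
  by apply: leq_trans szF; rewrite -[X in (X < _)%N]add0n ltn_add2r.
have first_open i : exists k, (u (s i k) < a i k)%N && full_below u i k.
  have [k uk] := openF u uF i; pose P l := (u (s i l) < a i l)%N.
  have [l Pl lmin] := @arg_minnP _ k P (fun l => l : nat) uk.
  exists l; rewrite [X in X && _]Pl; apply/full_belowP => j jl; rewrite leqNgt; apply/negP => /lmin.
  by rewrite leqNgt jl.
have [kappa kappaP] := choice first_open.
suff -> : colon (mono_ideal (A := A) (fun m => truncate m \notin F)) 'X_[u] =
   var_ideal (A := A) [set s i (kappa i) | i : 'I_b] by apply: regV.
(* The truncation of m + u is u unless m involves a first open vertex: before it u is already at the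
   threshold, beyond it everything is cut off. *)
have openE m : truncate (m + u)%MM \notin F <-> exists2 v, v \in [set s i (kappa i) | i : 'I_b] & (0 < m v)%N.
  split=> [nF|[_ /imsetP[i _ ->] mi]].
    apply: contrapT => nex; case/negP: nF.
    have m0 i : m (s i (kappa i)) = 0%N.
      apply/eqP; rewrite -leqn0 leqNgt; apply/negP => mi; apply: nex.
      by exists (s i (kappa i)); rewrite ?imset_f.
    suff -> : truncate (m + u)%MM = u by [].
    rewrite -[RHS](truncF u uF); apply/mnmP => v.
    case: (vertexP v) => [i k ->|vs]; last by rewrite !truncate_out.
    have /andP[ui fi] := kappaP i; rewrite !truncateE mnmDE.
    have [kk|kk|kk] := ltngtP k (kappa i).
    - have fk : full_below u i k.
        by apply/full_belowP => l lk; apply: (full_belowP _ _ _ fi); apply: ltn_trans kk.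
      rewrite fk (full_below_mono (lem_addl _ _) fk).
      have au := full_belowP _ _ _ fi k kk.
      by rewrite !(minn_idPr _) // (leq_trans au) // leq_addl.
    - rewrite !ifF //; apply/full_belowP => /(_ _ kk); rewrite ?mnmDE ?m0 leqNgt ?add0n; by rewrite ui.
    - have -> : k = kappa i by apply: val_inj.
      by rewrite m0 add0n fi (full_below_mono (lem_addl _ _) fi).
  apply/negP => mF; have := above _ (lem_addl _ _) mF.
  have /andP[ui fi] := kappaP i.
  move/(congr1 (fun m : 'X_{1..n} => m (s i (kappa i)))); rewrite truncateE.
  rewrite (full_below_mono (lem_addl _ _) fi) mnmDE; by move=> E; move: E ui mi; lia.
apply: predP_eq => f; split=> [If m mf|Vf m].
  by apply/openE/If; rewrite (perm_mem (msuppMX _ _)) addmC map_f.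
by rewrite (perm_mem (msuppMX _ _)) => /mapP[m' m'f ->]; rewrite addmC; apply/openE/Vf.
Qed.

(** By the hypotheses on e, a generator divides m only if it divides the truncation of m, so
    membership in the ideal depends on the truncation alone. F lists the finitely many truncations
    outside the ideal; the generator of whisker i keeps each of them from filling that whisker. *)
Lemma weakly_regular_filled (I : finType) (P : pred I) (e : I -> 'X_{1..n}) xs :
  (forall p i k, P p -> (e p (s i k) <= a i k)%N) ->
  (forall p i k (l : 'I_r.+1), P p -> (l < k)%N -> (0 < e p (s i k))%N -> e p (s i l) = a i l) ->
  (forall p v, P p -> (forall i k, s i k != v) -> e p v = 0%N) ->
  (forall i, exists2 p, P p & forall v, (e p v <= \sum_k (v == s i k) * a i k)%N) ->
  (forall kappa : 'I_b -> 'I_r.+1, weakly_regular (var_ideal (A := A) [set s i (kappa i) | i : 'I_b]) xs) ->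
  weakly_regular (mono_ideal (A := A) (fun m => exists2 p, P p & (e p <= m)%MM)) xs.
Proof.
move=> e_le e_fill e_out whisker regV.
have le_trunc p m : P p -> (e p <= m)%MM -> (e p <= truncate m)%MM.
  move=> Pp /mnm_lepP le_pm; apply/mnm_lepP => v.
  case: (vertexP v) => [i k ->|vs]; last by rewrite e_out.
  rewrite truncateE; case: ifP => [_|nf]; first by rewrite leq_min le_pm e_le.
  rewrite leqn0 eqn0Ngt; apply: contraFN nf => ek; apply/full_belowP => l lk.
  by rewrite -(e_fill _ _ _ _ Pp lk ek) le_pm.
pose bad m := [exists p, P p && (e p <= m)%MM].
(* A bound for all thresholds, hence for all exponents of truncations. *)
pose B := (\max_i \max_k a i k)%N.
pose mon (h : {ffun 'I_n -> 'I_B.+1}) : 'X_{1..n} := [multinom (h v : nat) | v < n].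
pose F := [seq truncate (mon h) | h <- enum {ffun 'I_n -> 'I_B.+1} & ~~ bad (truncate (mon h))].
have FP m : (truncate m \in F) = ~~ bad (truncate m).
  apply/mapP/idP => [[h + ->]|nb]; first by rewrite mem_filter => /andP[].
  have tB v : (truncate m v < B.+1)%N.
    rewrite ltnS; case: (vertexP v) => [i k ->|vs]; last by rewrite truncate_out.
    rewrite truncateE; case: ifP => // _; apply: leq_trans (geq_minr _ _) _.
    by apply: leq_trans (leq_bigmax i); apply: leq_bigmax.
  have mE : mon [ffun v => Ordinal (tB v)] = truncate m by apply/mnmP => v; rewrite mnmE ffunE.
  by exists [ffun v => Ordinal (tB v)]; [rewrite mem_filter mE truncateK nb mem_enum | rewrite mE truncateK].
have badP m : bad (truncate m) <-> exists2 p, P p & (e p <= m)%MM.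
  split=> [/existsP[p /andP[Pp le_p]]|[p Pp le_p]].
    by exists p => //; apply: lepm_trans le_p (truncate_le m).
  by apply/existsP; exists p; rewrite Pp le_trunc.
have -> : (fun m => exists2 p, P p & (e p <= m)%MM) = (fun m => truncate m \notin F).
  by apply: predP_eq => m; rewrite -badP FP negbK.
apply: weakly_regular_truncation => // [m m' le_mm|u|u uF i].
- rewrite !FP; apply: contra => /badP[p Pp le_p]; apply/badP; exists p => //.
  exact: lepm_trans le_mm.
- by case/mapP => h _ ->; rewrite truncateK.
- apply: contrapT => nex.
  have {}nex k : (a i k <= u (s i k))%N by rewrite leqNgt; apply/negP => uk; apply: nex; exists k.
  have uE : truncate u = u by case/mapP: uF => h _ ->; rewrite truncateK.
  move: uF; rewrite -uE FP => /negP; apply; apply/badP.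
  have [p Pp le_p] := whisker i; exists p => //; apply/mnm_lepP => v; apply: leq_trans (le_p v) _.
  have [/existsP[k /eqP ->]|nv] := boolP [exists k, v == s i k].
    rewrite (bigD1 k) //= eqxx mul1n big1 ?addn0 // => l lk.
    by case: eqP => // /s_inj[_ kl]; rewrite kl eqxx in lk.
  rewrite big1 // => k _; case: eqP => // vk; case/existsP: nv.
  by exists k; apply/eqP.
Qed.

End Truncation.

(** * Minimal covers and Cohen-Macaulay monomial ideals *)

Section Covers.
Variables (n : nat) (I : finType) (P : pred I) (e : I -> 'X_{1..n}).
Implicit Types (c d : 'I_n -> nat) (p : I) (i j : 'I_n).
Local Notation natf h := (fun i => nat_of_ord (h i)).

(* c i = 0 means that c does not involve the vertex i. *)
Definition cover c := forall p, P p -> exists i, (0 < c i <= e p i)%N.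

(* The minimal covers c correspond to the irredundant components
   P_(cover_support c, c). *)
Definition min_cover c := cover c /\
  forall i, (0 < c i)%N -> exists p, [/\ P p, c i = e p i
    & forall j, j != i -> (0 < c j)%N -> (e p j < c j)%N].

Definition cover_support c : {set 'I_n} := [set i | (0 < c i)%N].

Definition exponent_bound : nat := \max_p \max_i e p i.

Lemma exponent_le p i : (e p i <= exponent_bound)%N.
Proof. by apply: leq_trans (leq_bigmax p); apply: leq_bigmax. Qed.

(* Maximize the sum of the entries of a cover above c, a missing vertex counting
   for more than any exponent. *)
Lemma cover_refine c : cover c -> exists2 d, min_cover d &
  forall i, (0 < d i)%N -> (0 < c i <= d i)%N.
Proof.
move=> cov_c; set B := exponent_bound.
pose R (h : {ffun 'I_n -> 'I_B.+1}) :=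
  `[< cover (natf h) /\ forall i, (0 < h i)%N -> (0 < c i <= h i)%N >].
pose mu (h : {ffun 'I_n -> 'I_B.+1}) := (\sum_i if h i == 0%N :> nat then B.+1 else h i)%N.
pose h0 : {ffun 'I_n -> 'I_B.+1} := [ffun i => if (c i <= B)%N then inord (c i) else ord0].
have h0E i : h0 i = (if (c i <= B)%N then c i else 0%N) :> nat.
  by rewrite ffunE; case: ifP => // cB; rewrite inordK.
have Rh0 : R h0.
  apply/asboolP; split=> [p /cov_c[i /andP[ci ce]]|i]; last by rewrite h0E; case: ifP => // _ -> /=.
  by exists i; rewrite h0E (leq_trans ce (exponent_le p i)) ci.
have [h /asboolP[cov_h hc] hmax] := @arg_maxnP _ h0 R mu Rh0.
have {}hmax g : R g -> (mu g <= mu h)%N by exact: hmax.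
exists (natf h) => //; split=> // i hi.
(* Raise the entry at i by one, or drop i if it is at B already: [mu] grows, so by maximality some p
   is no longer covered, and only i covered it. *)
pose v := if (h i < B)%N then (h i).+1 else 0%N.
have vB : (v < B.+1)%N by rewrite /v; case: ifP.
pose g : {ffun 'I_n -> 'I_B.+1} := [ffun j => if j == i then Ordinal vB else h j].
have gi : g i = v :> nat by rewrite ffunE eqxx.
have gj j : j != i -> g j = h j by rewrite ffunE => /negPf ->.
have hB j : (h j <= B)%N by rewrite -ltnS.
have ncov : ~ cover (natf g).
  move=> cov_g; have /hmax : R g.
    apply/asboolP; split=> // j; have [->|ji] := eqVneq j i; last by rewrite gj //; apply: hc.
    have /andP[ci ch] := hc i hi; rewrite gi ci /v; case: ifP => // _ _.
    exact: leq_trans (leqnSn _).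
  rewrite /mu leqNgt => /negP; apply; rewrite [ltnLHS](bigD1 i) // [ltnRHS](bigD1 i) //=.
  rewrite (eq_bigr (fun j => if g j == 0%N :> nat then B.+1 else g j)); last by move=> j /gj ->.
  rewrite ltn_add2r gi /v (gtn_eqF hi); by have [_|_] := ltnP (h i) B; rewrite /= ltnS.
have [p [Pp np]] : exists p, P p /\ forall j, ~ (0 < g j <= e p j)%N.
  apply: contrapT => nex; apply: ncov => p Pp; apply: contrapT => np; apply: nex.
  by exists p; split=> // j gje; apply: np; exists j.
exists p; split=> //.
  have [j /andP[hj hje]] := cov_h p Pp; have [ji|ji] := eqVneq j i; last first.
    by case: (np j); rewrite gj // hj hje.
  subst j; apply/eqP; rewrite eqn_leq hje /= leqNgt; apply/negP => lt_he.
  by apply: (np i); rewrite gi /v (leq_trans lt_he (exponent_le p i)) lt_he.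
by move=> j ji hj; rewrite ltnNge; apply/negP => hje; apply: (np j); rewrite gj // hj.
Qed.

(** Refinement may raise entries but drops no vertex i, as the p belonging to i would be left
    uncovered. Hence convenient exponents suffice when only the support matters. *)
Lemma support_minimal_cover c : cover c ->
  (forall i, (0 < c i)%N -> exists2 p, P p & forall j, j != i -> (0 < c j)%N -> (e p j < c j)%N) ->
  exists2 d, min_cover d & cover_support d = cover_support c.
Proof.
move=> cov_c cmin; have [d [cov_d dmin] dc] := cover_refine cov_c; exists d; first by [].
apply/setP => i; rewrite !inE; apply/idP/idP => [/dc /andP[]//|/cmin[p Pp np]].
have [j /andP[dj dje]] := cov_d p Pp; have /andP[cj cdj] := dc j dj.
have [<- //|ji] := eqVneq j i.
by have := np j ji cj; rewrite ltnNge (leq_trans cdj).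
Qed.

Lemma min_cover_unique c d : cover c -> min_cover d ->
  (forall i, (0 < c i)%N -> (0 < d i <= c i)%N) -> c =1 d.
Proof.
move=> cov_c [_ dmin] cd.
have sub i : (0 < d i)%N -> c i = d i.
  move=> di; have [p [Pp die np]] := dmin i di.
  have [j /andP[cj cje]] := cov_c p Pp; have /andP[dj dcj] := cd j cj.
  have [ji|ji] := eqVneq j i; last by have := np j ji dj; rewrite ltnNge (leq_trans dcj).
  by subst j; apply/eqP; rewrite eqn_leq die cje -die dcj.
move=> i; have [di0|/sub //] := posnP (d i).
rewrite di0; apply/eqP; rewrite -leqn0 leqNgt; apply/negP => /cd.
by rewrite di0.
Qed.

Definition above m : Prop := exists2 p, P p & (e p <= m)%MM.

Lemma above_upclosed : upclosed above.
Proof. by move=> m m' [p Pp le_p]; exists p => //; apply: lepm_trans le_p (lem_addr _ _). Qed.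

(** If no generator divides m, then m + 1 is a cover, and a minimal cover refining it exceeds m on
    its whole support. *)
Lemma aboveP m : above m <-> forall c, min_cover c -> exists i, (0 < c i <= m i)%N.
Proof.
split=> [[p Pp /mnm_lepP le_p] c [/(_ p Pp)[i /andP[ci ce]] _]|mc].
  by exists i; rewrite ci (leq_trans ce).
apply: contrapT => nm.
have cov : cover (fun i => (m i).+1).
  move=> p Pp; apply: contrapT => nex; apply: nm; exists p => //.
  apply/mnm_lepP => i; rewrite leqNgt; apply/negP => mi; apply: nex.
  by exists i.
have [c minc cm] := cover_refine cov; have [i /andP[ci ce]] := mc c minc.
by have := cm i ci; rewrite /= ltnNge ce.
Qed.

(* A monomial of the socle modulo the variables outside the support of c. *)
Lemma min_cover_socle c : min_cover c -> exists2 u : 'X_{1..n}, ~ above u &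
  forall i, i \in cover_support c -> above (u + U_(i))%MM.
Proof.
case=> cov_c cmin.
(* One less than c on the support, and outside it large enough for every generator, so the generator
   private to i divides u times X_i. *)
pose u : 'X_{1..n} := [multinom (if (0 < c i)%N then (c i).-1 else exponent_bound) | i < n].
exists u => [[p /cov_c[i /andP[ci ce]] /mnm_lepP /(_ i)]|i].
  by rewrite mnmE ci leqNgt prednK // ce.
rewrite inE => ci; have [p [Pp cie np]] := cmin i ci; exists p => //.
apply/mnm_lepP => j; rewrite mnmDE mnmE mnm1E; have [<-|ij] := eqVneq i j.
  by rewrite ci addn1 prednK // cie.
rewrite addn0; case: ifP => [cj|_]; last exact: exponent_le.
by have := np j; rewrite eq_sym => /(_ ij cj); case: (c j) cj.
Qed.

Section Unmixed.
Local Open Scope ring_scope.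
Variables (A : fieldType) (J : {pred {mpoly A[n]}}).
Hypothesis memJ : forall f, f \in J <-> mono_ideal above f.

Lemma mem_P_ideal (W : {set 'I_n}) (sigma : 'I_n -> nat) f :
  f \in P_ideal A W sigma <-> mono_ideal (fun m => exists2 i, i \in W & (sigma i <= m i)%N) f.
Proof.
have -> : P_ideal A W sigma =
    gen_ideal (fun i => i \in W) (fun i => 'X_[U_(i) *+ sigma i] : {mpoly A[n]}).
  by congr gen_ideal; apply/funext => i; rewrite mpolyXn.
rewrite gen_ideal_monomials.
have -> : (fun m : 'X_{1..n} => exists2 i, i \in W & (U_(i) *+ sigma i <= m)%MM) =
          (fun m => exists2 i, i \in W & (sigma i <= m i)%N) => //.
apply: predP_eq => m; split=> [[i iW /mnm_lepP /(_ i)]|[i iW im]].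
  by rewrite mulmnE mnm1E eqxx mul1n; exists i.
exists i => //; apply/mnm_lepP => j; rewrite mulmnE mnm1E.
by case: eqP => [<-|_]; rewrite ?mul1n ?mul0n.
Qed.

(** The last alternative is the unit ideal: exponent 0 makes 1 a generator. *)
Lemma P_ideal_sub (W W' : {set 'I_n}) (sigma sigma' : 'I_n -> nat) :
  {subset P_ideal A W sigma <= P_ideal A W' sigma'} <->
  forall i, i \in W -> i \in W' /\ (sigma' i <= sigma i)%N \/ exists2 j, j \in W' & sigma' j = 0%N.
Proof.
split=> [sub i iW|sub f].
  have /sub /mem_P_ideal : 'X_[U_(i) *+ sigma i] \in P_ideal A W sigma.
    by apply/mem_P_ideal/mono_idealX; exists i; rewrite // mulmnE mnm1E eqxx mul1n.
  case/mono_idealX => j jW'; rewrite mulmnE mnm1E; case: eqP jW' => [<-|_] jW'.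
    by rewrite mul1n => le_s; left.
  by rewrite mul0n leqn0 => /eqP s0; right; exists j.
move=> /mem_P_ideal fW; apply/mem_P_ideal => m /fW[i /sub [[iW' le_s]|[j jW' sj]] le_m].
  by exists i => //; apply: leq_trans le_m.
by exists j; rewrite // sj.
Qed.

(** Every minimal cover c is a component: some component k lies over c entrywise on W k, and being
    itself a cover, it equals c by [min_cover_unique]. *)
Lemma m_unmixed_min_covers : m_unmixed J -> forall c d, min_cover c -> min_cover d ->
  #|cover_support c| = #|cover_support d|.
Proof.
case=> t [W [sigma [[s0 JP _] eqW]]].
suff compo c : min_cover c -> exists k, cover_support c = W k.
  by move=> c d /compo[k ->] /compo[l ->].
move=> minc; have [cov_c _] := minc.
have [k kc] : exists k, forall i, i \in W k -> (0 < c i <= sigma k i)%N.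
  apply: contrapT => nex.
  have /choice[v vP] k : exists i, i \in W k /\ ~ (0 < c i <= sigma k i)%N.
    apply: contrapT => nk; apply: nex; exists k => i iW; apply: contrapT => ni.
    by apply: nk; exists i.
  (* v k is a vertex of component k at which c is zero or too large. This monomial lies in every
     component, hence in J, but stays below c on the support of c. *)
  pose m : 'X_{1..n} := [multinom (\max_(k < t | v k == i) sigma k i)%N | i < n].
  have /memJ/mono_idealX[p Pp /mnm_lepP le_p] : 'X_[m] \in J.
    apply/JP => k; apply/mem_P_ideal/mono_idealX; exists (v k); first by case: (vP k).
    by rewrite mnmE (bigD1 k) //= leq_maxl.
  have [i /andP[ci cie]] := cov_c p Pp.
  have := leq_trans cie (le_p i); rewrite mnmE leqNgt => /negP; apply.
  rewrite -[X in (_ < X)%N](prednK ci) ltnS; apply/bigmax_leqP => k /eqP vk.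
  have [_] := vP k; rewrite vk ci /= => /negP; rewrite -ltnNge.
  by rewrite -{1}(prednK ci).
exists k; pose d i := if i \in W k then sigma k i else 0%N.
have cov_d : cover d.
  move=> p Pp; have : 'X_[e p] \in J by apply/memJ/mono_idealX; exists p => //; apply: lepm_refl.
  move/JP/(_ k)/mem_P_ideal/mono_idealX => [i iW le_s].
  by exists i; rewrite /d iW le_s s0.
have dc : d =1 c.
  by apply: min_cover_unique => // i; rewrite /d; case: ifP => // iW _; apply: kc.
by apply/setP => i; rewrite inE -dc /d; case: ifP => // /s0 ->.
Qed.

(** The components are indexed by a list of all minimal covers, finite because their nonzero entries
    are exponents of generators. *)
Lemma min_covers_m_unmixed : (forall c d, min_cover c -> min_cover d ->
  #|cover_support c| = #|cover_support d|) -> m_unmixed J.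
Proof.
move=> eqc; set B := exponent_bound.
pose ms := [seq h : {ffun 'I_n -> 'I_B.+1} <- enum {ffun 'I_n -> 'I_B.+1} | `[< min_cover (natf h) >]].
pose h k := tnth (in_tuple ms) k.
have minh k : min_cover (natf (h k)).
  by have := mem_tnth k (in_tuple ms); rewrite mem_filter => /andP[/asboolP].
have hP c : min_cover c -> exists k, c =1 natf (h k).
  move=> minc; have cB i : (c i < B.+1)%N.
    have [->//|/(proj2 minc)[p [_ -> _]]] := posnP (c i); exact: exponent_le.
  have : [ffun i => Ordinal (cB i)] \in ms.
    rewrite mem_filter mem_enum andbT; apply/asboolP.
    by rewrite (_ : (fun i => _) = c) //; apply/funext => i; rewrite ffunE.
  by case/(tnthP (in_tuple ms)) => k hk; exists k => i; rewrite /h -hk ffunE.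
exists (size ms), (fun k => cover_support (natf (h k))), (fun k => natf (h k)).
split; last by move=> k l; apply: eqc.
split=> [k i|f|k l kl].
- by rewrite inE.
- have PE k : f \in P_ideal A (cover_support (natf (h k))) (natf (h k)) <->
      mono_ideal (fun m => exists i, (0 < h k i <= m i)%N) f.
    rewrite mem_P_ideal; split=> Pf m /Pf [i]; first by rewrite inE => hi him; exists i; rewrite hi.
    by case/andP => hi him; exists i; rewrite // inE.
  split=> [/memJ Jf k|Pf]; first by apply/PE => m /Jf /aboveP; apply.
  apply/memJ => m mf; apply/aboveP => c /hP[k ck].
  by have /PE/(_ m mf)[i] := Pf k; exists i; rewrite ck.
- move/P_ideal_sub => sub; case/eqP: kl; apply/val_inj/eqP.
  have uniq_ms : uniq ms by rewrite filter_uniq ?enum_uniq.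
  have kE : h k = h l.
    apply/ffunP => i; apply/val_inj; have := min_cover_unique (proj1 (minh k)) (minh l) _ i; apply.
    move=> j hj; have [|[hj' ->]|[j']] := sub j; rewrite ?inE //; first by move: hj'; rewrite inE => ->.
    by rewrite lt0n => /eqP.
  have hE (k' : 'I_(size ms)) : nth (h k) ms k' = h k' by apply: esym (tnth_nth _ (in_tuple ms) k').
  rewrite -(nth_uniq (h k) (ltn_ord k) (ltn_ord l) uniq_ms); apply/eqP.
  exact: etrans (hE k) (etrans kE (esym (hE l))).
Qed.

End Unmixed.
End Covers.

(** * Quotient rings, residue fields and the Cohen-Macaulay property *)

Section Quotients.
Local Open Scope ring_scope.

Lemma ideal_quot_proj (R : comNzRingType) (J : {pred R}) (hJ : idealr_closed J) :
  exists pi : {rmorphism R -> {ideal_quot (bundled_ideal hJ)}},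
    (forall q, exists f, pi f = q) /\ forall f, pi f = 0 <-> f \in J.
Proof.
exists (\pi_({ideal_quot (bundled_ideal hJ)}))%qT; split=> [q|f].
  by exists (repr q); apply: reprK.
have -> : (f \in J) = (f - 0 \in bundled_ideal hJ) by rewrite subr0.
rewrite Quotient.idealrBE -(rmorph0 (\pi_({ideal_quot (bundled_ideal hJ)}))%qT).
by split=> [->|/eqP].
Qed.

(** An alias of R, to carry the field structure given by the chosen inverses. *)
Definition field_of (R : comNzRingType) (inv : R -> R)
  (invP : forall x, x != 0 -> inv x * x = 1) : Type := R.

Section FieldOf.
Variables (R : comNzRingType) (inv : R -> R) (invP : forall x, x != 0 -> inv x * x = 1).
HB.instance Definition _ := GRing.ComNzRing.on (field_of invP).

Definition field_of_inv (x : field_of invP) : field_of invP := if x == 0 then 0 else inv x.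

Lemma field_of_mulVf : forall x : field_of invP, x != 0 -> field_of_inv x * x = 1.
Proof. by move=> x x0; rewrite /field_of_inv (negPf x0); apply: invP. Qed.

Lemma field_of_inv0 : field_of_inv 0 = 0.
Proof. by rewrite /field_of_inv eqxx. Qed.

HB.instance Definition _ := GRing.ComNzRing_isField.Build (field_of invP) field_of_mulVf field_of_inv0.
End FieldOf.

Lemma maximal_residue_field (R : comNzRingType) (M : {pred R}) : maximal_ideal M ->
  exists (K : fieldType) (psi : {rmorphism R -> K}),
    (forall z, exists f, psi f = z) /\ forall f, psi f = 0 <-> f \in M.
Proof.
case=> hM maxM; have [pi [surj ker]] := ideal_quot_proj hM.
pose L := {ideal_quot (bundled_ideal hM)}.
have /choice[inv invP] (x : L) : exists y : L, x != 0 -> y * x = 1.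
  have [f fx] := surj x; have [Mf|Mf] := boolP (f \in M).
    by exists 0; rewrite -fx; move/ker: Mf => ->; rewrite eqxx.
  have /idealr_closedP[iM M1] := hM.
  have [b Mb] : adjoin (fun f => f \in M) f 1.
    apply: contrapT => n1; case/negP: Mf.
    apply: (maxM (fun g => `[< adjoin (fun f => f \in M) f g >])).
    - apply/idealr_closedP; split; last by apply/negP => /asboolP.
      have [h0 hD] := adjoin_ideal iM f; split=> [|a u v /asboolP Ju /asboolP Jv]; apply/asboolP => //.
      exact: hD.
    - by move=> g Mg; apply/asboolP/sub_adjoin.
    - by apply/asboolP/mem_adjoin.
  exists (pi b) => _; rewrite -fx -rmorphM mulrC; apply/esym/eqP.
  by rewrite -subr_eq0 -(rmorph1 pi) -rmorphB; apply/eqP/ker.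
exists (field_of invP), pi; split; [exact: surj | exact: ker].
Qed.

Section Projection.
Variables (S Q : comNzRingType) (pi : {rmorphism S -> Q}) (J : S -> Prop).
Hypotheses (surj : forall q, exists f, pi f = q) (ker : forall f, pi f = 0 <-> J f).

Lemma ker_ideal : is_ideal J.
Proof.
split=> [|a u v /ker Ju /ker Jv]; apply/ker; first exact: rmorph0.
by rewrite rmorphD rmorphM Ju Jv mulr0 addr0.
Qed.

Lemma preim_ideal (P : Q -> Prop) : is_ideal P -> is_ideal (fun f => P (pi f)).
Proof.
move=> hP; split=> [|a u v Pu Pv]; first by rewrite rmorph0; apply: ideal0.
by rewrite rmorphD rmorphM; apply: idealD => //; apply: idealM.
Qed.

Lemma preim_prime (P : Q -> Prop) : is_prime P -> is_prime (fun f => P (pi f)).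
Proof.
case=> hP P1 PM; split=> [||u v]; [exact: preim_ideal | by rewrite rmorph1 | ].
by rewrite rmorphM => /PM.
Qed.

(** The dictionary by which regular sequences of the quotient Q are studied in S, relative to the
    kernel J. *)
Lemma gen_ideal_adjoin d (ys : seq S) i f : size ys = d ->
  pi f \in gen_ideal (fun j : 'I_d => (j < i)%N) (fun j => pi ys`_j) <->
  foldl (@adjoin S) J (take i ys) f.
Proof.
move=> szy; split; last first.
  pose G := gen_ideal (fun j : 'I_d => (j < i)%N) (fun j => pi ys`_j).
  have hG : is_ideal (fun f => f \in G) by apply: gen_ideal_is_ideal.
  apply: (@foldl_adjoin_sub _ _ (fun f => pi f \in G) _ (preim_ideal hG)) => [g /ker ->|y].
    exact: ideal0 hG.
  case/(nthP 0) => j; rewrite size_take_min leq_min => /andP[ji jsz] <-.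
  rewrite nth_take //; rewrite szy in jsz.
  exact: (mem_gen_ideal (fun j : 'I_d => pi ys`_j) (i := Ordinal jsz)).
case/asboolP => c fE; have [c' c'E] := choice (fun j => surj (c j)).
have hF := foldl_adjoin_ideal (take i ys) ker_ideal.
rewrite -[f](subrK (\sum_(j < d | (j < i)%N) c' j * ys`_j)); apply: (idealD hF).
  have : J (f - \sum_(j < d | (j < i)%N) c' j * ys`_j).
    apply/ker; rewrite rmorphB fE rmorph_sum; apply/eqP; rewrite subr_eq0; apply/eqP.
    by apply: eq_bigr => j _; rewrite rmorphM c'E.
  elim: (take i ys) (J) => //= x xs IH J' J'f; exact/IH/sub_adjoin.
apply: (ideal_sum hF) => j ji; apply: (idealM hF).
have : ys`_j \in take i ys.
  by rewrite -(nth_take _ ji) mem_nth // size_take_min leq_min ji szy ltn_ord.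
elim: (take i ys) (J) ker_ideal => //= x xs IH J' hJ'.
rewrite inE => /orP[/eqP ->|]; last exact/IH/adjoin_ideal.
by elim: xs (adjoin J' x) (mem_adjoin hJ' x) {IH} => //= y xs IH J'' J''x; exact/IH/sub_adjoin.
Qed.

Lemma regular_sequence_lift (ys : seq S) d : size ys = d -> weakly_regular J ys ->
  ~ foldl (@adjoin S) J ys 1 -> regular_sequence (fun j : 'I_d => pi ys`_j).
Proof.
move=> szy reg n1; split=> [|i a].
  apply/negP => in1; apply: n1; rewrite -[ys]take_size.
  apply/(gen_ideal_adjoin (size ys) _ szy); rewrite rmorph1.
  by move: in1; congr (_ \in gen_ideal _ _); apply/funext => j; rewrite szy ltn_ord.
have [f <-] := surj a; rewrite -rmorphM => /(gen_ideal_adjoin _ _ szy) h.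
apply/(gen_ideal_adjoin _ _ szy); apply: (iffLR (weakly_regular_take ys ker_ideal) reg) h.
by rewrite szy.
Qed.

Lemma lift_regular_sequence d (x : 'I_d -> Q) : regular_sequence x ->
  exists ys, [/\ size ys = d, forall j, x j = pi ys`_j & weakly_regular J ys].
Proof.
case=> _ reg; have [y yx] := choice (fun j => surj (x j)).
pose ys := [seq y j | j <- enum 'I_d].
have szy : size ys = d by rewrite size_map size_enum_ord.
have ysE (j : 'I_d) : ys`_j = y j.
  by rewrite (nth_map j) ?size_enum_ord // nth_ord_enum.
have xE j : x j = pi ys`_j by rewrite ysE yx.
exists ys; split=> //; apply/(weakly_regular_take ys ker_ideal) => i; rewrite szy => id f.
have xfun : x = (fun j => pi ys`_j) by apply/funext.
rewrite xfun in reg.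
move/(gen_ideal_adjoin _ _ szy); rewrite rmorphM => /(reg (Ordinal id)).
by move/(gen_ideal_adjoin _ _ szy).
Qed.

Lemma chain_below_preim (P : {pred Q}) d :
  prime_chain_to P d <-> chain_below J (fun f => pi f \in P) d.
Proof.
rewrite prime_chain_toP; split=> [[C [Cd C0 pC Cinc Cprop]]|[C [Cd JC pC Cinc Cprop]]].
  exists (fun k f => C k (pi f)); split=> [|f /ker Jf|k /pC|k kd f|k kd].
  - by apply: predP_eq => f; rewrite Cd.
  - exact: C0.
  - exact: preim_prime.
  - exact: Cinc.
  - have [q Cq nCq] := Cprop k kd; have [f fq] := surj q.
    by exists f; rewrite fq.
have JCk k : (k <= d)%N -> forall f, J f -> C k f.
  elim: k => [_|k IHk kd f Jf]; first exact: JC.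
  by apply: Cinc => //; apply: IHk => //; apply: ltnW.
pose C' k q := exists2 f, pi f = q & C k f.
have C'P k f : (k <= d)%N -> C' k (pi f) <-> C k f.
  move=> kd; split=> [[g gf Cg]|]; last by exists f.
  have [hC _ _] := pC k kd; rewrite -[f](subrK g); apply: (idealD hC) => //.
  by apply: (JCk k kd); apply/ker; rewrite rmorphB gf subrr.
exists C'; split=> [|q ->|k kd|k kd q [f <-]|k kd].
- apply: predP_eq => q; have [f <-] := surj q; rewrite C'P // Cd; by [].
- by rewrite -(rmorph0 pi); apply/C'P => //; apply/JC/ker; rewrite rmorph0.
- have [hC C1 CM] := pC k kd; split.
  + split=> [|a u v]; first by rewrite -(rmorph0 pi); apply/C'P => //; apply: ideal0.
    have [a' <-] := surj a; have [u' <-] := surj u; have [v' <-] := surj v.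
    rewrite -rmorphM -rmorphD !C'P // => Cu Cv; apply: (idealD hC) => //; exact: (idealM hC).
  + by rewrite -(rmorph1 pi) C'P.
  + move=> u v; have [u' <-] := surj u; have [v' <-] := surj v.
    by rewrite -rmorphM !C'P //; apply: CM.
- by move=> Cf; exists f => //; apply: Cinc.
- have [f Cf nCf] := Cprop k kd; exists (pi f); first exact/C'P.
  by rewrite C'P // ltnW.
Qed.

(* A regular sequence of length D in each maximal ideal yields a prime chain of
   length D, so it suffices to bound the lengths of prime chains by D. *)
Lemma cohen_macaulay_criterion D :
  (forall M : {pred Q}, maximal_ideal M ->
     exists ys, [/\ size ys = D, weakly_regular J ys & forall y, y \in ys -> pi y \in M]) ->
  (forall (P : S -> Prop) k, chain_below J P k -> (k <= D)%N) -> cohen_macaulay Q.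
Proof.
move=> regD chainD M maxM; exists D.
have [hM M1 MM] := iffLR (prime_idealP M) (maximal_prime maxM).
have JM f : J f -> pi f \in M by move/ker ->; apply: ideal0 hM.
have chain k : regular_sequence_in M k -> prime_chain_to M k.
  case=> x [reg xM]; have [ys [szy xE regy]] := lift_regular_sequence reg.
  apply/chain_below_preim; rewrite -szy.
  apply: weakly_regular_chain regy; [exact: ker_ideal|exact: (preim_prime (And3 hM M1 MM))|exact: JM|].
  move=> y /(nthP 0)[i]; rewrite szy => id <-.
  by rewrite -(xE (Ordinal id)).
have regM : regular_sequence_in M D.
  have [ys [szy regy yM]] := regD M maxM.
  exists (fun j : 'I_D => pi ys`_j); split; last by move=> j; apply/yM/mem_nth; rewrite szy.
  apply: regular_sequence_lift => // in1; case: (M1); rewrite -(rmorph1 pi).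
  exact: (foldl_adjoin_sub (preim_ideal hM) JM yM in1).
have le_D k : prime_chain_to M k -> (k <= D)%N by move/chain_below_preim/chainD.
by split; split=> //; [move=> k /chain /le_D | exact: chain].
Qed.

End Projection.

Section CohenMacaulayUnmixed.
Variables (A : fieldType) (n : nat) (I : finType) (P : pred I) (e : I -> 'X_{1..n}).
Hypothesis e_neq0 : forall p, P p -> exists i, (0 < e p i)%N.
Variable J : {pred {mpoly A[n]}}.
Hypothesis memJ : forall f, f \in J <-> mono_ideal (above P e) f.

Lemma cohen_macaulay_unmixed : cohen_macaulay_ideal J -> forall c d,
  min_cover P e c -> min_cover P e d -> #|cover_support c| = #|cover_support d|.
Proof.
case=> hJ CM; have [pi [surj ker0]] := ideal_quot_proj hJ.
have ker f : pi f = 0 <-> mono_ideal (above P e) f by rewrite ker0 memJ.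
have [hm m1 mM] := @var_ideal_prime A n [set: 'I_n].
have Jm f : mono_ideal (above P e) f -> var_ideal [set: 'I_n] f.
  move=> Jf m /Jf[p Pp /mnm_lepP le_p]; have [i ei] := e_neq0 Pp.
  by exists i; rewrite ?inE // (leq_trans ei).
pose M : {pred {ideal_quot (bundled_ideal hJ)}} :=
  fun q => `[< exists2 f, pi f = q & var_ideal [set: 'I_n] f >].
have MP f : (pi f \in M) <-> var_ideal [set: 'I_n] f.
  split=> [/asboolP[g gf mg]|mf]; last by apply/asboolP; exists f.
  rewrite -[f](subrK g); apply: (idealD hm) => //.
  by apply/Jm/ker; rewrite rmorphB gf subrr.
have iM : is_ideal (fun q => q \in M).
  split=> [|a u v]; first by rewrite -(rmorph0 pi) MP; apply: ideal0 hm.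
  have [a' <-] := surj a; have [u' <-] := surj u; have [v' <-] := surj v.
  rewrite -rmorphM -rmorphD !MP => mu mv; apply: (idealD hm) => //; exact: (idealM hm).
have maxM : maximal_ideal M.
  split=> [|J' /idealr_closedP[iJ' J'1] sub q].
    by apply/idealr_closedP; split=> //; apply/negP; rewrite -(rmorph1 pi) MP.
  have [f <-] := surj q; rewrite MP => J'f; apply: contrapT => nf.
  (* f has a nonzero constant term; the rest of f maps into M, so J' contains a unit. *)
  have c0 : f@_0%MM != 0.
    apply/eqP => c0; apply: nf => m mf.
    have [i mi] : exists i, (0 < m i)%N.
      apply: contrapT => nex; move: mf; rewrite mcoeff_msupp.
      rewrite (_ : m = 0%MM) ?c0 ?eqxx //; apply/mnmP => i; rewrite mnm0E; apply/eqP.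
      by rewrite -leqn0 leqNgt; apply/negP => mi; apply: nex; exists i.
    by exists i; rewrite ?inE.
  have /sub J'g : pi (f - (f@_0%MM)%:MP) \in M.
    apply/MP => m; rewrite mcoeff_msupp mcoeffB mcoeffC.
    have [->|m0 _] := eqVneq m 0%MM; first by rewrite mulr1 subrr eqxx.
    apply: contrapT => nex; case/eqP: m0; apply/mnmP => i; rewrite mnm0E; apply/eqP.
    by rewrite -leqn0 leqNgt; apply/negP => mi; apply: nex; exists i; rewrite ?inE.
  case/negP: J'1; have -> : 1 = pi ((f@_0%MM)^-1)%:MP * (pi f - pi (f - (f@_0%MM)%:MP)).
    by rewrite -rmorphB -rmorphM opprB addrC subrK -mpolyCM mulVf // rmorph1.
  by apply: (idealM iJ'); apply: (idealB iJ').
have [D [[[x [reg xM]] _] [_ ht]]] := CM M maxM.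
have [ys [szy xE regy]] := lift_regular_sequence surj ker reg.
suff card c : min_cover P e c -> #|~: cover_support c| = D.
  move=> c d /card cD /card dD; have := cardsC (cover_support c).
  by rewrite -(cardsC (cover_support d)) cD dD => /addIn.
move=> minc; apply/eqP; rewrite eqn_leq; apply/andP; split.
  apply: ht; apply/(chain_below_preim surj ker).
  have -> : (fun f => is_true (pi f \in M)) = var_ideal [set: 'I_n].
    by apply: predP_eq => f; rewrite MP.
  have [C [CD C0 pC Cinc Cprop]] := @var_ideal_chain A n (cover_support c).
  exists C; split=> // f Jf; apply: C0 => m /Jf[p Pp /mnm_lepP le_p].
  have [i /andP[ci ce]] := proj1 minc p Pp; exists i; first by rewrite inE.
  exact: leq_trans (leq_trans ci ce) _.
have [u nu ucov] := min_cover_socle minc; rewrite -szy.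
apply: (weakly_regular_length_le (@above_upclosed _ _ P e) nu ucov) regy.
move=> y /(nthP 0)[i]; rewrite szy => id <-; apply/MP.
by rewrite -(xE (Ordinal id)).
Qed.

End CohenMacaulayUnmixed.
End Quotients.

(** * Parameters along whiskers *)

Section FilledCohenMacaulay.
Local Open Scope ring_scope.
Variables (A : fieldType) (n b r : nat).
Variables (s : 'I_b -> 'I_r.+1 -> 'I_n) (a : 'I_b -> 'I_r.+1 -> nat).
Hypothesis s_inj : forall i k j l, s i k = s j l -> i = j /\ k = l.
Local Notation S := {mpoly A[n]}.

Definition whisker_coord (v : 'I_n) : option ('I_b * 'I_r.+1) := [pick u | s u.1 u.2 == v].

Lemma whisker_coordK i k : whisker_coord (s i k) = Some (i, k).
Proof.
rewrite /whisker_coord; case: pickP => [[j l] /= /eqP /s_inj[-> ->] //|/(_ (i, k))].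
by rewrite eqxx.
Qed.

Variant whisker_coord_spec v : option ('I_b * 'I_r.+1) -> Prop :=
  | WhiskerCoord i k of v = s i k : whisker_coord_spec v (Some (i, k))
  | NoWhiskerCoord of (forall i k, s i k != v) : whisker_coord_spec v None.

Lemma whisker_coordP v : whisker_coord_spec v (whisker_coord v).
Proof.
rewrite /whisker_coord; case: pickP => [[i k] /= /eqP <-|nv]; first exact: WhiskerCoord.
by apply: NoWhiskerCoord => i k; apply/negbT/(nv (i, k)).
Qed.

Definition bases : {set 'I_n} := [set s i ord0 | i : 'I_b].

Local Notation index := {v : 'I_n | v \notin bases}.

Definition parameter (v : index) : S :=
  if whisker_coord (val v) is Some (i, k) then 'X_(s i (inord k.-1)) - 'X_(val v) else 'X_(val v).

(* The translation along shift kappa v moves the parameter of v by 1, fixes the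
   other parameters and the variables s i (kappa i). *)
Definition shift (kappa : 'I_b -> 'I_r.+1) (v : index) (u : 'I_n) : A :=
  match whisker_coord (val v), whisker_coord u with
  | Some (i, k), Some (j, l) =>
    if j == i then (if (k <= kappa i)%N then (l < k)%N%:R else - (k <= l)%N%:R) else 0
  | None, None => (u == val v)%:R
  | _, _ => 0
  end.

Lemma shift_kappa kappa v u : u \in [set s i (kappa i) | i : 'I_b] -> shift kappa v u = 0.
Proof.
case/imsetP => i _ ->; rewrite /shift whisker_coordK.
case: whisker_coord => [[j k]|] //; have [<-|//] := eqVneq i j.
by case: leqP => //= _; rewrite oppr0.
Qed.

Lemma index_pos (v : index) i k : val v = s i k -> (0 < k)%N.
Proof.
move=> vE; rewrite lt0n; apply: contraNneq (valP v) => k0; rewrite vE.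
by apply/imsetP; exists i => //; congr s; apply: val_inj.
Qed.

(** Along the whisker of v, at position k, [shift] is a step function whose only jump, of height 1,
    is between k - 1 and k, normalized to vanish on the side of kappa i. So the difference at k
    moves by 1 and the other differences stay. *)
Lemma shift_parameter kappa v w :
  translate (shift kappa v) (parameter v) (parameter w) =
  (parameter w)%:P + (w == v)%:R%:P * ('X - (parameter v)%:P).
Proof.
set psi := translate _ _; set T := 'X - _.
have psiX u : psi 'X_u = ('X_u)%:P + (shift kappa v u)%:MP%:P * T by apply: translateX.
have mpb (x : bool) : (x%:R : A)%:MP = x%:R :> S by case: x; rewrite ?mpolyC1 ?mpolyC0.
have wv : (w == v) = (val w == val v) by [].
rewrite wv {wv} /parameter; case: (whisker_coordP (val w)) => [i k wE|wN].
  have k0 := index_pos wE; have kE : (inord k.-1 : 'I_r.+1) = k.-1 :> nat.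
    by rewrite inordK // (leq_ltn_trans (leq_pred _)).
  rewrite rmorphB !psiX opprD addrACA -mulrBl -!polyCB -mpolyCB; congr (_ + _%:P * _).
  rewrite -mpb; congr (_%:MP); rewrite /shift wE !whisker_coordK.
  case: (whisker_coordP (val v)) => [j l vE|vN]; last by rewrite subrr (negPf (vN _ _)).
  have l0 := index_pos vE; rewrite vE.
  have -> : (s i k == s j l) = (i == j) && (k == l).
    apply/eqP/andP => [/s_inj[-> ->]//|[/eqP -> /eqP -> //]].
  have [_|_] := eqVneq i j; last by rewrite subrr.
  have -> : (k == l) = (k == l :> nat) by [].
  rewrite kE; case: ifP => _.
    have [->|kl] := eqVneq (k : nat) l; first by rewrite ltnn subr0 prednK // leqnn.
    have -> : (k.-1 < l)%N = (k < l)%N by move: kl k0; lia.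
    by rewrite subrr.
  have [->|kl] := eqVneq (k : nat) l.
    by rewrite leqnn opprK leqNgt prednK // leqnn oppr0 add0r.
  have -> : (l <= k.-1)%N = (l <= k)%N by move: kl k0; lia.
  by rewrite subrr.
rewrite psiX; congr (_ + _%:P * _); rewrite -mpb; congr (_%:MP).
rewrite /shift; case: (whisker_coordP (val w)) => [i k wE|_]; first by have := wN i k; rewrite wE eqxx.
by case: (whisker_coordP (val v)) => [j l vE|vN] //; rewrite vE eq_sym (negPf (wN _ _)).
Qed.

Lemma card_kappa (kappa : 'I_b -> 'I_r.+1) : #|~: [set s i (kappa i) | i : 'I_b]| = (n - b)%N.
Proof.
have cardW : #|[set s i (kappa i) | i : 'I_b]| = b.
  by rewrite card_imset ?card_ord // => i j /s_inj[].
have := cardsC [set s i (kappa i) | i : 'I_b]; rewrite card_ord cardW => cardsn.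
by rewrite -[X in (X - b)%N]cardsn addKn.
Qed.

Variables (I : finType) (P : pred I) (e : I -> 'X_{1..n}).
Hypotheses (e_le : forall p i k, P p -> (e p (s i k) <= a i k)%N)
  (e_fill : forall p i (k l : 'I_r.+1), P p -> (l < k)%N -> (0 < e p (s i k))%N -> e p (s i l) = a i l)
  (e_out : forall p v, P p -> (forall i k, s i k != v) -> e p v = 0%N)
  (e_whisker : forall i, exists2 p, P p & forall v, (e p v <= \sum_k (v == s i k) * a i k)%N)
  (e_neq0 : forall p, P p -> exists i, (0 < e p i)%N).
Variable J : {pred {mpoly A[n]}}.
Hypothesis memJ : forall f, f \in J <-> mono_ideal (above P e) f.

Lemma prime_monomial (Q : S -> Prop) (m : 'X_{1..n}) : is_prime Q -> Q 'X_[m] ->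
  exists2 v, (0 < m v)%N & Q 'X_v.
Proof.
move=> pQ; have [hQ Q1 QM] := pQ => Qm; apply: contrapT => nex; move: Qm.
rewrite mpolyXE_id; apply: (big_ind (fun x => ~ Q x)) => // [x y nx ny /QM[]//|v _].
have [->|mv] := posnP (m v); first by rewrite expr0.
by move/(prime_exp_avoid pQ) => Qv; apply: nex; exists v.
Qed.

Lemma filled_cohen_macaulay : cohen_macaulay_ideal J.
Proof.
have iJ : is_ideal (fun f => f \in J).
  have -> : (fun f => is_true (f \in J)) = mono_ideal (above P e) by apply: predP_eq => f; rewrite memJ.
  exact/mono_ideal_is_ideal/above_upclosed.
have hJ : idealr_closed J.
  apply/idealr_closedP; split=> //; apply/negP => /memJ /(_ 0%MM); rewrite msupp1 inE eqxx.
  case=> // p Pp /mnm_lepP le_p; have [i] := e_neq0 Pp.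
  by rewrite ltnNge -[X in (_ <= X)%N](mnm0E i) le_p.
exists hJ; have [pi [surj ker0]] := ideal_quot_proj hJ.
have ker f : pi f = 0 <-> mono_ideal (above P e) f by rewrite ker0 memJ.
apply: (cohen_macaulay_criterion (D := (n - b)%N) surj ker) => [M maxM|Q k].
  have [K [psi [psi_surj psi_ker]]] := maximal_residue_field maxM.
  pose phi : {rmorphism S -> K} := psi \o pi.
  have phi_surj z : exists f, phi f = z.
    by have [q <-] := psi_surj z; have [f <-] := surj q; exists f.
  have /choice[p pP] (v : index) : exists p : {poly A},
      p \is monic /\ phi (map_poly (@mpolyC n A) p).[parameter v] = 0.
    by have [p pmon p0] := zariski_algebraic (parameter v) phi_surj; exists p.
  exists [seq (map_poly (@mpolyC n A) (p v)).[parameter v] | v <- enum {: index}]; split.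
  - rewrite size_map -cardE card_sig -(card_kappa (fun=> ord0)).
    by apply: eq_card => v; rewrite !inE.
  - apply: (weakly_regular_filled s_inj e_le e_fill e_out e_whisker) => kappa.
    apply: weakly_regular_forms => [v|v|]; [by case: (pP v) | | exact: enum_uniq].
    exists (shift kappa v); split=> [u|| w wv]; first exact: shift_kappa.
      by rewrite shift_parameter eqxx mul1r addrC subrK.
    by rewrite shift_parameter (negPf wv) mul0r addr0.
  - by move=> y /mapP[v _ ->]; apply/psi_ker; case: (pP v).
case=> C [CQ JC pC Cinc Cprop]; have pC0 := pC 0%N (leq0n k).
(* The smallest prime of the chain contains the monomial of each whisker, hence a variable on each
   whisker: b variables in all. *)
have /choice[kappa kappaP] i : exists l, C 0%N 'X_(s i l).
  have [p Pp p_le] := e_whisker i.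
  have [|v pv Cv] := prime_monomial (m := e p) pC0.
    by apply/JC/mono_idealX; exists p => //; apply: lepm_refl.
  have [l vE|nv] := pickP (fun l => v == s i l); first by exists l; rewrite -(eqP vE).
  have := leq_trans pv (p_le v); rewrite big1 // => l _; by rewrite nv.
rewrite -(card_kappa kappa); apply: (@chain_length_le A _ _ Q); exists C; split=> // f.
have [hC _ _] := pC0; apply: (mono_ideal_min hC) => m [_ /imsetP[i _ ->] mi].
have le_m : (U_(s i (kappa i)) <= m)%MM.
  by apply/mnm_lepP => j; rewrite mnm1E; case: eqP => // <-.
by rewrite -(submK le_m) mpolyXD; apply: (idealM hC).
Qed.

End FilledCohenMacaulay.

(** * Path ideals of suspensions *)

Section PathMonomials.
Variables (n r : nat) (G : wgraph 'I_n).
Hypothesis r_gt0 : (0 < r)%N.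
Implicit Types (p : {ffun 'I_r.+1 -> 'I_n}) (x y v : 'I_n).

Definition path_monomial p : 'X_{1..n} := (\sum_j U_(p j) *+ path_exponent G p j)%MM.

Lemma mem_path_ideal (A : fieldType) f : f \in path_ideal A r G <->
  mono_ideal (above (fun p => is_rpath G p) path_monomial) f.
Proof.
have -> : path_ideal A r G = gen_ideal (fun p => is_rpath G p) (fun p => 'X_[path_monomial p])%R.
  congr gen_ideal; apply/funext => p.
  rewrite /path_monomial; elim/big_ind2: _ => [||j _]; first by rewrite mpolyX0.
    by move=> m1 f1 m2 f2 -> ->; rewrite mpolyXD.
  by rewrite mpolyXn.
exact: gen_ideal_monomials.
Qed.

Lemma path_monomialE p j : injective p -> path_monomial p (p j) = path_exponent G p j.
Proof.
move=> p_inj; rewrite /path_monomial mnm_sumE (bigD1 j) //= mulmnE mnm1E eqxx mul1n.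
rewrite big1 ?addn0 // => l lj; rewrite mulmnE mnm1E.
by case: eqP => [/p_inj lj'|_]; rewrite ?mul0n // lj' eqxx in lj *.
Qed.

Lemma path_monomial_out p v : (forall j, p j != v) -> path_monomial p v = 0%N.
Proof.
move=> pv; rewrite /path_monomial mnm_sumE big1 // => j _.
by rewrite mulmnE mnm1E (negPf (pv j)).
Qed.

Definition path_edge p x y := exists2 k, (k < r)%N &
  (x = p (inord k) /\ y = p (inord k.+1)) \/ (y = p (inord k) /\ x = p (inord k.+1)).

Lemma path_edge_sym p x y : path_edge p x y -> path_edge p y x.
Proof. by case=> k kr [[-> ->]|[-> ->]]; exists k => //; [right | left]. Qed.

Lemma path_edge_adj p x y : is_rpath G p -> path_edge p x y -> adj G x y.
Proof.
case/andP => _ /forallP adjp [k kr [[-> ->]|[-> ->]]]; last rewrite adj_sym.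
all: exact: (adjp (Ordinal kr)).
Qed.

Lemma rpath_inj p : is_rpath G p -> injective p.
Proof. by case/andP => /injectiveP. Qed.

(** With [path_monomial_edge] this describes the exponent at x as the largest weight of a path edge
    at x, independently of the position of x on the path. *)
Lemma path_edge_weight p x y : is_rpath G p -> path_edge p x y ->
  (weight G x y <= path_monomial p x)%N.
Proof.
move=> rp; have p_inj := rpath_inj rp.
case=> k kr [[-> ->]|[-> ->]]; rewrite path_monomialE // /path_exponent.
  rewrite (inordK (ltnW kr : k < r.+1)%N); case: eqP => [->//|_].
  by rewrite (ltn_eqF kr) leq_maxr.
rewrite (inordK (kr : k.+1 < r.+1)%N) /=; case: eqP => [kE|_]; last by rewrite weight_sym leq_maxl.
have -> : r.-1 = k by move: kE; lia.
have -> : inord r = inord k.+1 :> 'I_r.+1 by congr inord.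
by rewrite weight_sym.
Qed.

Lemma path_monomial_edge p j : is_rpath G p ->
  exists2 y, path_edge p (p j) y & path_monomial p (p j) = weight G (p j) y.
Proof.
move=> rp; have p_inj := rpath_inj rp; rewrite path_monomialE // /path_exponent.
have jE : p j = p (inord j) by rewrite inord_val.
have jr : (j <= r)%N by rewrite -ltnS.
have up : (j < r)%N -> path_edge p (p j) (p (inord j.+1)) by exists j => //; left.
have down : (0 < j)%N -> path_edge p (p j) (p (inord j.-1)).
  by move=> j0; exists j.-1; [rewrite prednK | right; rewrite prednK].
case: eqP => [j0|/eqP]; first by exists (p (inord j.+1)); [apply: up; rewrite j0 | rewrite jE j0].
rewrite -lt0n => j0; case: eqP => [jr'|/eqP jr'].
  by exists (p (inord j.-1)); [exact: down | rewrite jE jr' weight_sym].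
case: (leqP (weight G (p (inord j.-1)) (p j)) (weight G (p j) (p (inord j.+1)))) => _.
  by exists (p (inord j.+1)) => //; apply: up; rewrite ltn_neqAle jr'.
by exists (p (inord j.-1)); [exact: down | rewrite weight_sym].
Qed.

Lemma path_monomial_pos p j : is_rpath G p -> (0 < path_monomial p (p j))%N.
Proof.
by move=> rp; have [y /(path_edge_adj rp) adjy ->] := path_monomial_edge j rp; apply: weight_gt0.
Qed.

Lemma path_crossing p (Y : {set 'I_n}) j l : p j \in Y -> p l \notin Y ->
  exists x y, [/\ path_edge p x y, x \in Y & y \notin Y].
Proof.
move=> pj pl; apply: contrapT => nex.
have step k : (k < r)%N -> (p (inord k) \in Y) = (p (inord k.+1) \in Y).
  move=> kr; apply/idP/idP => h; apply: contrapT => /negP nh; apply: nex.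
    by exists (p (inord k)), (p (inord k.+1)); split=> //; exists k => //; left.
  by exists (p (inord k.+1)), (p (inord k)); split=> //; exists k => //; right.
have all0 k : (k <= r)%N -> (p (inord k) \in Y) = (p (inord 0) \in Y).
  by elim: k => // k IHk kr; rewrite -step // IHk // ltnW.
have all (i : 'I_r.+1) : (p i \in Y) = (p (inord 0) \in Y) by have := all0 i (ltn_ord i); rewrite inord_val.
by move: pl; rewrite all -(all j) pj.
Qed.

Lemma rpath_card p (Y : {set 'I_n}) : is_rpath G p -> (forall j, p j \in Y) -> (r < #|Y|)%N.
Proof.
move=> /rpath_inj p_inj pY; rewrite -[r.+1]card_ord -(card_imset _ p_inj).
by apply/subset_leq_card/subsetP => _ /imsetP[j _ ->].
Qed.

(** By induction every path survives into the current graph, so it avoids the leaf pruned next. *)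
Lemma pruned_rpath (W : {set 'I_n}) p : pruned r G W -> is_rpath G p -> forall j, p j \in W.
Proof.
elim=> [_ j|W' v prW IH [_ leaf] rp j]; first by rewrite inE.
have pW := IH rp; rewrite !inE pW andbT; apply/eqP => pj.
pose q : {ffun 'I_r.+1 -> {x | x \in W'}} := [ffun k => exist _ (p k) (pW k)].
apply: (leaf q _ j); last by apply: val_inj; rewrite ffunE.
have /andP[/injectiveP p_inj /forallP adjp] := rp; apply/andP; split.
  by apply/injectiveP => k l; rewrite !ffunE => -[] /p_inj.
by apply/forallP => k; rewrite !ffunE /=.
Qed.

Section Suspension.
Variables (b : nat) (Gamma : wgraph 'I_b) (W : {set 'I_n}) (sW : 'I_b -> 'I_r.+1 -> {x : 'I_n | x \in W}).
Hypotheses (prW : pruned r G W) (susp : path_suspension Gamma (induced G W) sW).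
Hypothesis weight_le : forall i j, adj Gamma i j ->
  (weight G (val (sW i ord0)) (val (sW j ord0)) <=
   minn (weight G (val (sW i ord0)) (val (sW i (inord 1))))
        (weight G (val (sW j ord0)) (val (sW j (inord 1)))))%N.

Let s i k := val (sW i k).

Lemma susp_inj i k j l : s i k = s j l -> i = j /\ k = l.
Proof.
move/val_inj => E.
by have /(_ (i, k) (j, l) E) [-> ->] := bij_inj (susp_vertices susp).
Qed.

Lemma susp_onto v : v \in W -> exists i k, v = s i k.
Proof.
move=> vW; have [g _ gK] := susp_vertices susp.
by exists (g (Sub v vW)).1, (g (Sub v vW)).2; rewrite /s gK.
Qed.

Lemma susp_out v : (forall i k, s i k != v) -> v \notin W.
Proof.
by move=> vs; apply/negP => /susp_onto[i [k vE]]; have := vs i k; rewrite vE eqxx.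
Qed.

Lemma susp_adj_succ i (k l : 'I_r.+1) : l = k.+1 :> nat -> adj G (s i k) (s i l).
Proof.
move=> kl; have kr : (k < r)%N by rewrite -ltnS -kl.
have := susp_path susp i kr; rewrite /= -/(s i _) inord_val.
by congr (adj G _ (val (sW i _))); apply: val_inj; rewrite /= inordK -?kl.
Qed.

(** The neighbours along the whisker already exhaust the prescribed degree. *)
Lemma susp_nbr i (k : 'I_r.+1) y : (0 < k)%N -> y \in W -> adj G (s i k) y ->
  exists2 l : 'I_r.+1, y = s i l & (l = k.+1 :> nat) \/ (k = l.+1 :> nat).
Proof.
move=> k0 yW adjy; pose y' : {x | x \in W} := exist _ y yW.
pose N := [set z | adj (induced G W) (sW i k) z].
have y'N : y' \in N by rewrite inE.
have km : (k.-1 < r.+1)%N by apply: leq_ltn_trans (ltn_ord k); apply: leq_pred.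
pose k' := Ordinal km; have kk' : k = k'.+1 :> nat by rewrite /= prednK.
have k'N : sW i k' \in N by rewrite inE /= adj_sym; apply: (susp_adj_succ i kk').
have kE : k = inord k by rewrite inord_val.
have := ltn_ord k; rewrite ltnS leq_eqVlt => /orP[/eqP kr|kr].
  have kmax : k = ord_max by apply: val_inj.
  have : #|N| = 1%N by rewrite /N kmax; apply: (susp_end_degree susp i).
  move/eqP/cards1P => [z NE]; exists k'; last by right.
  by move: y'N k'N; rewrite NE !inE => /eqP y'z /eqP k'z; rewrite /s k'z -y'z.
have kp : (k.+1 < r.+1)%N by rewrite ltnS.
pose k'' := Ordinal kp.
have k''N : sW i k'' \in N by rewrite inE /=; apply: susp_adj_succ.
have N2 : #|N| = 2%N.
  have := susp_inner_degree susp i (k := k); rewrite k0 kr => /(_ isT).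
  by rewrite inord_val.
have kk : sW i k' != sW i k''.
  apply/eqP => E; have [_ /(congr1 val) /=] : i = i /\ k' = k'' by apply: susp_inj; rewrite /s E.
  by lia.
have NE : [set sW i k'; sW i k''] = N.
  apply/eqP; rewrite eqEcard N2 cards2 kk leqnn andbT.
  by apply/subsetP => z; rewrite in_set2 => /orP[] /eqP ->.
move: y'N; rewrite -NE in_set2 => /orP[] /eqP y'E.
  by exists k'; [rewrite /s -y'E | right].
by exists k''; [rewrite /s -y'E | left].
Qed.

Lemma susp_adj i k j l : adj G (s i k) (s j l) ->
  (i = j /\ ((l = k.+1 :> nat) \/ (k = l.+1 :> nat))) \/ (k = ord0 /\ l = ord0).
Proof.
move=> adjs; have [k0|k0] := posnP k; last first.
  have [l' /susp_inj[-> ->] kl] := susp_nbr k0 (valP (sW j l)) adjs.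
  by left.
have [l0|l0] := posnP l; first by right; split; apply: val_inj.
rewrite adj_sym in adjs; have [k' /susp_inj[-> ->] kl] := susp_nbr l0 (valP (sW i k)) adjs.
by left; split=> //; case: kl; [right | left].
Qed.

Let wpath i : {ffun 'I_r.+1 -> 'I_n} := [ffun k => s i k].

Lemma wpath_rpath i : is_rpath G (wpath i).
Proof.
apply/andP; split; first by apply/injectiveP => k l; rewrite !ffunE => /susp_inj[].
apply/forallP => k; rewrite !ffunE; apply: susp_adj_succ.
by have := ltn_ord k => kr; rewrite !inordK //; lia.
Qed.

Lemma wpath_edge i (k l : 'I_r.+1) : l = k.+1 :> nat -> path_edge (wpath i) (s i k) (s i l).
Proof.
move=> kl; exists k; first by rewrite -ltnS -kl.
by left; rewrite !ffunE inord_val -kl inord_val.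
Qed.

Let a i k := path_monomial (wpath i) (s i k).

Lemma wpath_monomial i (k : 'I_r.+1) : exists2 l : 'I_r.+1,
  (l = k.+1 :> nat) \/ (k = l.+1 :> nat) & a i k = weight G (s i k) (s i l).
Proof.
have skE : s i k = wpath i k by rewrite ffunE.
have [y ey aE] := path_monomial_edge k (wpath_rpath i).
rewrite -skE in ey aE; case: ey => m mr; rewrite !ffunE => -[[/susp_inj[_ kE] yE]|[yE /susp_inj[_ kE]]].
  exists (inord m.+1); last by rewrite /a aE yE.
  by left; rewrite kE !inordK //; lia.
exists (inord m); last by rewrite /a aE yE.
by right; rewrite kE !inordK //; lia.
Qed.

Lemma weight_le_wpath i (k l : 'I_r.+1) : (l = k.+1 :> nat) \/ (k = l.+1 :> nat) ->
  (weight G (s i k) (s i l) <= a i k)%N.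
Proof.
case=> kl; apply: (path_edge_weight (wpath_rpath i)); first exact: wpath_edge.
by apply/path_edge_sym/wpath_edge.
Qed.

(** The exponent is the weight of a path edge at s i k. A whisker edge is accounted for in a i k,
    and an edge between bases is bounded by the first edge of whisker i. *)
Lemma susp_monomial_le p i k : is_rpath G p -> (path_monomial p (s i k) <= a i k)%N.
Proof.
move=> rp; case: (pickP (fun j => p j == s i k)) => [j /eqP pj|np]; last first.
  by rewrite path_monomial_out // => j; apply/negbT/np.
have [y ey] := path_monomial_edge j rp; rewrite pj in ey * => ->.
have adjy := path_edge_adj rp ey.
have yW : y \in W by case: ey => m _ [[_ ->]|[-> _]]; apply: pruned_rpath.
have [i' [l yE]] := susp_onto yW; rewrite {y ey yW}yE in adjy *.
have [[<- kl]|[k0 l0]] := susp_adj adjy; first exact: weight_le_wpath.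
rewrite {}k0 {}l0 in adjy *.
have /weight_le : adj Gamma i i' by rewrite -(susp_base_adj susp).
rewrite leq_min => /andP[le_w _]; apply: leq_trans le_w _.
by apply: (@weight_le_wpath i ord0 (inord 1)); left; rewrite inordK.
Qed.

(** The vertices of whisker i beyond m number at most r, so a path through one of them has to leave
    this set, and its only exit is the edge between positions m and m + 1. *)
Lemma susp_path_edge p i (k : 'I_r.+1) : is_rpath G p -> (forall j, p j != s i k) \/
  (forall l : 'I_r.+1, (l < k)%N -> path_edge p (s i l) (s i (inord l.+1))).
Proof.
move=> rp; case: (pickP (fun j => p j == s i k)) => [j /eqP pj|np]; last first.
  by left=> j; apply/negbT/np.
right=> m mk; pose Y := [set s i x | x : 'I_r.+1 & (m < x)%N].
have pjY : p j \in Y by rewrite pj; apply/imsetP; exists k; rewrite ?inE.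
have [j' pj'] : exists j', p j' \notin Y.
  apply: contrapT => nex; have : (r < #|Y|)%N.
    by apply: (rpath_card rp) => j'; apply: contrapT => /negP pj'; apply: nex; exists j'.
  rewrite ltnNge => /negP; apply.
  have sub : Y \subset s i @: ~: [set ord0].
    by apply/imsetS/subsetP => x; rewrite !inE => mx; apply: contraTneq mx => ->.
  apply: leq_trans (subset_leq_card sub) _; apply: leq_trans (leq_imset_card _ _) _.
  by have := cardsC [set ord0 : 'I_r.+1]; rewrite cards1 card_ord add1n => -[->].
have [x [y [exy /imsetP[u mu xE] yY]]] := path_crossing pjY pj'.
have yW : y \in W by case: exy => ? _ [[_ ->]|[-> _]]; apply: pruned_rpath.
have [i' [v yE]] := susp_onto yW; rewrite inE in mu.
have := path_edge_adj rp exy; rewrite {1}xE yE => /susp_adj[[ii' uv]|[u0 _]]; last first.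
  by rewrite u0 in mu.
subst i'; have vm : (v <= m)%N.
  by rewrite leqNgt; apply/negP => mv; case/negP: yY; rewrite yE; apply/imsetP; exists v; rewrite ?inE.
have um : u = m.+1 :> nat by case: uv; move: mu vm; lia.
have vm' : v = m by apply: val_inj => /=; case: uv; move: um vm; lia.
apply: path_edge_sym; move: exy; rewrite xE yE vm'.
suff -> : u = inord m.+1 by [].
by apply: val_inj; rewrite /= inordK -um.
Qed.

Lemma suspension_cohen_macaulay (A : fieldType) : cohen_macaulay_ideal (path_ideal A r G).
Proof.
apply: (@filled_cohen_macaulay A n b r s a susp_inj _ (fun p => is_rpath G p) path_monomial).
- by move=> p i k; apply: susp_monomial_le.
- move=> p i k l rp lk pk; apply/eqP; rewrite eqn_leq susp_monomial_le //=.
  have [np|ep] := susp_path_edge i k rp; first by rewrite path_monomial_out in pk.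
  (* The threshold at l is the weight of a whisker edge at l; since l < k, the path runs along that
     edge as well. *)
  have [l' ll' ->] := wpath_monomial i l.
  apply: (path_edge_weight rp); case: ll' => ll'.
    suff -> : l' = inord l.+1 by apply: ep.
    by apply: val_inj; rewrite /= inordK // -ll'.
  apply: path_edge_sym; suff -> : l = inord l'.+1 by apply: ep; rewrite -ltnS -ll' ltnW.
  by apply: val_inj; rewrite /= inordK // -ll'.
- move=> p v rp /susp_out vW; apply: path_monomial_out => j; apply: contraNneq vW => <-.
  exact: pruned_rpath.
- move=> i; exists (wpath i) => [|v]; first exact: wpath_rpath.
  case: (pickP (fun k => v == s i k)) => [k /eqP ->|nv]; first by rewrite (bigD1 k) //= eqxx mul1n leq_addr.
  by rewrite path_monomial_out // => j; rewrite ffunE eq_sym; apply/negbT/nv.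
- by move=> p rp; exists (p ord0); apply: path_monomial_pos.
- exact: mem_path_ideal.
Qed.

End Suspension.
End PathMonomials.

(** * Packings of paths in a tree *)

Section Acyclic.
Variables (T : finType) (e : rel T).
Hypotheses (e_sym : ssrbool.symmetric e) (e_irr : ssrbool.irreflexive e).
Hypothesis acyclic : forall c : seq T, (2 < size c)%N -> ~ ucycle e c.
Implicit Types (x y z : T) (p q s : seq T).

Lemma sorted_rev s : sorted e (rev s) = sorted e s.
Proof. by rewrite rev_sorted; apply: eq_sorted => x y; rewrite e_sym. Qed.

Lemma sorted_cat_cons s1 x s2 : sorted e (s1 ++ x :: s2) = sorted e (rcons s1 x) && path e x s2.
Proof. by case: s1 => [|y s1] //=; rewrite cat_path rcons_path /= andbA. Qed.

Lemma sorted_closed (P : T -> Prop) s x : sorted e s ->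
  (forall y z, y \in s -> z \in s -> e y z -> P y -> P z) ->
  x \in s -> P x -> forall y, y \in s -> P y.
Proof.
move=> srt step xs Px y ys; case: s srt step xs ys => // a s /= pas step xs ys.
have all_a z : z \in a :: s -> P a <-> P z.
  move: pas step => {xs ys}; elim: s a => [|b s IH] a /=.
    by move=> _ _; rewrite inE => /eqP ->.
  case/andP=> eab pbs step; rewrite inE => /orP[/eqP -> //|zs].
  have ab : P a <-> P b.
    by split; apply: step; rewrite ?inE ?eqxx ?orbT // e_sym.
  rewrite ab; apply: IH => // y1 y2 y1s y2s; apply: step; by rewrite inE ?y1s ?y2s orbT.
by apply/(all_a y ys)/(all_a x xs).
Qed.

(** A chord passing over x would close a cycle of at least three vertices. *)
Lemma chord_free s1 x s2 y z : sorted e (s1 ++ x :: s2) -> uniq (s1 ++ x :: s2) ->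
  y \in s1 -> z \in s2 -> ~~ e y z.
Proof.
move=> + + ys1 zs2; case/splitPr: ys1 => p1 p2; case/splitPr: zs2 => q1 q2.
rewrite -catA cat_cons => srt unq; apply/negP => eyz.
apply: (@acyclic (y :: p2 ++ x :: rcons q1 z)); first by rewrite /= size_cat /= size_rcons !addnS.
have eqs : p1 ++ y :: p2 ++ x :: q1 ++ z :: q2 = p1 ++ (y :: p2 ++ x :: rcons q1 z) ++ q2.
  by rewrite /= -catA /= cat_rcons.
rewrite eqs in srt unq; apply/andP; split.
  have : sorted e (y :: p2 ++ x :: rcons q1 z).
    by move: srt => /cat_sorted2[_ /cat_sorted2[]].
  rewrite /= rcons_path => ->; rewrite last_cat /= last_rcons.
  by rewrite e_sym.
by move: unq; rewrite cat_uniq => /and3P[_ _]; rewrite cat_uniq => /and3P[].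
Qed.

Definition spath x p := path e x p && uniq (x :: p).

(** If the first steps differ, the first vertex w of p that lies on q closes a cycle with the
    initial segments of p and q. *)
Lemma spath_unique x p q : spath x p -> spath x q -> last x p = last x q -> p = q.
Proof.
elim: p x q => [|a p IH] x [|b q] //=.
- by move=> _ /andP[_ /andP[xq _]] xE; rewrite xE mem_last in xq.
- by move=> /andP[_ /andP[xp _]] _ xE; rewrite -xE mem_last in xp.
move=> sp sq; have /andP[/andP[exa pa] /andP[xap uap]] := sp.
have /andP[/andP[exb qb] /andP[xbq ubq]] := sq.
have [ab lastE|ab lastE] := eqVneq a b.
  by subst b; congr cons; apply: (IH a) => //; apply/andP; split.
pose P := mem (b :: q); have has_pq : has P (a :: p).
  by apply/hasP; exists (last a p); rewrite /= ?mem_last // lastE mem_last.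
pose i := find P (a :: p); have isz : (i < size (a :: p))%N by rewrite -has_find.
pose w := nth x (a :: p) i; have wq : w \in b :: q := nth_find x has_pq.
pose p1 := take i (a :: p).
have np1 y : y \in p1 -> y \notin b :: q.
  move=> yp1; apply/negP => yq; have : has P p1 by apply/hasP; exists y.
  by rewrite has_take // ltnn.
have p1w : take i.+1 (a :: p) = rcons p1 w by rewrite (take_nth x).
have path1 : path e x (rcons p1 w) by rewrite -p1w; apply: take_path; rewrite /= exa.
have uniq1 : uniq (x :: rcons p1 w).
  by rewrite -p1w -[x :: _]/(take i.+2 (x :: a :: p)) take_uniq //= xap uap.
have qE : exists q1 q2, b :: q = q1 ++ w :: q2 by case/splitPr: wq => q1 q2; exists q1, q2.
have [q1 [q2 {}qE]] := qE.
have path2 : path e x (rcons q1 w).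
  have : path e x (b :: q) by rewrite /= exb.
  by rewrite qE -cat_rcons cat_path => /andP[].
have uniq2 : uniq (x :: rcons q1 w).
  have : uniq (x :: b :: q) by rewrite cons_uniq xbq.
  by rewrite qE -cat_rcons -cat_cons cat_uniq => /and3P[].
have q1q y : y \in q1 -> y \in b :: q by rewrite qE mem_cat => ->.
(* Length at least three: p1 and q1 cannot both be empty, for then a = w = b. *)
case: (@acyclic (x :: p1 ++ w :: rev q1)).
  rewrite /= size_cat /= size_rev addnS !ltnS addn_gt0 !lt0n !size_eq0.
  case: eqP => [p10|//]; case: eqP => // q10; case/eqP: ab.
  have wb : w = b by move: qE; rewrite q10 => -[].
  by rewrite -wb; move: p1w; rewrite p10 /=; case: (i) => [|?] [].
apply/andP; split.
  rewrite /= rcons_cat /= -rev_cons -cat_rcons cat_path path1 last_rcons.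
  have := rev_path e x (rcons q1 w); rewrite last_rcons belast_rcons => ->.
  by rewrite (eq_path (e' := e)) // => u v; rewrite /= e_sym.
move: uniq1 uniq2; rewrite !cons_uniq !mem_rcons !inE !rcons_uniq mem_cat inE mem_rev !negb_or.
move=> /andP[/andP[xw xp1] /andP[wp1 up1]] /andP[/andP[_ xq1] /andP[wq1 uq1]].
rewrite xp1 xw xq1 /= cat_uniq up1 /= mem_rev wq1 rev_uniq uq1 (negPf wp1) /= andbT.
apply/hasPn => y; rewrite mem_rev => yq1; apply/negP => /np1.
by rewrite q1q.
Qed.

Section Rooted.
Variable root : T.
Hypothesis conn : forall x, connect e root x.

Definition rooted (par : T -> T) (dep : T -> nat) :=
  [/\ par root = root,
      forall x, x != root -> e x (par x),
      forall x, x != root -> dep x = (dep (par x)).+1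
    & forall x y, e x y -> (x != root /\ y = par x) \/ (y != root /\ x = par y)].

(** The parent of x is the last vertex but one of the unique simple path from the root to x, the
    depth its length. *)
Lemma rooted_exists : exists par dep, rooted par dep.
Proof.
have /choice[pth pthP] x : exists p, spath root p /\ last root p = x.
  have /connectP[p pp ->] := conn x; case/shortenP: pp => p' pp' up' _.
  by exists p'; rewrite /spath pp'.
have pthE x p : spath root p -> last root p = x -> pth x = p.
  move=> sp lp; apply: (@spath_unique root) => //; first by case: (pthP x).
  by rewrite lp; case: (pthP x).
pose par x := last root (belast root (pth x)).
have belastE p y : last root (belast root (rcons p y)) = last root p.
  by rewrite belast_rcons.
have rcons_pth x : x != root -> exists2 q, pth x = rcons q x & spath root q.
  have [sp lp] := pthP x; case: (lastP (pth x)) sp lp => [|q y] sp; first by move=> /= ->; rewrite eqxx.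
  rewrite last_rcons => yx _; subst y; exists q => //.
  move: sp; rewrite /spath rcons_path -rcons_cons rcons_uniq => /andP[/andP[-> _]].
  by case/andP.
exists par, (fun x => size (pth x)); split.
- by rewrite /par (pthE root [::]).
- move=> x /rcons_pth[q xE _]; rewrite /par xE belastE e_sym.
  by have [/andP[]] := pthP x; rewrite xE rcons_path => /andP[].
- move=> x /rcons_pth[q xE sq]; rewrite /par xE belastE size_rcons.
  by rewrite (pthE (last root q) q).
(* Of two neighbours, one is not on the path to the other: otherwise each of the two paths would be
   a proper initial segment of the other. *)
suff step x y : e x y -> y \notin root :: pth x -> y != root /\ x = par y.
  move=> x y exy; have [yx|yx] := boolP (y \in root :: pth x); last by right; apply: step.
  left; apply: step; first by rewrite e_sym.
  apply/negP => xy.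
  have xyn : x != y by apply: contraTneq exy => ->; rewrite e_irr.
  have [spx lpx] := pthP x; have [spy lpy] := pthP y.
  have prefix u v p : spath root p -> last root p = u -> v \in root :: p -> v != u ->
      exists2 q, pth v = q & (size q < size p)%N.
    move=> sp lp; rewrite inE => /orP[/eqP ->|vp] vu.
      exists [::]; first exact: pthE.
      by case: p sp lp => //= _ ru; rewrite ru eqxx in vu.
    case/splitPr: vp sp lp => p1 p2 sp lp; exists (rcons p1 v).
      apply: pthE; last by rewrite last_rcons.
      move: sp; rewrite /spath -cat_rcons cat_path -cat_cons cat_uniq.
      by case/andP => /andP[-> _] /and3P[-> _ _].
    rewrite size_rcons size_cat /= addnS ltnS -[X in (X < _)%N]addn0 ltn_add2l lt0n size_eq0.
    by apply/eqP => p20; move: lp vu; rewrite p20 last_cat /= => ->; rewrite eqxx.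
  have yxn : y != x by rewrite eq_sym.
  have [q1 q1E lt1] := prefix _ _ _ spx lpx yx yxn.
  have [q2 q2E lt2] := prefix _ _ _ spy lpy xy xyn.
  by move: lt1 lt2; rewrite -q1E -q2E; lia.
move=> exy; rewrite inE negb_or => /andP[yr yp]; split=> //.
have [/andP[pp up] lp] := pthP x.
rewrite /par (pthE y (rcons (pth x) y)) ?belastE ?last_rcons ?lp //.
by rewrite /spath rcons_path pp lp exy -rcons_cons rcons_uniq up inE negb_or yr yp.
Qed.

Section Certificate.
Variables (par : T -> T) (dep : T -> nat).
Hypothesis rtd : rooted par dep.

Definition below v x := exists k, iter k par x = v.

Lemma below_refl v : below v v. Proof. by exists 0%N. Qed.

Lemma below_leave u x y : below u x -> ~ below u y -> e x y -> x = u /\ y = par u.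
Proof.
case=> k ku ny exy; have [_ _ _ /(_ x y exy)[[_ yE]|[_ xE]]] := rtd.
  case: k ku => [|k] ku; first by split=> //; rewrite yE -ku.
  by case: ny; exists k; rewrite yE -iterSr.
by case: ny; exists k.+1; rewrite iterSr -xE.
Qed.

Lemma dep_below v x : below v x -> (dep v <= dep x)%N.
Proof.
case=> k <-; elim: k => //= k IHk; apply: leq_trans IHk.
have [parr _ depS _] := rtd; have [->|/depS ->] := eqVneq (iter k par x) root; first by rewrite parr.
exact: leqnSn.
Qed.

Lemma below_root x : below root x.
Proof.
have [parr _ depS _] := rtd; have [k] := ubnP (dep x); elim: k x => // k IHk x.
rewrite ltnS; have [-> _|xr] := eqVneq x root; first exact: below_refl.
by rewrite depS // => /IHk[l lE]; exists l.+1; rewrite iterSr.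
Qed.

(* A walk that meets the subtree below u and avoids the parent of u stays below u. *)
Lemma sorted_below u s x : sorted e s -> par u \notin s -> x \in s -> below u x ->
  forall y, y \in s -> below u y.
Proof.
move=> srt pus xs bx.
apply: (@sorted_closed (below u) s x) => // y z ys zs eyz byu.
apply: contrapT => nz; have [_ zE] := below_leave byu nz eyz.
by rewrite -zE zs in pus.
Qed.

End Certificate.
End Rooted.
End Acyclic.

(** * Transversals of the paths *)

Section RPathSequences.
Variables (T : finType) (e : rel T) (r : nat).
Hypothesis e_sym : ssrbool.symmetric e.
Implicit Types (x y z : T) (s p q : seq T) (C W Z : {set T}).

Definition rseq s := [&& size s == r.+1, uniq s & sorted e s].

Lemma rseq_rev s : rseq (rev s) = rseq s.
Proof. by rewrite /rseq size_rev rev_uniq sorted_rev. Qed.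

Definition hits C := forall s, rseq s -> has (mem C) s.

Definition min_transversal C := hits C /\ forall x, x \in C ->
  exists2 s, rseq s & x \in s /\ forall y, y \in s -> y \in C -> y = x.

Lemma min_transversal_sub C : hits C -> exists2 C', min_transversal C' & C' \subset C.
Proof.
move=> hitC; have [C' /minsetP[/asboolP hitC' minC'] sub] :=
  @minset_exists T (fun D => `[< hits D >]) C (asboolT hitC).
exists C' => //; split=> // x xC'; apply: contrapT => nex.
suff /minC' E : `[< hits (C' :\ x) >].
  by have := E (subsetDl _ _) => C'E; move: xC'; rewrite -C'E !inE eqxx.
apply/asboolP => s rs; have /hasP[y ys yC'] := hitC' s rs.
apply/hasP; apply: contrapT => nh; apply: nex; exists s => //.
have all_x z : z \in s -> z \in C' -> z = x.
  move=> zs zC'; apply: contrapT => /eqP zx; apply: nh; exists z => //.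
  by rewrite !inE zx.
by split=> //; rewrite -(all_x y ys yC').
Qed.

Lemma hits_compl Z : (forall s, rseq s -> ~ {subset s <= Z}) -> hits (~: Z).
Proof.
move=> nZ s rs; apply/hasP; apply: contrapT => nh; apply: (nZ s rs) => y ys.
by apply: contrapT => yZ; apply: nh; exists y; rewrite //= inE; apply/negP.
Qed.

Section Packing.
Variables (root : T) (par : T -> T) (dep : T -> nat).
Hypothesis rtd : rooted e root par dep.

(* Greedily take a path inside W below a vertex v of largest depth: all paths inside
   W that meet the subtree below v contain v. *)
Lemma packing_in W : exists (Qs : seq (seq T)) C,
  [/\ forall Q, Q \in Qs -> rseq Q /\ {subset Q <= W}, uniq (flatten Qs), (#|C| <= size Qs)%N
    & forall s, rseq s -> {subset s <= W} -> has (mem C) s].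
Proof.
have [N] := ubnP #|W|; elim: N W => // N IH W; rewrite ltnS => WN.
pose good v := `[< exists s, [/\ rseq s, {subset s <= W} & forall y, y \in s -> below par v y] >].
have [[v0 gv0]|none] := pselect (exists v, good v); last first.
  exists [::], set0; split; rewrite ?cards0 // => s rs sW; case: none.
  by exists root; apply/asboolP; exists s; split=> // y _; apply: (below_root rtd).
have [v /asboolP[s [rs sW sv]] vmax] := @arg_maxnP _ v0 good dep gv0.
(* A path that enters the subtree below v without containing v stays below one child of v, a deeper
   good vertex. *)
have meets s' x : rseq s' -> {subset s' <= W} -> x \in s' -> below par v x -> v \in s'.
  move=> rs' s'W xs' bx; apply: contrapT => /negP vs'.
  have xv : x != v by apply: contraNneq vs' => <-.
  have [k kE] : exists k, iter k.+1 par x = v.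
    by case: bx => -[|k] kE; [rewrite /= in kE; rewrite kE eqxx in xv | exists k].
  have [u pu bu] : exists2 u, par u = v /\ u != v & below par u x.
    case: (ex_minnP (ex_intro (fun k => iter k.+1 par x == v) k (introT eqP kE))) => m /eqP mE mmin.
    exists (iter m par x); last by exists m.
    split=> //; apply/eqP => mv; case: m => [|m] in mE mmin mv *.
      by rewrite /= in mv; rewrite mv eqxx in xv.
    by have := mmin m; rewrite /= in mv; rewrite /= mv eqxx ltnn => /(_ isT).
  have [pu1 pu2] := pu; have [parr _ depS _] := rtd.
  have ur : u != root by apply: contraNneq pu2 => ur; rewrite -pu1 ur parr.
  have /vmax : good u.
    apply/asboolP; exists s'; split=> // y ys'.
    by apply: (sorted_below e_sym rtd _ _ xs' bu) ys'; [case/and3P: rs' | rewrite pu1].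
  by rewrite (depS u ur) pu1 /geq /= ltnn.
pose W' := [set x in W | ~~ `[< below par v x >]].
have s0 : exists x, x \in s by case/and3P: rs; case: (s) => // x s' _ _ _; exists x; rewrite mem_head.
have [|Qs [C [QsP uQs CQs hitC]]] := IH W'.
  apply: leq_trans WN; apply: proper_card; apply/properP; split.
    by apply/subsetP => x; rewrite inE => /andP[].
  have [x xs] := s0; exists x; first exact: sW.
  by rewrite inE negb_and negbK; apply/orP; right; apply/asboolP/sv.
exists (s :: Qs), (v |: C); split=> [Q|||s' rs' s'W].
- rewrite inE => /orP[/eqP -> //|/QsP[rQ QW']]; split=> // x /QW'.
  by rewrite inE => /andP[].
- rewrite /= cat_uniq uQs andbT; have /and3P[_ -> _] := rs.
  apply/hasPn => x /flattenP[Q /QsP[_ QW'] /QW']; rewrite inE => /andP[_ nb].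
  by apply/negP => /sv bx; case/asboolP: nb.
- by rewrite cardsU1 /=; apply: leq_trans (leq_add (leq_b1 _) CQs) _; rewrite add1n.
- have [vs'|vs'] := boolP (v \in s'); first by apply/hasP; exists v; rewrite //= !inE eqxx.
  have /hasP[y ys' yC] : has (mem C) s'.
    apply: hitC => // x xs'; rewrite inE s'W //=; apply/asboolP => bx.
    by case/negP: vs'; apply: meets bx.
  by apply/hasP; exists y; rewrite //= inE; apply/orP; right.
Qed.

Lemma packing : exists (Qs : seq (seq T)) C,
  [/\ forall Q, Q \in Qs -> rseq Q, uniq (flatten Qs), (#|C| <= size Qs)%N & hits C].
Proof.
have [Qs [C [QsP uQs CQs hitC]]] := packing_in [set: T].
exists Qs, C; split=> // [Q /QsP[]//|s rs]; apply: hitC => // x _; exact: in_setT.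
Qed.

End Packing.

Section Unmixed.
Variable Qs : seq (seq T).
Hypotheses (Qs_rseq : forall Q, Q \in Qs -> rseq Q) (Qs_uniq : uniq (flatten Qs)).
Hypothesis exact_transversal : forall C, min_transversal C -> (#|C| <= size Qs)%N.

(** C meets each of the disjoint paths Qs and has at most as many elements as there are paths; so it
    has one on each and none elsewhere. *)
Lemma transversal_counts C : min_transversal C ->
  all (fun Q => count (mem C) Q == 1%N) Qs /\ {subset C <= flatten Qs}.
Proof.
move=> minC; have [hitC _] := minC.
have pos Q : Q \in Qs -> (0 < count (mem C) Q)%N by move/Qs_rseq/hitC; rewrite has_count.
pose F := [seq x <- flatten Qs | x \in C].
have uF : uniq F by rewrite filter_uniq.
have FC : {subset F <= C} by move=> x; rewrite mem_filter => /andP[].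
have leF : (size F <= #|C|)%N by rewrite cardE uniq_leq_size // => x /FC; rewrite mem_enum.
have szF : size F = sumn [seq count (mem C) Q | Q <- Qs].
  rewrite size_filter; elim: (Qs) => //= Q Qs' IH.
  by rewrite count_cat IH.
have leQs : (size Qs <= size F)%N.
  rewrite szF; elim: (Qs) pos => //= Q Qs' IH pos; rewrite -add1n leq_add ?pos ?mem_head //.
  by apply: IH => Q' Q's; apply: pos; rewrite inE Q's orbT.
have eqC := exact_transversal minC; split; last first.
  have FCsz : size F = #|C| by apply/eqP; rewrite eqn_leq leF (leq_trans eqC leQs).
  move=> x xC; have : x \in F.
    have FC' : {subset F <= enum C} by move=> y /FC; rewrite mem_enum.
    have [|_ ->] := uniq_min_size uF FC'; last by rewrite mem_enum.
    by rewrite -cardE FCsz.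
  by rewrite mem_filter => /andP[].
have : (sumn [seq count (mem C) Q | Q <- Qs] <= size Qs)%N by rewrite -szF (leq_trans leF).
elim: (Qs) pos => //= Q Qs' IH pos le_sum.
have ge : (size Qs' <= sumn [seq count (mem C) Q0 | Q0 <- Qs'])%N.
  have pos' Q' : Q' \in Qs' -> (0 < count (mem C) Q')%N by move=> Q's; apply: pos; rewrite inE Q's orbT.
  elim: (Qs') pos' => //= Q' Qs'' IH' pos'; rewrite -add1n leq_add ?pos' ?mem_head //.
  by apply: IH' => Q0 Q0s; apply: pos'; rewrite inE Q0s orbT.
have Q1 := pos Q (mem_head _ _).
apply/andP; split; first by rewrite eqn_leq Q1; move: le_sum ge; lia.
apply: IH; last by move: le_sum Q1; lia.
by move=> Q' Q's; apply: pos; rewrite inE Q's orbT.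
Qed.

(** The complement of s without x hits every path, as only r vertices are left out. A minimal
    transversal inside it can meet s only in x, so x lies on a packed path. *)
Lemma rseq_flatten s x : rseq s -> x \in s -> x \in flatten Qs.
Proof.
move=> rs xs; have /and3P[/eqP szs us _] := rs.
have hit : hits (~: [set y in s | y != x]).
  apply: hits_compl => s' /and3P[/eqP szs' us' _] sub.
  suff : (size s' <= size (rem x s))%N by rewrite size_rem // szs szs' /= ltnn.
  apply: uniq_leq_size => // y /sub; rewrite inE => /andP[ys yx].
  by rewrite mem_rem_uniq // !inE yx.
have [C minC /subsetP sub] := min_transversal_sub hit.
have [_ /(_ x)] := transversal_counts minC; apply.
have /hasP[y ys yC] := minC.1 s rs; suff <- : y = x by [].
by apply: contrapT => /eqP yx; have := sub y yC; rewrite !inE ys yx.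
Qed.

Lemma same_member Q C x y : Q \in Qs -> min_transversal C ->
  x \in Q -> y \in Q -> x \in C -> y \in C -> x = y.
Proof.
move=> QQs /transversal_counts[/allP /(_ Q QQs) /= cnt _] xQ yQ xC yC.
apply: contrapT => /eqP xy; have /and3P[_ uQ _] := Qs_rseq QQs.
suff : (1 < count (mem C) Q)%N by rewrite (eqP cnt).
rewrite -size_filter; have : {subset [:: x; y] <= [seq z <- Q | z \in C]}.
  by move=> z; rewrite !inE mem_filter => /orP[] /eqP ->; apply/andP.
by apply: (@uniq_leq_size _ [:: x; y]); rewrite /= inE xy.
Qed.

(* A minimal transversal avoiding Z contains both x and y, but it meets Q once. *)
Lemma private_pair Q x y Rx Ry Z : Q \in Qs -> x != y -> x \in Q -> y \in Q ->
  rseq Rx -> rseq Ry -> x \in Rx -> y \in Ry -> x \notin Ry -> y \notin Rx ->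
  {subset Rx <= x |: Z} -> {subset Ry <= y |: Z} ->
  ~ (forall s, rseq s -> ~ {subset s <= Z}).
Proof.
move=> QQs xy xQ yQ rRx rRy xRx yRy xRy yRx subx suby freeZ.
have [C minC /subsetP CZ] := min_transversal_sub (hits_compl freeZ).
have only v R : rseq R -> {subset R <= v |: Z} -> v \in C.
  move=> rR sub; have /hasP[w wR wC] := minC.1 R rR.
  have := sub w wR; rewrite !inE => /orP[/eqP <- //|wZ].
  by have := CZ w wC; rewrite inE wZ.
by case/eqP: xy; apply: same_member QQs minC _ _ _ _ => //; [apply: only subx | apply: only suby].
Qed.

End Unmixed.
End RPathSequences.

(** * Edges between the packed paths *)

Section WhiskerStructure.
Variables (T : finType) (e : rel T) (r : nat).
Hypothesis e_sym : ssrbool.symmetric e.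
Hypothesis acyclic : forall c : seq T, (2 < size c)%N -> ~ ucycle e c.
Implicit Types (x y z q : T) (s L R B M : seq T).
Local Notation rseq := (rseq e r).

Lemma split_size s k : (k <= size s)%N -> exists s1 s2, s = s1 ++ s2 /\ size s1 = k.
Proof. by move=> ks; exists (take k s), (drop k s); rewrite cat_take_drop size_takel. Qed.

Lemma sorted_color (f : T -> nat) (Z s : seq T) :
  (forall x y, x \in Z -> y \in Z -> e x y -> f x = f y) ->
  sorted e s -> {subset s <= Z} -> exists c, forall x, x \in s -> f x = c.
Proof.
move=> fZ srt sZ; case: s => [|a s] in srt sZ *; first by exists 0%N.
exists (f a) => x xs; apply: (sorted_closed e_sym (P := fun x => f x = f a) srt _ (mem_head a s)) => //.
by move=> y z ys zs eyz <-; apply/esym/fZ; rewrite ?sZ.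
Qed.

(** Edges inside Z preserve the colour f, so a path in Z would be monochromatic, and a colour has at
    most r vertices. *)
Lemma split_free (f : T -> nat) (Z : seq T) :
  (forall x y, x \in Z -> y \in Z -> e x y -> f x = f y) ->
  (forall c, (count (fun z => f z == c) Z <= r)%N) -> forall s, rseq s -> ~ {subset s <= Z}.
Proof.
move=> fZ cnt s /and3P[/eqP szs us srt] sZ; have [c cs] := sorted_color fZ srt sZ.
suff : (size s <= count (fun z => f z == c) Z)%N by move/leq_trans/(_ (cnt c)); rewrite szs ltnn.
rewrite -size_filter; apply: uniq_leq_size => // x xs.
by rewrite mem_filter cs // eqxx sZ.
Qed.

(* A path meets at most two of the legs of a spider. *)
Lemma spider_free q (f : T -> nat) (Z : seq T) :
  (forall x y, x \in Z -> y \in Z -> e x y -> f x = f y) ->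
  (forall c, (c < 3)%N -> (count (fun z => f z != c) Z < r)%N) ->
  forall s, rseq s -> ~ {subset s <= q :: Z}.
Proof.
move=> fZ cnt s /and3P[/eqP szs us srt] sZ.
(* Without q the path falls into at most two monochromatic stretches, so one of three colours is
   missing; the remaining vertices are fewer than r, and q makes them at most r. *)
have avoid : exists2 c, (c < 3)%N & forall x, x \in s -> x != q -> f x != c.
  suff [c1 [c2 c12]] : exists c1 c2, forall x, x \in s -> x != q -> f x = c1 \/ f x = c2.
    have [c c3 [cc1 cc2]] : exists2 c, (c < 3)%N & c1 != c /\ c2 != c.
      pose c := if (c1 != 0) && (c2 != 0) then 0%N else if (c1 != 1) && (c2 != 1) then 1%N else 2%N.
      exists c; first by rewrite /c; do !case: ifP.
      by rewrite /c; case: ifP; first lia; case: ifP; lia.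
    by exists c => // x xs xq; case: (c12 x xs xq) => ->.
  have sub (p : seq T) : {subset p <= s} -> q \notin p -> {subset p <= Z}.
    move=> ps qp x xp; have := sZ x (ps x xp); rewrite inE => /orP[/eqP xq|//].
    by rewrite -xq xp in qp.
  have [qs|qs] := boolP (q \in s); last first.
    have [c cs] := sorted_color fZ srt (sub s (fun x => id) qs).
    by exists c, c => x xs _; left; apply: cs.
  case/splitPr: qs us srt sub => p1 p2 us srt sub.
  have [srt1 srt2] := cat_sorted2 srt; rewrite cat_uniq /= in us.
  have /and3P[_ /norP[qp1 _] /andP[qp2 _]] := us.
  have [|c1 cs1] := sorted_color fZ srt1 (sub p1 _ qp1); first by move=> x xp; rewrite mem_cat xp.
  have [|c2 cs2] := sorted_color fZ (path_sorted srt2) (sub p2 _ qp2).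
    by move=> x xp; rewrite mem_cat inE xp !orbT.
  exists c1, c2 => x; rewrite mem_cat inE => /or3P[xp|->//|xp] _; [left|right].
    exact: cs1.
  exact: cs2.
have [c c3 cs] := avoid; have := cnt c c3; rewrite ltnNge => /negP; apply.
have szq : (r <= size [seq x <- s | x != q])%N.
  rewrite size_filter; have := count_predC (pred1 q) s; rewrite szs count_uniq_mem //.
  rewrite (@eq_count _ (fun x => x != q) (predC (pred1 q))) //.
  by case: (q \in s); rewrite /= ?add0n ?add1n; [case=> -> | move=> ->].
apply: leq_trans szq _; rewrite -[leqRHS]size_filter; apply: uniq_leq_size; first exact: filter_uniq.
move=> x; rewrite !mem_filter => /andP[xq xs]; rewrite cs //=.
by have := sZ x xs; rewrite inE (negPf xq).
Qed.

Lemma arm L z R : rseq (L ++ z :: R) -> exists B,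
  [/\ path e z B, uniq (z :: B), {subset z :: B <= L ++ z :: R} & size B = maxn (size L) (size R)].
Proof.
case/and3P=> _ us srt; case: (leqP (size L) (size R)) => _.
  exists R; move: us srt; rewrite cat_uniq sorted_cat_cons => /and3P[_ _ uR] /andP[_ pR].
  by split=> // x xR; rewrite mem_cat xR orbT.
exists (rev L); rewrite size_rev; have := sorted_rev e_sym (L ++ z :: R); rewrite srt rev_cat rev_cons.
rewrite -cats1 -catA /= sorted_cat_cons => /andP[_ pL]; split=> //.
  have : uniq (rev (L ++ z :: R)) by rewrite rev_uniq.
  by rewrite rev_cat rev_cons -cats1 -catA cat_uniq => /and3P[].
by move=> x; rewrite inE mem_rev mem_cat inE => /orP[] ->; rewrite ?orbT.
Qed.

(** N is r; l, m and l', m' are the numbers of vertices on the two sides of q and of z. Two legs of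
    the spider have k vertices beside q, the third has t vertices from z on, z included. The sum k +
    1 + t = N makes one more vertex, a leg, q and the third leg an r-path; the strict bounds by l
    and m leave room for that vertex, and 2k < N bounds the two legs on the path of q. *)
Lemma spider_sizes (l m l' m' N : nat) : (l + m = N)%N -> (l' + m' = N)%N ->
  (minn l' m' <= minn l m)%N -> (0 < minn l m)%N -> exists t k,
  [/\ (t <= (maxn l' m').+1)%N, (k.+1 + t = N)%N, (k < l)%N, (k < m)%N & (k + k < N)%N].
Proof.
move=> lm lm'; have := addn_min_max l' m'; rewrite lm'; move: (minn l' m') (maxn l' m') => a b ab.
rewrite leq_min => /andP[al am]; rewrite leq_min => /andP[l0 m0].
exists (N - (maxn a 1))%N, (maxn a 1).-1.
have [a0|a1] := posnP a; first by rewrite a0 /= in ab *; split; lia.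
by rewrite (maxn_idPl a1); split; lia.
Qed.

Section Packed.
Variable Qs : seq (seq T).
Hypotheses (Qs_rseq : forall Q, Q \in Qs -> rseq Q) (Qs_uniq : uniq (flatten Qs)).
Hypothesis exact_transversal : forall C, min_transversal e r C -> (#|C| <= size Qs)%N.

Lemma Qs_disjoint Q Q' x : Q \in Qs -> Q' \in Qs -> x \in Q -> x \in Q' -> Q = Q'.
Proof.
elim: (Qs) Qs_uniq => //= Q0 Qs' IH; rewrite cat_uniq => /and3P[_ /hasPn disj uQs].
rewrite !inE => /orP[/eqP ->|QQs] /orP[/eqP ->|Q'Qs] // xQ xQ'; last exact: IH.
  by have := disj x (introT flattenP (ex_intro2 _ _ Q' Q'Qs xQ')); rewrite /= xQ.
by have := disj x (introT flattenP (ex_intro2 _ _ Q QQs xQ)); rewrite /= xQ'.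
Qed.

(* Otherwise truncate the arms of the spider with centre q formed by L, R and the
   longer half of the other path starting at z: it contains no path, but each of
   two vertices of Q completes it to one. *)
Lemma inner_edge L q R L' z R' : L ++ q :: R \in Qs -> L' ++ z :: R' \in Qs ->
  L ++ q :: R != L' ++ z :: R' -> e q z ->
  (minn (size L') (size R') <= minn (size L) (size R))%N -> minn (size L) (size R) = 0%N.
Proof.
move=> QQs Q'Qs QQ' eqz ba; apply/eqP; rewrite -leqn0 leqNgt; apply/negP => a0.
have rQ := Qs_rseq QQs; have /and3P[/eqP szQ uQ srtQ] := rQ.
have rQ' := Qs_rseq Q'Qs; have /and3P[/eqP szQ' _ _] := rQ'.
rewrite size_cat /= addnS in szQ; rewrite size_cat /= addnS in szQ'.
have [B [pB uB BQ' szB]] := arm rQ'.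
have disj x : x \in L ++ q :: R -> x \notin z :: B.
  by move=> xQ; apply/negP => /BQ' xQ'; case/eqP: QQ'; apply: Qs_disjoint xQ xQ'.
case: szQ szQ' => szQ [szQ'].
have [t [k [tB kt kL kR k2]]] := spider_sizes szQ szQ' ba a0; rewrite -szB in tB.
have [|M [M0 [ME szM]]] := @split_size (z :: B) t; first exact: tB.
have [L0 [x [L1 [LE szL1]]]] : exists L0 x L1, L = L0 ++ x :: L1 /\ size L1 = k.
  have [|L0 [[|x L1] [LE szL0]]] := @split_size L (size L - k.+1); first exact: leq_subr.
    by move: kL szL0; rewrite LE cats0; clear; lia.
  by exists L0, x, L1; split=> //; move: kL szL0; rewrite LE size_cat /=; clear; lia.
have [R1 [y [R0 [RE szR1]]]] : exists R1 y R0, R = R1 ++ y :: R0 /\ size R1 = k.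
  have [|R1 [[|y R0] [RE szR1]]] := @split_size R k; first exact: ltnW.
    by move: kR; rewrite RE cats0 szR1 ltnn.
  by exists R1, y, R0.
have srtB : path e q (z :: B) by rewrite /= eqz.
have full1 : sorted e (L ++ q :: z :: B) /\ uniq (L ++ q :: z :: B).
  split; first by move: srtQ; rewrite !sorted_cat_cons srtB => /andP[-> _].
  rewrite -cat_rcons cat_uniq uB andbT; move: uQ; rewrite -cat_rcons cat_uniq => /and3P[-> _ _].
  rewrite andTb; apply/hasPn => v vB; apply: contraL vB => vL; apply: disj.
  by rewrite -cat_rcons mem_cat vL.
have full2 : sorted e (rev R ++ q :: z :: B) /\ uniq (rev R ++ q :: z :: B).
  have := sorted_rev e_sym (L ++ q :: R); rewrite srtQ.
  have := rev_uniq (L ++ q :: R); rewrite uQ.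
  rewrite rev_cat rev_cons -cats1 -catA /= => uQr srtQr.
  split; first by move: srtQr; rewrite !sorted_cat_cons srtB => /andP[-> _].
  rewrite -cat_rcons cat_uniq uB andbT; move: uQr; rewrite -cat_rcons cat_uniq => /and3P[-> _ _].
  rewrite andTb; apply/hasPn => v vB; apply: contraL vB => vL; apply: disj.
  by move: vL; rewrite mem_rcons inE mem_rev mem_cat inE => /orP[] ->; rewrite ?orbT.
have full1E : L ++ q :: z :: B = L0 ++ (x :: L1 ++ q :: M) ++ M0.
  by rewrite ME LE -!catA /= -!catA.
have full2E : rev R ++ q :: z :: B = rev R0 ++ (y :: rev R1 ++ q :: M) ++ M0.
  by rewrite ME RE rev_cat rev_cons -cats1 -!catA /= -!catA.
have rRx : rseq (x :: L1 ++ q :: M).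
  have [srt unq] := full1; rewrite full1E in srt unq; apply/and3P; split.
  - by rewrite /= size_cat /= szL1 szM; apply/eqP; move: kt; clear; lia.
  - by move: unq; rewrite cat_uniq => /and3P[_ _]; rewrite cat_uniq => /and3P[].
  - by have [_ /cat_sorted2[]] := cat_sorted2 srt.
have rRy : rseq (y :: rev R1 ++ q :: M).
  have [srt unq] := full2; rewrite full2E in srt unq; apply/and3P; split.
  - by rewrite /= size_cat /= size_rev szR1 szM; apply/eqP; move: kt; clear; lia.
  - by move: unq; rewrite cat_uniq => /and3P[_ _]; rewrite cat_uniq => /and3P[].
  - by have [_ /cat_sorted2[]] := cat_sorted2 srt.
have disjL v : v \in L -> v \notin q :: R.
  by move: uQ; rewrite cat_uniq => /and3P[_ /hasPn h _] vL; apply/negP => /h; rewrite /= vL.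
have sL1 v : v \in L1 -> v \in L by move=> vL; rewrite LE mem_cat inE vL !orbT.
have sR1 v : v \in R1 -> v \in R by move=> vR; rewrite RE mem_cat vR.
have sM v : v \in M -> v \in z :: B by move=> vM; rewrite ME mem_cat vM.
have LQ v : v \in L -> v \in L ++ q :: R by move=> vL; rewrite mem_cat vL.
have RQ v : v \in R -> v \in L ++ q :: R by move=> vR; rewrite mem_cat inE vR !orbT.
have LM v : v \in L -> v \notin M by move=> /LQ/disj; apply: contra => /sM.
have RM v : v \in R -> v \notin M by move=> /RQ/disj; apply: contra => /sM.
have LR v : v \in L -> v \notin R by move=> /disjL; rewrite inE => /norP[].
have xL : x \in L by rewrite LE mem_cat mem_head orbT.
have yR : y \in R by rewrite RE mem_cat mem_head orbT.
have xq : x != q by have := disjL x xL; rewrite inE => /norP[].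
have yq : y != q.
  move: uQ; rewrite cat_uniq /= => /and3P[_ _ /andP[qR _]].
  by apply: contraNneq qR => <-.
have n12 u v : u \in L1 -> v \in R1 -> ~~ e u v.
  by move=> /sL1 uL /sR1 vR; apply: (chord_free e_sym acyclic srtQ uQ).
have n13 u v : u \in L1 -> v \in M -> ~~ e u v.
  by move=> /sL1 uL /sM vB; apply: (chord_free e_sym acyclic full1.1 full1.2).
have n23 u v : u \in R1 -> v \in M -> ~~ e u v.
  move=> /sR1 uR /sM vB; apply: (chord_free e_sym acyclic full2.1 full2.2) => //.
  by rewrite mem_rev.
(* The legs have k, k and t vertices, any two of them together fewer than r, and by [chord_free] no
   edge joins two legs. *)
pose Z := L1 ++ R1 ++ M.
pose f v := if v \in L1 then 0%N else if v \in R1 then 1%N else 2%N.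
have fL v : v \in L1 -> f v = 0%N by rewrite /f => ->.
have fR v : v \in R1 -> f v = 1%N.
  move=> vR; rewrite /f vR ifF //; apply/negP => /sL1/LR; by rewrite sR1.
have fM v : v \in M -> f v = 2%N.
  move=> vM; rewrite /f !ifF //; apply/negP; first by move/sR1/RM; rewrite vM.
  by move/sL1/LM; rewrite vM.
have fZ u v : u \in Z -> v \in Z -> e u v -> f u = f v.
  have evu : e v u = e u v by rewrite e_sym.
  rewrite !mem_cat => /or3P[] uZ /or3P[] vZ euv.
  - by rewrite !fL.
  - by have := n12 _ _ uZ vZ; rewrite euv.
  - by have := n13 _ _ uZ vZ; rewrite euv.
  - by have := n12 _ _ vZ uZ; rewrite evu euv.
  - by rewrite !fR.
  - by have := n23 _ _ uZ vZ; rewrite euv.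
  - by have := n13 _ _ vZ uZ; rewrite evu euv.
  - by have := n23 _ _ vZ uZ; rewrite evu euv.
  - by rewrite !fM.
have cnt c : (c < 3)%N -> (count (fun v => f v != c) Z < r)%N.
  have c0 l d : (forall v, v \in l -> f v = d) -> count (fun v => f v != d) l = 0%N.
    move=> fl; apply/eqP; rewrite -leqn0 leqNgt -has_count; apply/hasPn => v /fl ->.
    by rewrite eqxx.
  have cs l d : (count (fun v => f v != d) l <= size l)%N by apply: count_size.
  case: c => [|[|[|//]]] _; rewrite !count_cat.
  - by rewrite (c0 _ _ fL); have := cs R1 0%N; have := cs M 0%N; move: kt; rewrite szR1 szM; clear; lia.
  - by rewrite (c0 _ _ fR); have := cs L1 1%N; have := cs M 1%N; move: kt; rewrite szL1 szM; clear; lia.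
  - by rewrite (c0 _ _ fM); have := cs L1 2%N; have := cs R1 2%N; move: k2; rewrite szL1 szR1; clear; lia.
apply: (private_pair Qs_rseq Qs_uniq exact_transversal QQs (x := x) (y := y) _ _ _ rRx rRy
  (Z := [set v in q :: Z])).
- by apply: contraTneq xL => ->; apply/negP => /LR; rewrite yR.
- exact: LQ.
- exact: RQ.
- exact: mem_head.
- exact: mem_head.
- rewrite inE mem_cat mem_rev inE !negb_or xq (LM x xL) andbT /=; apply/andP; split.
    by apply: contraTneq xL => ->; apply/negP => /LR; rewrite yR.
  by rewrite andbT; apply: contra (LR x xL) => /sR1.
- rewrite inE mem_cat inE !negb_or yq (RM y yR) andbT /=; apply/andP; split.
    by apply: contraTneq yR => ->; apply: LR.
  by rewrite andbT; apply/negP => /sL1 /LR; rewrite yR.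
- by move=> v; rewrite !inE !mem_cat inE => /or4P[]->; rewrite ?orbT.
- by move=> v; rewrite !inE !mem_cat mem_rev inE => /or4P[]->; rewrite ?orbT.
- move=> s rs sub; apply: (spider_free (q := q) fZ cnt rs) => v /sub; by rewrite inE.
Qed.

End Packed.
End WhiskerStructure.

Section WhiskerBases.
Variables (T : finType) (e : rel T) (r : nat).
Hypotheses (e_sym : ssrbool.symmetric e) (r_gt0 : (0 < r)%N).
Hypothesis acyclic : forall c : seq T, (2 < size c)%N -> ~ ucycle e c.
Implicit Types (x y z q : T) (s L R B M : seq T).
Local Notation rseq := (rseq e r).
Variable Qs : seq (seq T).
Hypotheses (Qs_rseq : forall Q, Q \in Qs -> rseq Q) (Qs_uniq : uniq (flatten Qs)).
Hypothesis exact_transversal : forall C, min_transversal e r C -> (#|C| <= size Qs)%N.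

(** Apply [inner_edge] at the endpoint with the larger minimum. If that is z, its minimum would be
    0, yet exceed the minimum at q; so it is q, which must be an end. *)
Lemma edge_ends Q Q' q z : Q \in Qs -> Q' \in Qs -> Q != Q' -> q \in Q -> z \in Q' -> e q z ->
  exists B, Q = q :: B \/ Q = rev (q :: B).
Proof.
move=> QQs Q'Qs QQ' qQ zQ' eqz.
have QE : exists L R, Q = L ++ q :: R by case/splitPr: qQ => L R; exists L, R.
have Q'E : exists L R, Q' = L ++ z :: R by case/splitPr: zQ' => L R; exists L, R.
have [L [R QE']] := QE; have [L' [R' Q'E']] := Q'E; subst Q Q'.
suff : minn (size L) (size R) = 0%N.
  case: L {QE QQ' QQs qQ} => [|a L] /=; first by exists R; left.
  case: R => [_|b R]; last by rewrite minnSS.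
  by exists (rev (a :: L)); right; rewrite rev_cons revK /= cats1.
have [ba|ab] := leqP (minn (size L') (size R')) (minn (size L) (size R)).
  exact: (inner_edge e_sym acyclic Qs_rseq Qs_uniq exact_transversal QQs Q'Qs QQ' eqz ba).
rewrite eq_sym in QQ'; rewrite e_sym in eqz.
have b0 := inner_edge e_sym acyclic Qs_rseq Qs_uniq exact_transversal Q'Qs QQs QQ' eqz (ltnW ab).
by move: ab; rewrite b0.
Qed.

Lemma end_arm Q q B : Q \in Qs -> Q = q :: B \/ Q = rev (q :: B) ->
  [/\ path e q B, uniq (q :: B), (q :: B) =i Q & size B = r].
Proof.
move=> QQs QE; have : rseq (q :: B).
  by case: QE (Qs_rseq QQs) => -> //; rewrite rseq_rev.
case/and3P=> /eqP[szB] uB pB; split=> // x.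
by case: QE => ->; rewrite ?mem_rev.
Qed.

(** If Q' = Q'', the two edges close a cycle. Otherwise let M and M' be the first r vertices of Q'
    and Q'' counted from z and w. No edge joins them, so their union contains no path, whereas q0
    completes M and qr completes M': a [private_pair] on Q. *)
Lemma one_attached_end Q q0 m qr Q' Q'' z w : Q \in Qs -> Q' \in Qs -> Q'' \in Qs ->
  Q = q0 :: rcons m qr -> Q != Q' -> Q != Q'' -> z \in Q' -> w \in Q'' ->
  e q0 z -> ~~ e qr w.
Proof.
move=> QQs Q'Qs Q''Qs QE QQ' QQ'' zQ' wQ'' e0z; apply/negP => erw.
have q0Q : q0 \in Q by rewrite QE mem_head.
have qrQ : qr \in Q by rewrite QE inE mem_rcons mem_head orbT.
have Q'Q : Q' != Q by rewrite eq_sym.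
have Q''Q : Q'' != Q by rewrite eq_sym.
have [B /(end_arm Q'Qs)[pB uB BQ' szB]] : exists B, Q' = z :: B \/ Q' = rev (z :: B).
  by apply: edge_ends Q'Qs QQs Q'Q zQ' q0Q _; rewrite e_sym.
have [B2 /(end_arm Q''Qs)[pB2 uB2 BQ'' szB2]] : exists B, Q'' = w :: B \/ Q'' = rev (w :: B).
  by apply: edge_ends Q''Qs QQs Q''Q wQ'' qrQ _; rewrite e_sym.
have /and3P[_ uQ srtQ] := Qs_rseq QQs.
have disj Q1 Q2 : Q1 \in Qs -> Q2 \in Qs -> Q1 != Q2 -> forall x, x \in Q1 -> x \notin Q2.
  by move=> h1 h2 n12 x x1; apply: contra n12 => x2; apply/eqP; apply: (Qs_disjoint Qs_uniq h1 h2 x1 x2).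
have uQr : uniq (rev Q) by rewrite rev_uniq.
have [Q'E|Q'Q''] := eqVneq Q' Q''.
  have revQ : rev Q = qr :: rcons (rev m) q0 by rewrite QE rev_cons rev_rcons.
  have srt : sorted e (rev Q ++ z :: B).
    rewrite revQ -rcons_cons cat_rcons sorted_cat_cons; apply/andP; split.
      by rewrite rcons_cons -revQ (sorted_rev e_sym).
    by rewrite /= e0z.
  have unq : uniq (rev Q ++ z :: B).
    rewrite cat_uniq uQr uB andbT andTb; apply/hasPn => x; rewrite BQ' => xQ'.
    by rewrite /= mem_rev; apply: (disj Q' Q Q'Qs QQs Q'Q).
  have wB : w \in z :: B by rewrite BQ' Q'E.
  rewrite revQ in srt unq.
  have [a [s aE]] : exists a s, rcons (rev m) q0 = a :: s.
    by case: (rev m) => [|a s]; [exists q0, [::] | exists a, (rcons s q0)].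
  rewrite aE /= in srt unq.
  have := @chord_free _ _ e_sym acyclic [:: qr] a (s ++ z :: B) qr w srt unq (mem_head _ _).
  by rewrite mem_cat wB orbT erw => /(_ isT).
have [|M [M0 [ME szM]]] := @split_size _ (z :: B) r; first by rewrite /= szB.
have [|M' [M0' [ME' szM']]] := @split_size _ (w :: B2) r; first by rewrite /= szB2.
have sM x : x \in M -> x \in Q' by move=> xM; rewrite -BQ' ME mem_cat xM.
have sM' x : x \in M' -> x \in Q'' by move=> xM; rewrite -BQ'' ME' mem_cat xM.
have rRx : rseq (q0 :: M).
  apply/and3P; split; first by rewrite /= szM.
    rewrite /= (contra (sM q0)) ?(disj _ _ QQs Q'Qs) //=.
    by move: uB; rewrite ME cat_uniq => /and3P[].
  have : path e q0 (z :: B) by rewrite /= e0z.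
  by rewrite ME cat_path => /andP[].
have rRy : rseq (qr :: M').
  apply/and3P; split; first by rewrite /= szM'.
    rewrite /= (contra (sM' qr)) ?(disj _ _ QQs Q''Qs) //=.
    by move: uB2; rewrite ME' cat_uniq => /and3P[].
  have : path e qr (w :: B2) by rewrite /= erw.
  by rewrite ME' cat_path => /andP[].
have q0r : q0 != qr by move: uQ; rewrite QE /= mem_rcons inE => /andP[/norP[]].
pose S := rev (z :: B) ++ q0 :: (rcons m qr ++ w :: B2).
have SE : S = rev (z :: B) ++ Q ++ w :: B2 by rewrite /S QE.
have srtS : sorted e S.
  rewrite /S sorted_cat_cons; apply/andP; split.
    by rewrite -rev_cons (sorted_rev e_sym) /= e0z.
  rewrite cat_path last_rcons /= erw pB2 !andbT.
  by move: srtQ; rewrite QE.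
have uS : uniq S.
  rewrite SE cat_uniq rev_uniq uB andTb cat_uniq uQ uB2 andbT andTb; apply/andP; split.
    apply/hasPn => x; rewrite mem_cat /= mem_rev BQ' BQ'' => /orP[xQ|xQ''].
      exact: (disj Q Q' QQs Q'Qs QQ').
    by apply: (disj Q'' Q' Q''Qs Q'Qs); rewrite // eq_sym.
  by apply/hasPn => x; rewrite BQ'' => xQ''; apply: (disj Q'' Q Q''Qs QQs Q''Q).
have nMM' x y : x \in M -> y \in M' -> ~~ e x y.
  move=> xM yM'; apply: (chord_free e_sym acyclic srtS uS); first by rewrite mem_rev ME mem_cat xM.
  by rewrite mem_cat ME' mem_cat yM' orbT.
have Mdisj x : x \in M' -> x \notin M.
  move=> /sM' xQ''; apply/negP => /sM xQ'; case/eqP: Q'Q''.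
  exact: (Qs_disjoint Qs_uniq Q'Qs Q''Qs xQ' xQ'').
pose f v := nat_of_bool (v \in M); pose Z := M ++ M'.
have fM v : v \in M -> f v = 1%N by rewrite /f => ->.
have fM' v : v \in M' -> f v = 0%N by rewrite /f => /Mdisj/negPf ->.
have fZ u v : u \in Z -> v \in Z -> e u v -> f u = f v.
  have evu : e v u = e u v by rewrite e_sym.
  rewrite !mem_cat => /orP[] uZ /orP[] vZ euv.
  - by rewrite !fM.
  - by have := nMM' _ _ uZ vZ; rewrite euv.
  - by have := nMM' _ _ vZ uZ; rewrite evu euv.
  - by rewrite !fM'.
have cnt c : (count (fun v => f v == c) Z <= r)%N.
  have cs l d : (count (fun v => f v == d) l <= size l)%N by apply: count_size.
  have c0 l d d' : (forall v, v \in l -> f v = d) -> d != d' -> count (fun v => f v == d') l = 0%N.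
    move=> fl dd'; apply/eqP; rewrite -leqn0 leqNgt -has_count; apply/hasPn => v /fl ->.
    exact: dd'.
  rewrite count_cat; case: c => [|c].
    by rewrite (c0 _ _ _ fM) // add0n -szM'; apply: cs.
  by rewrite (c0 _ _ _ fM') // addn0 -szM; apply: cs.
apply: (private_pair Qs_rseq Qs_uniq exact_transversal QQs q0r q0Q qrQ rRx rRy (Z := [set v in Z])).
- exact: mem_head.
- exact: mem_head.
- by rewrite inE negb_or q0r; apply: contra (sM' q0) _; apply: (disj _ _ QQs Q''Qs).
- by rewrite inE negb_or eq_sym q0r; apply: contra (sM qr) _; apply: (disj _ _ QQs Q'Qs).
- by move=> v; rewrite !inE !mem_cat => /orP[]->; rewrite ?orbT.
- by move=> v; rewrite !inE !mem_cat => /orP[]->; rewrite ?orbT.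
- by move=> s rs sub; apply: (split_free e_sym fZ cnt rs) => v /sub; rewrite inE.
Qed.

(** The base is qr if it has an edge to another packed path, and q0 otherwise. *)
Lemma whisker_orientation Q : Q \in Qs -> exists v B,
  [/\ rseq (v :: B), (v :: B) =i Q &
      forall Q' x z, Q' \in Qs -> Q != Q' -> x \in B -> z \in Q' -> ~~ e x z].
Proof.
move=> QQs; have rQ := Qs_rseq QQs; have /and3P[/eqP szQ uQ _] := rQ.
have [q0 [m [qr QE]]] : exists q0 m qr, Q = q0 :: rcons m qr.
  case: (Q) szQ => [//|q0 Q1] [szQ1]; case/lastP: Q1 szQ1 => [r0|m qr _]; last by exists q0, m, qr.
  by move: r_gt0; rewrite -r0.
have revQ : rev Q = qr :: rcons (rev m) q0 by rewrite QE rev_cons rev_rcons.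
have ends x Q' z : Q' \in Qs -> Q != Q' -> x \in Q -> z \in Q' -> e x z -> x = q0 \/ x = qr.
  move=> Q'Qs QQ' xQ zQ' exz; have [B [QB|QB]] := edge_ends QQs Q'Qs QQ' xQ zQ' exz.
    by left; move: QE; rewrite QB => -[].
  by right; move: revQ; rewrite QB revK => -[].
have [[Q' [z [Q'Qs QQ' zQ' erz]]]|none] :=
    pselect (exists Q' z, [/\ Q' \in Qs, Q != Q', z \in Q' & e qr z]).
  exists qr, (rcons (rev m) q0); rewrite -revQ.
  split; [by rewrite rseq_rev | by move=> x; rewrite mem_rev | ].
  move=> Q1 x z1 Q1Qs QQ1 xB z1Q1; apply/negP => exz.
  have xQ : x \in Q by rewrite -mem_rev revQ inE xB orbT.
  have [xE|xE] := ends x Q1 z1 Q1Qs QQ1 xQ z1Q1 exz.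
    rewrite xE in exz.
    by have := one_attached_end QQs Q1Qs Q'Qs QE QQ1 QQ' z1Q1 zQ' exz; rewrite erz.
  have : uniq (rev Q) by rewrite rev_uniq.
  by rewrite revQ cons_uniq -xE xB.
exists q0, (rcons m qr); rewrite -QE; split=> // Q1 x z1 Q1Qs QQ1 xB z1Q1; apply/negP => exz.
have xQ : x \in Q by rewrite QE inE xB orbT.
have [xE|xE] := ends x Q1 z1 Q1Qs QQ1 xQ z1Q1 exz.
  by move: uQ; rewrite QE cons_uniq -xE xB.
by case: none; exists Q1, z1; rewrite -xE.
Qed.

End WhiskerBases.

(** * Vertices on paths and pruning of the others *)

Section OnPath.
Variables (T : finType) (e : rel T) (r : nat).
Hypothesis e_sym : ssrbool.symmetric e.
Implicit Types (x y z u : T) (s p q : seq T).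

Definition on_path x := exists2 s, rseq e r s & x \in s.

Lemma window s x : sorted e s -> uniq s -> (r < size s)%N -> x \in s -> on_path x.
Proof.
move=> srt us rs xs; pose i := index x s; have isz : (i < size s)%N by rewrite index_mem.
(* The window starts at x unless it would then run past the end of s. *)
pose m := minn i (size s - r.+1).
have im : (i - m < r.+1)%N by rewrite /m; move: isz rs; clear; lia.
have mi : (m <= i)%N by rewrite /m geq_minl.
have mr : (r < size s - m)%N by rewrite /m; move: rs; clear; lia.
exists (take r.+1 (drop m s)).
  apply/and3P; split; [by rewrite size_takel // size_drop | by rewrite take_uniq ?drop_uniq | ].
  by apply/take_sorted/drop_sorted.
have xE : nth x (take r.+1 (drop m s)) (i - m) = x by rewrite nth_take // nth_drop subnKC // nth_index.
by rewrite -{1}xE mem_nth // size_takel // size_drop.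
Qed.

Lemma half_arm s z : rseq e r s -> z \in s -> exists B,
  [/\ path e z B, uniq (z :: B), {subset z :: B <= s} & (r <= (size B).*2)%N].
Proof.
move=> rs zs; case/splitPr: zs rs => L R rs; have [B [pB uB sub szB]] := arm e_sym rs.
exists B; split=> //; have /and3P[/eqP + _ _] := rs.
by rewrite size_cat /= addnS szB => -[<-]; clear; lia.
Qed.

Variables (root : T) (par : T -> T) (dep : T -> nat).
Hypothesis rtd : rooted e root par dep.

Lemma traject_spath k u : (forall j, (j < k)%N -> iter j par u != root) ->
  [/\ path e u (traject par (par u) k), uniq (u :: traject par (par u) k)
    & forall x, x \in traject par (par u) k -> (dep x < dep u)%N].
Proof.
elim: k u => // k IH u nroot; have [_ epar depS _] := rtd.
have ur : u != root := nroot 0%N isT.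
have [|pu uu du] := IH (par u); first by move=> j jk; rewrite -iterSr; apply: nroot.
have dlt x : x \in traject par (par u) k.+1 -> (dep x < dep u)%N.
  rewrite inE => /orP[/eqP ->|/du]; first by rewrite (depS u ur).
  by move/ltn_trans; apply; rewrite (depS u ur).
split=> //; first by rewrite /= epar.
by rewrite cons_uniq uu andbT; apply/negP => /dlt; rewrite ltnn.
Qed.

(* Two half paths, one below u and one above, and the chain of ancestors of u
   between them form a long path through the parent of u. *)
Lemma on_path_par u : on_path root -> u != root -> on_path u -> on_path (par u).
Proof.
move=> onr ur [P1 rP1 uP1]; apply: contrapT => npu.
(* k is the distance from u to its first proper ancestor on a path; the root is a candidate. *)
have exk : exists k, `[< (0 < k)%N /\ on_path (iter k par u) >].
  have [k kE] := below_root rtd u; exists k; apply/asboolP; rewrite kE; split=> //.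
  by case: k kE => // uE; rewrite -uE eqxx in ur.
case: (ex_minnP exk) => k /asboolP[k0 [P0 rP0 zP0]] kmin.
have nonp j : (0 < j)%N -> (j < k)%N -> ~ on_path (iter j par u).
  by move=> j0 jk onj; have := kmin j (asboolT (conj j0 onj)); rewrite leqNgt jk.
have nroot j : (j < k)%N -> iter j par u != root.
  case: j => // j jk; apply/eqP => jr; apply: (nonp j.+1) => //; by rewrite jr.
have [pq uq dq] := traject_spath nroot; set q := traject par (par u) k in pq uq dq.
have lq : last u q = iter k par u by rewrite last_traject.
have puP1 : par u \notin P1 by apply/negP => puP1; apply: npu; exists P1.
have puP0 : par u \notin P0 by apply/negP => puP0; apply: npu; exists P0.
have below1 : forall y, y \in P1 -> below par u y.
  by apply: (sorted_below e_sym rtd _ puP1 uP1 (below_refl _ _)); case/and3P: rP1.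
have qnb y : y \in q -> ~ below par u y.
  by move=> /dq dy /(dep_below rtd); rewrite leqNgt dy.
have zq : iter k par u \in q.
  by apply/trajectP; exists k.-1; rewrite ?prednK // -iterSr prednK.
have puq : par u \in q by apply/trajectP; exists 0%N.
have below0 y : y \in P0 -> ~ below par u y.
  move=> yP0 by0; apply: (qnb _ zq).
  by apply: (sorted_below e_sym rtd _ puP0 yP0 by0) zP0; case/and3P: rP0.
have [a1 [pa1 ua1 sub1 sz1]] := half_arm rP1 uP1.
have [a2 [pa2 ua2 sub2 sz2]] := half_arm rP0 zP0.
(* The two half paths have together at least r vertices besides their starting points, so with u the
   walk has more than r, and a window of it contains the parent of u. *)
apply: npu; apply: (@window (rev a1 ++ u :: q ++ a2)).
- rewrite sorted_cat_cons -rev_cons (sorted_rev e_sym) /= pa1 cat_path pq lq.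
  exact: pa2.
- have a1b y : y \in a1 -> below par u y by move=> ya; apply/below1/sub1; rewrite inE ya orbT.
  have a2b y : y \in a2 -> ~ below par u y by move=> ya; apply/below0/sub2; rewrite inE ya orbT.
  have a2q y : y \in a2 -> y \notin u :: q.
    move=> ya2; rewrite inE negb_or; apply/andP; split.
      by apply/eqP => yu; apply: (a2b y ya2); rewrite yu; apply: below_refl.
    apply/trajectP => -[j jk yE]; have [jk'|] := ltnP j.+1 k.
      apply: (nonp j.+1) => //; rewrite iterSr -yE; exists P0 => //.
      by apply: sub2; rewrite inE ya2 orbT.
    move=> kj; have kE : k = j.+1 by apply/eqP; rewrite eqn_leq kj jk.
    by move: ua2; rewrite cons_uniq kE iterSr -yE ya2.
  have ua1' : uniq a1 by move: ua1; rewrite cons_uniq => /andP[].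
  have ua2' : uniq a2 by move: ua2; rewrite cons_uniq => /andP[].
  rewrite cat_uniq rev_uniq -cat_cons ua1' andTb; apply/andP; split.
    apply/hasPn => y; rewrite mem_cat inE => /orP[/orP[/eqP ->|yq]|ya2];
      rewrite /= mem_rev; apply/negP => ya1.
    + by move: ua1; rewrite cons_uniq ya1.
    + by apply: (qnb y yq); apply: a1b.
    + by apply: (a2b y ya2); apply: a1b.
  rewrite cat_uniq uq andTb ua2' andbT.
  by apply/hasPn => y /a2q.
- rewrite size_cat size_rev /= size_cat size_traject; move: sz1 sz2; clear; lia.
- by rewrite mem_cat inE mem_cat puq !orbT.
Qed.

End OnPath.

Section Pruning.
Variables (n r : nat) (G : wgraph 'I_n) (root : 'I_n) (par : 'I_n -> 'I_n) (dep : 'I_n -> nat).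
Hypothesis rtd : rooted (adj G) root par dep.
Variable U : {set 'I_n}.
Hypotheses (root_U : root \in U) (par_U : forall x, x \in U -> par x \in U)
  (rpath_U : forall p, is_rpath (r := r) G p -> forall j, p j \in U).

(** A deepest vertex x of W outside U has no child in W: a child would be deeper, hence in U, and
    then x would be in U as its parent. So x is a leaf, and it is on no path. *)
Lemma pruned_to W : pruned r G W -> U \subset W -> (forall x, x \in W -> par x \in W) -> pruned r G U.
Proof.
have [N] := ubnP #|W :\: U|; elim: N W => // N IH W; rewrite ltnS => WN prW UW parW.
have [/eqP|[x0 x0WU]] := set_0Vmem (W :\: U).
  by rewrite setD_eq0 => WU; have -> : U = W by apply/eqP; rewrite eqEsubset UW.
have [x xWU xmax] := @arg_maxnP _ x0 (fun x => x \in W :\: U) dep x0WU.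
have {}xmax y : y \in W :\: U -> (dep y <= dep x)%N by exact: xmax.
move: (xWU); rewrite inE => /andP[xU xW].
have [parr epar depS certP] := rtd.
have xr : x != root by apply: contraNneq xU => ->.
have child y : y \in W -> y != root -> par y != x.
  move=> yW yr; apply/eqP => yx; have [yU|yU] := boolP (y \in U).
    by case/negP: xU; rewrite -yx par_U.
  by have := xmax y; rewrite inE yU yW => /(_ isT); rewrite (depS y yr) yx ltnn.
pose v : {x | x \in W} := exist _ x xW.
have leaf : pathless_leaf r (induced G W) v.
  split=> [|p rp j pj].
    have pxW := parW x xW; rewrite /degree.
    have -> : [set y | adj (induced G W) v y] = [set exist _ (par x) pxW].
      apply/setP => y; rewrite !inE /=; apply/idP/eqP => [axy|->]; last exact: epar.
      apply: val_inj => /=; have [[_ ->] //|[yr xE]] := certP _ _ axy.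
      by have := child _ (valP y) yr; rewrite -xE eqxx.
    exact: cards1.
  have /andP[/injectiveP p_inj /forallP adjp] := rp.
  pose q : {ffun 'I_r.+1 -> 'I_n} := [ffun k => val (p k)].
  have rq : is_rpath G q.
    apply/andP; split; first by apply/injectiveP => k l; rewrite !ffunE => /val_inj/p_inj.
    by apply/forallP => k; rewrite !ffunE; apply: adjp.
  by have := rpath_U rq j; rewrite ffunE pj /= (negPf xU).
apply: (IH (W :\ x)).
- apply: leq_trans WN; apply: proper_card; apply/properP; split.
    by apply/subsetP => y; rewrite !inE => /and3P[-> _ ->].
  by exists x; rewrite ?xWU // !inE eqxx andbF.
- exact: (pruned_leaf prW leaf).
- by apply/subsetP => y yU; rewrite !inE (subsetP UW) // andbT; apply: contraNneq xU => <-.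
- move=> y; rewrite !inE => /andP[yx yW]; rewrite parW // andbT.
  by have [->|yr] := eqVneq y root; [rewrite parr eq_sym | apply: child].
Qed.

End Pruning.

(** * The suspension structure of a tree with an m-unmixed path ideal *)

Section TreeWhiskers.
Variables (n r : nat) (G : wgraph 'I_n).
Hypotheses (r_gt0 : (0 < r)%N) (treeG : is_tree G).
Local Notation e := (adj G).
Local Notation is_path := (fun p : {ffun 'I_r.+1 -> 'I_n} => is_rpath G p).
Hypothesis covers_card : forall c d, min_cover is_path (path_monomial G) c ->
  min_cover is_path (path_monomial G) d -> #|cover_support c| = #|cover_support d|.

Let e_sym : ssrbool.symmetric e := adj_sym G.

Lemma tree_acyclic : forall c, (2 < size c)%N -> ~ ucycle e c.
Proof. by case: treeG. Qed.

Lemma rpath_rseq (p : {ffun 'I_r.+1 -> 'I_n}) : is_rpath G p ->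
  exists2 s, rseq e r s & forall v, v \in s <-> exists j, p j = v.
Proof.
move=> rp; have /andP[/injectiveP p_inj /forallP adjp] := rp.
exists (mkseq (fun k => p (inord k)) r.+1) => [|v].
  apply/and3P; split; first by rewrite size_mkseq.
    rewrite map_inj_in_uniq ?iota_uniq // => k l; rewrite !mem_iota /= !add0n => kr lr /p_inj.
    by move/(congr1 val); rewrite /= !inordK.
  apply/(sortedP (p ord0)) => k; rewrite size_mkseq => kr.
  rewrite !nth_mkseq // 1?ltnW //; exact: (adjp (Ordinal (kr : k < r)%N)).
split=> [/mapP[k _ ->]|[j <-]]; first by exists (inord k).
by apply/mapP; exists (j : nat); rewrite ?inord_val // mem_iota /= add0n.
Qed.

Definition seq_path (x0 : 'I_n) (s : seq 'I_n) : {ffun 'I_r.+1 -> 'I_n} := [ffun k : 'I_r.+1 => nth x0 s k].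

Lemma seq_path_rpath x0 s : rseq e r s -> is_rpath G (seq_path x0 s).
Proof.
case/and3P=> /eqP szs us srt; apply/andP; split.
  apply/injectiveP => k l; rewrite !ffunE => /eqP.
  by rewrite nth_uniq ?szs // => /eqP/val_inj.
apply/forallP => k; rewrite !ffunE !inordK ?ltnS //; last by rewrite ltnW.
by have /(sortedP x0) := srt; apply; rewrite szs ltnS.
Qed.

Lemma mem_seq_path x0 s v : rseq e r s -> v \in s -> exists k, seq_path x0 s k = v.
Proof.
case/and3P=> /eqP szs _ _ /(nthP x0)[k]; rewrite szs => kr <-.
by exists (Ordinal kr); rewrite ffunE.
Qed.

Lemma seq_path_mem x0 s k : rseq e r s -> seq_path x0 s k \in s.
Proof. by case/and3P=> /eqP szs _ _; rewrite ffunE mem_nth ?szs. Qed.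

Lemma seq_path_out x0 s v : rseq e r s -> v \notin s -> path_monomial G (seq_path x0 s) v = 0%N.
Proof.
move=> rs vs; apply: path_monomial_out => k; apply: contraNneq vs => <-.
exact: seq_path_mem.
Qed.

(** Take exponent 1 on C. Exponents of path vertices are positive, so this is a cover, and a path
    meeting C only in x has exponent 0 on the rest of C. *)
Lemma min_transversal_cover C : min_transversal e r C ->
  exists2 d, min_cover is_path (path_monomial G) d & cover_support d = C.
Proof.
case=> hitC minC; pose c i := nat_of_bool (i \in C).
have cC : cover_support c = C by apply/setP => i; rewrite inE lt0b.
have [p rp|i|d mind dE] := @support_minimal_cover _ _ is_path (path_monomial G) c;
  last by exists d; rewrite ?dE.
  have [s rs memp] := rpath_rseq rp; have /hasP[v vs vC] := hitC s rs.
  have [j jE] := iffLR (memp v) vs; exists v; rewrite /c (vC : v \in C) /= -jE.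
  exact: path_monomial_pos.
rewrite lt0b => /minC[s rs [is_s only]]; exists (seq_path i s); first exact: seq_path_rpath.
move=> j ji; rewrite lt0b => jC; rewrite /c jC seq_path_out //.
by apply: contra ji => js; rewrite (only j js jC).
Qed.

(** All minimal transversals have the size of one contained in C0, which has at most as many
    vertices as there are packed paths. *)
Lemma exact_packing root par dep : rooted e root par dep -> exists Qs,
  [/\ forall Q, Q \in Qs -> rseq e r Q, uniq (flatten Qs)
    & forall C, min_transversal e r C -> (#|C| <= size Qs)%N].
Proof.
move=> rtd; have [Qs [C0 [rQs uQs C0Qs hitC0]]] := packing r e_sym rtd.
exists Qs; split=> // C minC; apply: leq_trans C0Qs.
have [C1 minC1 sub] := min_transversal_sub hitC0.
have [d mind <-] := min_transversal_cover minC; have [d1 mind1 d1E] := min_transversal_cover minC1.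
by rewrite (covers_card mind mind1) d1E subset_leq_card.
Qed.

Lemma nth_chord x0 s i j : sorted e s -> uniq s -> (i < j)%N -> (j < size s)%N ->
  e (nth x0 s i) (nth x0 s j) -> j = i.+1.
Proof.
move=> srt us ij js eij; apply/eqP; rewrite eqn_leq ij andbT leqNgt; apply/negP => ij1.
have i1s : (i.+1 < size s)%N := ltn_trans ij1 js.
have sE : s = take i.+1 s ++ nth x0 s i.+1 :: drop i.+2 s.
  by rewrite -drop_nth // cat_take_drop.
have yin : nth x0 s i \in take i.+1 s.
  by rewrite -(nth_take _ (ltnSn i)) mem_nth // size_takel // ltnW.
have zin : nth x0 s j \in drop i.+2 s.
  have -> : nth x0 s j = nth x0 (drop i.+2 s) (j - i.+2) by rewrite nth_drop subnKC.
  by rewrite mem_nth // size_drop ltn_sub2r // (leq_ltn_trans ij1 js).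
rewrite sE in srt us.
by have := chord_free e_sym tree_acyclic srt us yin zin; rewrite eij.
Qed.

(* w i = [:: v_i; y_(i,1); ...; y_(i,r)] *)
Lemma whiskers_exist root par dep : rooted e root par dep -> exists b (w : 'I_b -> seq 'I_n),
  [/\ forall i, rseq e r (w i), forall i j x, x \in w i -> x \in w j -> i = j,
      forall x, on_path e r x -> exists i, x \in w i,
      forall i j x z, i != j -> x \in behead (w i) -> z \in w j -> ~~ e x z
    & forall C, min_transversal e r C -> (#|C| <= b)%N].
Proof.
move=> rtd; have [Qs [rQs uQs exact]] := exact_packing rtd.
have uniqQs : uniq Qs.
  elim: (Qs) rQs uQs => //= Q Qs' IH rQ; rewrite cat_uniq => /and3P[_ disj uQs'].
  rewrite IH ?andbT //; last by move=> Q' Q's; apply: rQ; rewrite inE Q's orbT.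
  apply/negP => QQs'; have := rQ Q (mem_head _ _); case/and3P => szQ _ _.
  case: Q szQ disj QQs' rQ => // x Q _ /hasPn disj QQs' _.
  have /disj : x \in flatten Qs' by apply/flattenP; exists (x :: Q); rewrite ?mem_head.
  by rewrite /= mem_head.
pose q (i : 'I_(size Qs)) := tnth (in_tuple Qs) i.
have qQs i : q i \in Qs by apply: mem_tnth.
have q_inj : injective q by apply/tuple_uniqP.
have /choice[w wP] (i : 'I_(size Qs)) : exists w, [/\ rseq e r w, w =i q i &
    forall Q' x z, Q' \in Qs -> q i != Q' -> x \in behead w -> z \in Q' -> ~~ e x z].
  have [v [B [rw wq sep]]] := whisker_orientation e_sym r_gt0 tree_acyclic rQs uQs exact (qQs i).
  by exists (v :: B).
exists (size Qs), w; split=> //.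
- by move=> i; case: (wP i).
- move=> i j x; have [_ -> _] := wP i; have [_ -> _] := wP j => xi xj.
  by apply: q_inj; apply: (Qs_disjoint uQs (qQs i) (qQs j) xi xj).
- move=> x [s rs xs]; have /flattenP[Q QQs xQ] := rseq_flatten rQs uQs exact rs xs.
  have [i QE] : exists i, Q = q i by case/(tnthP (in_tuple Qs)): QQs => i; exists i.
  by exists i; have [_ -> _] := wP i; rewrite -QE.
- move=> i j x z ij xi; have [_ -> _] := wP j; have [_ _ sep] := wP i => zj.
  apply: sep xi zj => //; by apply: contra ij => /eqP/q_inj ->.
Qed.

End TreeWhiskers.

(** * The suspension and the inequality of the weights *)

Section SuspensionOfTree.
Variables (n r : nat) (G : wgraph 'I_n).
Hypotheses (r_gt0 : (0 < r)%N) (treeG : is_tree G).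
Local Notation e := (adj G).
Local Notation is_path := (fun p : {ffun 'I_r.+1 -> 'I_n} => is_rpath G p).
Hypothesis covers_card : forall c d, min_cover is_path (path_monomial G) c ->
  min_cover is_path (path_monomial G) d -> #|cover_support c| = #|cover_support d|.
Variables (root : 'I_n) (par : 'I_n -> 'I_n) (dep : 'I_n -> nat).
Hypotheses (rtd : rooted e root par dep) (root_on_path : on_path e r root).
Variables (b : nat) (w : 'I_b -> seq 'I_n).
Hypotheses (w_rseq : forall i, rseq e r (w i))
  (w_disj : forall i j x, x \in w i -> x \in w j -> i = j)
  (w_all : forall x, on_path e r x -> exists i, x \in w i)
  (w_sep : forall i j x z, i != j -> x \in behead (w i) -> z \in w j -> ~~ e x z)
  (w_exact : forall C, min_transversal e r C -> (#|C| <= b)%N).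
Implicit Types (i j : 'I_b) (k l : 'I_r.+1).

Definition wv i k := nth root (w i) k.

Lemma size_w i : size (w i) = r.+1. Proof. by have /and3P[/eqP] := w_rseq i. Qed.

Lemma wv_mem i k : wv i k \in w i. Proof. by rewrite mem_nth ?size_w. Qed.

Lemma wv_inj i k j l : wv i k = wv j l -> i = j /\ k = l.
Proof.
move=> E; have ij : i = j by apply: (w_disj (wv_mem i k)); rewrite E wv_mem.
subst j; split=> //; apply/val_inj/eqP; have /and3P[_ uw _] := w_rseq i.
by rewrite /= -(nth_uniq root _ _ uw) ?size_w //; apply/eqP.
Qed.

Lemma w_wv i x : x \in w i -> exists k, x = wv i k.
Proof.
by case/(nthP root) => k; rewrite size_w => kr <-; exists (Ordinal kr).
Qed.

Lemma wv_succ i k l : l = k.+1 :> nat -> e (wv i k) (wv i l).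
Proof.
move=> kl; have /and3P[_ _ /(sortedP root) srt] := w_rseq i.
by rewrite /wv kl; apply: srt; rewrite size_w -kl.
Qed.

Lemma wv_adj i k j l : e (wv i k) (wv j l) ->
  (i = j /\ ((l = k.+1 :> nat) \/ (k = l.+1 :> nat))) \/ [/\ i != j, k = ord0 & l = ord0].
Proof.
have behead_mem i' (k' : 'I_r.+1) : k' != ord0 -> wv i' k' \in behead (w i').
  rewrite -lt0n => k0; rewrite /wv -(prednK k0) -nth_behead mem_nth // size_behead size_w /=.
  by rewrite -ltnS prednK.
move=> eij; have [ij|ij] := eqVneq i j; [left | right].
  subst j; split=> //; have /and3P[_ uw srt] := w_rseq i.
  have [kl|kl|kl] := ltngtP k l.
  - left; apply: (nth_chord treeG (x0 := root) srt uw kl _ eij); by rewrite size_w.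
  - by right; apply: (nth_chord treeG (x0 := root) srt uw kl); rewrite ?size_w // adj_sym.
  - by rewrite /wv kl adj_irr in eij.
split=> //; apply: contraTeq eij => k0.
  by apply: (w_sep ij) (wv_mem j l); apply: behead_mem.
by rewrite adj_sym; apply: (w_sep _ _ (wv_mem i k)); [rewrite eq_sym | exact: behead_mem].
Qed.

Definition U : {set 'I_n} := [set x | [exists i, x \in w i]].

Lemma UP x : reflect (on_path e r x) (x \in U).
Proof.
rewrite inE; apply: (iffP existsP) => [[i xi]|/w_all[i xi]]; last by exists i.
by exists (w i).
Qed.

Lemma wv_U i k : wv i k \in U.
Proof. by rewrite inE; apply/existsP; exists i; apply: wv_mem. Qed.

Lemma U_wv x : x \in U -> exists i k, x = wv i k.
Proof. by rewrite inE => /existsP[i /w_wv[k ->]]; exists i, k. Qed.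

Lemma rpath_U p : is_rpath (r := r) G p -> forall k, p k \in U.
Proof.
move=> rp k; apply/UP; have [s rs memp] := rpath_rseq rp.
by exists s => //; apply/memp; exists k.
Qed.

Lemma pruned_U : pruned r G U.
Proof.
have par_U x : x \in U -> par x \in U.
  move=> xU; have [xr|xr] := eqVneq x root; first by rewrite xr; have [-> _ _ _] := rtd; apply/UP.
  by apply/UP/(on_path_par (adj_sym G) rtd) => //; apply/UP.
have root_U : root \in U by apply/UP.
by apply: (pruned_to rtd root_U par_U rpath_U (pruned_none r G));
  [apply: subsetT | move=> x _; apply: in_setT].
Qed.

Definition sU i k : {x : 'I_n | x \in U} := exist _ (wv i k) (wv_U i k).

Definition base_graph : wgraph 'I_b :=
  @WGraph 'I_b (fun i j => adj G (wv i ord0) (wv j ord0))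
    (fun i j => adj_sym G _ _) (fun i => adj_irr G _)
    (fun i j => weight G (wv i ord0) (wv j ord0)) (fun i j => weight_sym G _ _)
    (fun i j => @weight_gt0 _ G _ _).

Lemma wv_degree i k : (0 < k)%N -> [set y | adj (induced G U) (sU i k) y] =
  [set sU i l | l : 'I_r.+1 & (l == k.+1 :> nat) || (k == l.+1 :> nat)].
Proof.
move=> k0; apply/setP => y; rewrite inE; apply/idP/imsetP => [ey|[l]].
  have [j [l yE]] := U_wv (valP y); rewrite /= yE in ey.
  have [[ij kl]|[_ kE _]] := wv_adj ey; last by rewrite kE in k0.
  exists l; last by apply: val_inj; rewrite /= ij yE.
  by rewrite inE; case: kl => ->; rewrite eqxx ?orbT.
rewrite inE => /orP[/eqP kl|/eqP kl] ->; first exact: wv_succ.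
by rewrite /= adj_sym; apply: wv_succ.
Qed.

Lemma sU_inj i : injective (sU i).
Proof. by move=> k l /(congr1 val) /wv_inj[]. Qed.

Lemma tree_path_suspension : path_suspension base_graph (induced G U) sU.
Proof.
split=> [|i k kr|i k /andP[k0 kr]|i|//|//].
- have surj (y : {x : 'I_n | x \in U}) : exists u : 'I_b * 'I_r.+1, sU u.1 u.2 = y.
    by have [i [k yE]] := U_wv (valP y); exists (i, k); apply: val_inj.
  have [g gK] := choice surj; exists g => // -[i k].
  have := gK (sU i k); case: (g (sU i k)) => j l /= /(congr1 val) /wv_inj[-> ->].
  by [].
- by apply: wv_succ; rewrite !inordK // ltnW // ltnS.
- have kE : (inord k : 'I_r.+1) = k :> nat by rewrite inordK // ltnW // ltnS.
  rewrite /degree wv_degree kE // card_imset; last exact: sU_inj.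
  have km : (k.-1 < r.+1)%N by apply: leq_ltn_trans (leq_pred k) _; apply: ltnW.
  have kp : (k.+1 < r.+1)%N by rewrite ltnS.
  have -> : [set l : 'I_r.+1 | (l == k.+1 :> nat) || (k == l.+1 :> nat)] = [set Ordinal km; Ordinal kp].
    apply/setP => l; rewrite !inE -!val_eqE /= orbC; congr (_ || _).
    by rewrite -{1}(prednK k0) eqSS eq_sym.
  by rewrite cards2 -val_eqE /=; move: k0; clear; case: k => //= k _; rewrite (ltn_eqF (ltnW (ltnSn k.+1))).
- rewrite /degree wv_degree // card_imset; last exact: sU_inj.
  have rm : (r.-1 < r.+1)%N by rewrite ltnS leq_pred.
  apply/eqP/cards1P; exists (Ordinal rm); apply/setP => l; rewrite !inE.
  rewrite -!val_eqE /= (ltn_eqF (ltn_ord l)) /=.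
  by rewrite -{1}(prednK r_gt0) eqSS eq_sym.
Qed.

(** For connectedness, climb to the root: parents stay on whiskers, and a step between different
    whiskers joins their bases. A cycle among the bases is a cycle of G. *)
Lemma base_tree : is_tree base_graph.
Proof.
have [i0 root0] := w_all root_on_path.
split=> [|i j|c c3 /andP[cyc uc]].
- by apply/card_gt0P; exists i0.
- have to_root x i' : x \in w i' -> connect (adj base_graph) i' i0.
    have [k] := ubnP (dep x); elim: k x i' => // k IH x i'; rewrite ltnS => xk xi'.
    have [xr|xr] := eqVneq x root.
      by rewrite (w_disj xi' (_ : x \in w i0)) ?connect0 // xr.
    have [_ epar depS _] := rtd.
    have xU : x \in U by rewrite inE; apply/existsP; exists i'.
    have /UP : on_path e r (par x) by apply: (on_path_par (adj_sym G) rtd) => //; apply/UP.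
    case/U_wv => j' [l pE]; have pj : par x \in w j' by rewrite pE wv_mem.
    have cj : connect (adj base_graph) j' i0 by apply: (IH (par x)) pj; rewrite -ltnS -(depS x xr) ltnS.
    have [m xE] := w_wv xi'; have := epar x xr; rewrite {1}xE pE => /wv_adj[[-> _] //|[_ mE lE]].
    by apply: connect_trans cj; apply: connect1; move: (epar x xr); rewrite {1}xE pE mE lE.
  have iw i' : exists x, x \in w i' by exists (wv i' ord0); apply: wv_mem.
  have [x xi] := iw i; have [y yj] := iw j.
  apply: connect_trans (to_root _ _ xi) _.
  have sym : connect_sym (adj base_graph) by apply/sym_connect_sym/adj_sym.
  by rewrite sym; apply: to_root yj.
- apply: (@tree_acyclic n G treeG (map (fun i => wv i ord0) c)); first by rewrite size_map.
  apply/andP; split; last by rewrite map_inj_uniq // => i j /wv_inj[].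
  case: c cyc {c3 uc} => //= i c; rewrite -map_rcons; move: (rcons c i) => s.
  by elim: s i => //= j s IH i /andP[-> /IH].
Qed.

(** Without z the whisker has only r vertices, too few for a path, and the only exits from a whisker
    are at its base. *)
Lemma path_leaves_whisker i p z : is_rpath (r := r) G p -> (exists k, p k \in w i) ->
  z \in w i -> (forall k, p k != z) -> exists2 j, j != i & path_edge p (wv i ord0) (wv j ord0).
Proof.
move=> rp [k pk] zi pz; pose Y := [set x in w i].
have pY : p k \in Y by rewrite inE.
have [k' pk'] : exists k', p k' \notin Y.
  apply: contrapT => nex; have : (r < #|Y :\ z|)%N.
    apply: (rpath_card rp) => k'; rewrite 2!inE pz /=.
    by apply: contrapT => /negP nk'; apply: nex; exists k'.
  have /and3P[_ uw _] := w_rseq i; have cY : #|Y| = r.+1.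
    by rewrite /Y cardsE (card_uniqP uw) size_w.
  by have := cardsD1 z Y; rewrite inE zi cY add1n => -[->]; rewrite ltnn.
have [x [y [exy xY yY]]] := path_crossing pY pk'.
have yU : y \in U by case: exy => m _ [[_ ->]|[-> _]]; apply: rpath_U.
rewrite inE in xY; rewrite inE in yY; have [l xE] := w_wv xY; have [j [l' yE]] := U_wv yU.
have := path_edge_adj rp exy; rewrite {1}xE yE => /wv_adj[[ij _]|[ij l0 l'0]].
  by case/negP: yY; rewrite yE ij wv_mem.
by exists j; [rewrite eq_sym | rewrite l0 in xE; rewrite l'0 in yE; rewrite -xE -yE].
Qed.

Lemma path_edge_mem (p : {ffun 'I_r.+1 -> 'I_n}) x y : path_edge p x y -> exists k, p k = x.
Proof. by case=> k _ [[-> _]|[_ ->]]; eexists. Qed.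

(* Otherwise the cover taking v_i with exponent weight v_i v_j, the ends of the
   whiskers i and j and the bases of the other whiskers has one vertex too many. *)
Lemma base_weight_le i j : adj base_graph i j ->
  (weight G (wv i ord0) (wv j ord0) <= weight G (wv i ord0) (wv i (inord 1)))%N.
Proof.
move=> /= eij; rewrite leqNgt; apply/negP => lt_w.
have ij : i != j by apply: contraTneq eij => ->; rewrite adj_irr.
set v := wv i ord0 in lt_w eij *; set W := weight G v (wv j ord0) in lt_w *.
pose B := [set wv k ord0 | k : 'I_b & (k != i) && (k != j)].
pose S := wv i ord_max |: (wv j ord_max |: B).
pose c x := if x == v then W else nat_of_bool (x \in S).
have max0 : (ord_max : 'I_r.+1) != ord0 by rewrite -val_eqE /= -lt0n.
have wvE i1 k1 i2 k2 : (wv i1 k1 == wv i2 k2) = (i1 == i2) && (k1 == k2).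
  by apply/eqP/andP => [/wv_inj[-> ->] //|[/eqP -> /eqP ->]].
have vS : v \notin S.
  rewrite !inE /v !wvE eqxx (negPf ij) andFb /= eq_sym (negPf max0) /=.
  by apply/imsetP => -[k]; rewrite inE => /andP[ki _] /wv_inj[ik _]; rewrite ik eqxx in ki.
have W0 : (0 < W)%N := leq_ltn_trans (leq0n _) lt_w.
have cS x : x \in S -> c x = 1%N.
  by move=> xS; rewrite /c xS; case: eqP => // xv; rewrite -xv xS in vS.
have supp : cover_support c = v |: S.
  apply/setP => x; rewrite !inE /c; case: eqP => [_|_]; first by rewrite W0.
  by rewrite lt0b !inE.
have cardB : #|B| = b.-2.
  rewrite card_imset; last by move=> k k' /wv_inj[].
  have -> : [set k : 'I_b | (k != i) && (k != j)] = [set: 'I_b] :\ i :\ j.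
    by apply/setP => k; rewrite !inE andbT andbC.
  have := cardsD1 i [set: 'I_b]; rewrite cardsT card_ord inE add1n => bE.
  have := cardsD1 j ([set: 'I_b] :\ i); rewrite !inE eq_sym ij add1n => bE'.
  move: bE bE'; move: #|_ :\ j| #|_ :\ i| => u t; clear; lia.
have card_supp : #|cover_support c| = b.+1.
  have b2 : (1 < b)%N.
    have := ltn_ord i; have := ltn_ord j; move: ij; rewrite -val_eqE /=; clear; lia.
  have nB i' : wv i' ord_max \notin B.
    by apply/imsetP => -[k _] /wv_inj[_ m0]; rewrite m0 eqxx in max0.
  rewrite supp cardsU1 vS cardsU1 cardsU1 cardB nB !inE wvE (negPf ij) /= (negPf (nB i)).
  by rewrite !add1n; case: (b) b2 => [|[|b']].
have hit1 p x : is_rpath (r := r) G p -> (exists k, p k = x) -> x \in S ->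
    exists x, (0 < c x <= path_monomial G p x)%N.
  move=> rp [k <-] pS; exists (p k); rewrite (cS _ pS) /=.
  exact: path_monomial_pos.
(* Consider the whisker of the first vertex of p. If p misses the vertex chosen there, it leaves by
   an edge between bases; the only such edge without an end in S is v_i v_j, and along it the
   exponent at v is at least W. *)
have cov : cover is_path (path_monomial G) c.
  move=> p rp; have [i' [l pE]] := U_wv (rpath_U rp ord0).
  have meet : exists k, p k \in w i' by exists ord0; rewrite pE wv_mem.
  have other (k : 'I_b) : k != i -> k != j -> wv k ord0 \in S.
    by move=> ki kj; rewrite !inE; apply/or3P/Or33/imsetP; exists k; rewrite ?inE ?ki.
  have use z : z \in w i' -> (exists k, p k = z) \/
      exists2 j', j' != i' & path_edge p (wv i' ord0) (wv j' ord0).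
    move=> zi; have [[k pk]|nex] := pselect (exists k, p k = z); first by left; exists k.
    by right; apply: (path_leaves_whisker rp meet zi) => k; apply/eqP => pk; apply: nex; exists k.
  have heavy : path_edge p v (wv j ord0) -> exists x, (0 < c x <= path_monomial G p x)%N.
    by move=> ep; exists v; rewrite /c eqxx W0; apply: path_edge_weight.
  have [ii'|i'i] := eqVneq i' i.
    have [pz|[j' j'i ep]] := use _ (wv_mem i' ord_max).
      by apply: hit1 rp pz _; rewrite ii' !inE eqxx.
    rewrite ii' in j'i ep; have [j'j|j'j] := eqVneq j' j; first by rewrite j'j in ep; apply: heavy.
    by apply: (hit1 p (wv j' ord0)) => //; [apply: path_edge_mem (path_edge_sym ep) | apply: other].
  have [i'j|i'j] := eqVneq i' j.
    have [pz|[j' j'j ep]] := use _ (wv_mem i' ord_max).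
      by apply: hit1 rp pz _; rewrite i'j !inE eqxx orbT.
    rewrite i'j in j'j ep; have [j'i|j'i] := eqVneq j' i.
      by rewrite j'i in ep; apply/heavy/path_edge_sym.
    by apply: (hit1 p (wv j' ord0)) => //; [apply: path_edge_mem (path_edge_sym ep) | apply: other].
  have [pz|[j' _ ep]] := use _ (wv_mem i' ord0); first by apply: hit1 rp pz _; apply: other.
  by apply: (hit1 p (wv i' ord0)) => //; [apply: path_edge_mem ep | apply: other].
have wS i' x : x \in w i' -> x \in S -> [\/ i' = i /\ x = wv i ord_max, i' = j /\ x = wv j ord_max |
    [/\ i' != i, i' != j & x = wv i' ord0]].
  move=> xi; rewrite !inE => /or3P[/eqP xE|/eqP xE|/imsetP[k]].
  - by apply: Or31; split=> //; apply: w_disj xi _; rewrite xE wv_mem.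
  - by apply: Or32; split=> //; apply: w_disj xi _; rewrite xE wv_mem.
  - rewrite inE => /andP[ki kj] xE; have -> : i' = k by apply: w_disj xi _; rewrite xE wv_mem.
    by apply: Or33.
have private p x : is_rpath (r := r) G p -> (0 < c x)%N ->
    (forall y, y \in S -> (exists k, p k = y) -> y = x) ->
    (x != v -> (path_monomial G p v < W)%N) ->
    exists2 p, is_rpath (r := r) G p & forall y, y != x -> (0 < c y)%N -> (path_monomial G p y < c y)%N.
  move=> rp cx only lt_v; exists p => // y yx cy.
  have [yv|yv] := eqVneq y v; first by rewrite yv /c eqxx; apply: lt_v; rewrite -yv eq_sym.
  have yS : y \in S by move: cy; rewrite /c (negPf yv) lt0b.
  rewrite (cS y yS) path_monomial_out // => k; apply: contra yx => /eqP pk.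
  by apply/eqP/only => //; exists k.
have whisker_out i' y : y \notin w i' -> path_monomial G (seq_path r root (w i')) y = 0%N.
  by apply: seq_path_out (w_rseq i').
have mem_whisker i' y : (exists k, seq_path r root (w i') k = y) -> y \in w i'.
  by case=> k <-; apply: seq_path_mem (w_rseq i').
have cmin x : (0 < c x)%N -> exists2 p, is_rpath (r := r) G p &
    forall y, y != x -> (0 < c y)%N -> (path_monomial G p y < c y)%N.
  move=> cx; have [xv|xv] := eqVneq x v.
    (* v followed by whisker j without its end, the only vertex of S on that whisker. *)
    pose s := v :: take r (w j).
    have wjE : w j = wv j ord0 :: behead (w j) by have := size_w j; rewrite /wv /=; case: (w j).
    have rs : rseq e r s.
      have /and3P[_ uw srt] := w_rseq j; apply/and3P; split.
      - by rewrite /= size_takel // size_w.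
      - rewrite /= take_uniq // andbT; apply/negP => /mem_take vj.
        by case/eqP: ij; apply: w_disj (wv_mem i ord0) vj.
      - have : sorted e (v :: w j) by rewrite wjE /= eij /=; rewrite wjE in srt.
        by rewrite -[s]/(take r.+1 (v :: w j)); apply: take_sorted.
    apply: (private (seq_path r root s)) => //; first exact: seq_path_rpath; last by rewrite xv eqxx.
    move=> y yS [k yk]; have : y \in s by rewrite -yk (seq_path_mem _ _ rs).
    rewrite inE => /orP[/eqP -> //|yt]; have yj := mem_take yt.
    have [[/eqP]|[_ yE]|[_ /eqP]] := wS j y yj yS; rewrite ?eqxx // 1?eq_sym ?(negPf ij) //.
    have /and3P[_ uw _] := w_rseq j; rewrite yE in yt.
    move: yt; rewrite in_take_leq ?size_w //.
    by rewrite /wv index_uniq ?size_w //= ltnn.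
  have xS : x \in S by move: cx; rewrite /c (negPf xv) lt0b.
  have [i' xi] : exists i', x \in w i'.
    move: xS; rewrite !inE => /or3P[/eqP ->|/eqP ->|/imsetP[k _ ->]]; by eexists; apply: wv_mem.
  apply: (private (seq_path r root (w i'))) => //; first exact: seq_path_rpath.
    move=> y yS /mem_whisker yi.
    have [[i1 ->]|[i1 ->]|[i1 i2 ->]] := wS i' x xi xS;
    have [[i3 ->]|[i3 ->]|[i3 i4 ->]] := wS i' y yi yS => //;
    by first [rewrite -i1 -i3 eqxx in ij | rewrite i1 eqxx in i3 | rewrite i1 eqxx in i4
      | rewrite i3 eqxx in i1 | rewrite i3 eqxx in i2].
  (* On whisker i the exponent of v is the weight of its first edge, which [lt_w] puts below W. *)
  move=> _; have [ii'|i'i] := eqVneq i' i; last first.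
    rewrite whisker_out //; apply: contra i'i => vi; apply/eqP.
    by apply: w_disj vi (wv_mem i ord0).
  rewrite ii'; have [k kv] : exists k, seq_path r root (w i) k = v.
    by apply: mem_seq_path (w_rseq i) (wv_mem i ord0).
  have rw := seq_path_rpath root (w_rseq i).
  have [y ey] := path_monomial_edge r_gt0 k rw; rewrite kv in ey * => ->.
  have yi : y \in w i by have [k' <-] := path_edge_mem (path_edge_sym ey); apply: seq_path_mem (w_rseq i).
  have [l yE] := w_wv yi; have := path_edge_adj rw ey; rewrite yE => /wv_adj[[_ kl]|[]]; last by rewrite eqxx.
  suff -> : l = inord 1 by [].
  by apply: val_inj; rewrite /= inordK //; case: kl.
(* A minimal cover supported on b + 1 vertices, against a minimal transversal of at most b
   vertices. *)
have [d mind dE] := support_minimal_cover cov cmin.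
have hitT : hits e r [set: 'I_n].
  by move=> s /and3P[+ _ _]; case: s => // x s _; rewrite /= in_setT.
have [C minC _] := min_transversal_sub hitT.
have [d' mind' d'E] := min_transversal_cover r_gt0 minC.
by have := w_exact minC; rewrite -d'E (covers_card mind' mind) dE card_supp ltnn.
Qed.

End SuspensionOfTree.

(* The hypothesis hI says that G has an r-path, i.e. that the path ideal is
   nonzero: for a tree without r-paths the first two conditions hold and the
   third one fails. *)
Theorem theorem2 (A : fieldType) (n r : nat) (G : wgraph 'I_n)
    (hr : (0 < r)%N) (hG : is_tree G)
    (hI : exists p : {ffun 'I_r.+1 -> 'I_n}, is_rpath G p) :
  let cond_i := cohen_macaulay_ideal (path_ideal A r G) in
  let cond_ii := m_unmixed (path_ideal A r G) in
  let cond_iii :=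
    exists (b : nat) (Gamma : wgraph 'I_b) (W : {set 'I_n})
           (s : 'I_b -> 'I_r.+1 -> {x : 'I_n | x \in W}),
      [/\ is_tree Gamma,
          pruned r G W,
          path_suspension Gamma (induced G W) s
        & forall i j, adj Gamma i j ->
            (weight G (val (s i ord0)) (val (s j ord0)) <=
             minn (weight G (val (s i ord0)) (val (s i (inord 1))))
                  (weight G (val (s j ord0)) (val (s j (inord 1)))))%N] in
  (cond_i <-> cond_ii) /\ (cond_ii <-> cond_iii).
Proof.
move=> cond_i cond_ii cond_iii.
have i_ii : cond_i -> cond_ii.
  move=> CM; apply: (min_covers_m_unmixed (mem_path_ideal r G (A := A))) => c d.
  apply: (cohen_macaulay_unmixed _ (mem_path_ideal r G (A := A)) CM) => p rp.
  by exists (p ord0); apply: path_monomial_pos.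
have ii_iii : cond_ii -> cond_iii.
  move=> /(m_unmixed_min_covers (mem_path_ideal r G (A := A))) covers_card.
  have [p0 rp0] := hI; have [_ conn _] := hG.
  have root_on_path : on_path (adj G) r (p0 ord0).
    by have [s rs memp] := rpath_rseq rp0; exists s => //; apply/memp; exists ord0.
  have [par [dep rtd]] := rooted_exists (adj_sym G) (adj_irr G) (tree_acyclic hG) (conn (p0 ord0)).
  have [b [w [w_rseq w_disj w_all w_sep w_exact]]] := whiskers_exist hr hG covers_card rtd.
  exists b, (base_graph r G (p0 ord0) w), (U w), (sU (p0 ord0) w_rseq).
  split=> [|||i j ij].
  - exact: (base_tree hG rtd root_on_path w_rseq w_disj w_all w_sep).
  - exact: (pruned_U rtd root_on_path w_rseq w_all).
  - exact: tree_path_suspension.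
  - have le := base_weight_le hr hG covers_card w_rseq w_disj w_all w_sep w_exact.
    rewrite leq_min; apply/andP; split; first exact: le.
    by rewrite weight_sym; apply: le; rewrite adj_sym.
have iii_i : cond_iii -> cond_i.
  case=> b [Gamma [W [s [_ prW susp weight_le]]]].
  exact: (suspension_cohen_macaulay hr prW susp weight_le).
split; split; [exact: i_ii | by move/ii_iii/iii_i | exact: ii_iii | by move/iii_i/i_ii].
Qed.
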